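(* Let $2 \le p < \infty$ and $s < \frac{p-2}{p-1}$. Suppose that $C \subset \mathbb{R}$ is a closed set with $\mathcal{H}^s(C) < \infty$ and that $F \subset \mathbb{R}$ is a closed set such that for $\mathcal{H}^1$-almost every point $y \in F$ there exist $r_y > 0$ and $c_y > 0$ so that for any $0 < r < r_y$ we have $$\mathcal{H}^1(B(y,r) \setminus F) \ge c_y\, r^{(1-s)(p-1)}.$$ Then the set $C \times F \subset \mathbb{R}^2$ is $p$-removable.
   Context: $\mathcal{H}^s$ (for $s \ge 0$) denotes the $s$-dimensional Hausdorff measure (so $\mathcal{H}^1$ on $\mathbb{R}$ is Lebesgue measure), and $B(y,r) = (y-r,y+r)$ in $\mathbb{R}$. For an open set $\Omega \subset \mathbb{R}^2$ and $1 \le p \le \infty$, $W^{1,p}(\Omega)$ consists of those $f \in L^p(\Omega)$ whose weak first order partial derivatives $\partial_i f$ are also in $L^p(\Omega)$. A closed set $E \subset \mathbb{R}^2$ is called $p$-removable (removable for $W^{1,p}$) if it has Lebesgue measure zero and $W^{1,p}(\mathbb{R}^2 \setminus E) = W^{1,p}(\mathbb{R}^2)$ as sets, i.e. every $u \in W^{1,p}(\mathbb{R}^2\setminus E)$, regarded as a function defined almost everywhere on $\mathbb{R}^2$, belongs to $W^{1,p}(\mathbb{R}^2)$. *)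

(* Defs.v *)
From HB Require Import structures.
From mathcomp Require Import all_boot all_order all_algebra.
From mathcomp Require Import all_classical all_reals all_analysis.

Set Implicit Arguments.
Unset Strict Implicit.
Unset Printing Implicit Defensive.

Import Order.TTheory GRing.Theory Num.Theory.
Import numFieldNormedType.Exports.

Local Open Scope classical_set_scope.
Local Open Scope ring_scope.

Definition ediam (R : realType) (V : normedModType R) (A : set V) : \bar R :=
  ereal_sup [set z | exists x y, [/\ A x, A y & z = (`|x - y|)%:E]].

(* The empty set costs nothing, even for s = 0, where a singleton costs
   0 `^ 0 = 1; thus the case s = 0 yields the counting measure. *)
Definition hausdorff_cost (R : realType) (V : normedModType R) (s : R)
    (A : set V) : \bar R :=
  if `[< A = set0 >] then 0%E else (ediam A `^ s)%E.

(* No normalizing constant: for s = 1 and V = R this is Lebesgue outer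
   measure. *)
Definition hausdorff_premeasure (R : realType) (V : normedModType R)
    (s delta : R) (A : set V) : \bar R :=
  ereal_inf [set z | exists U : nat -> set V,
    [/\ A `<=` \bigcup_k U k,
        (forall k, ediam (U k) <= delta%:E)%E
      & z = (\sum_(0 <= k <oo) hausdorff_cost s (U k))%E]].

Definition hausdorff_measure (R : realType) (V : normedModType R) (s : R)
    (A : set V) : \bar R :=
  ereal_sup [set hausdorff_premeasure s delta A | delta in [set d : R | 0 < d]].

Definition lebesgue2 (R : realType) :
    {measure set (measurableTypeR R * measurableTypeR R) -> \bar R} :=
  (@lebesgue_measure R \x @lebesgue_measure R)%E.

Definition basis_vec (R : realType) (i : 'I_2) : R * R :=
  if i == ord0 then (1, 0) else (0, 1).

Definition partial (R : realType) (i : 'I_2) (f : R * R -> R) : R * R -> R :=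
  fun x => 'D_(basis_vec R i) f x.

Fixpoint Ck (R : realType) (k : nat) (f : R * R -> R) : Prop :=
  continuous f /\
  if k is k'.+1 then
    forall i : 'I_2,
      (forall x, derivable f x (basis_vec R i)) /\ Ck k' (partial i f)
  else True.

Definition test_function (R : realType) (Omega : set (R * R))
    (phi : R * R -> R) : Prop :=
  [/\ forall k, Ck k phi,
      compact (closure [set x | phi x != 0])
    & closure [set x | phi x != 0] `<=` Omega].

(* An element of L^p(Omega) is represented by a Borel function; only the values
   on Omega matter, since the restriction u \_ Omega is extended by 0. *)
Definition Lp_on (R : realType) (p : \bar R) (Omega : set (R * R))
    (u : R * R -> R) : Prop :=
  (u \_ Omega) \in Lfun (@lebesgue2 R) p.

Definition weak_partial (R : realType) (Omega : set (R * R)) (i : 'I_2)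
    (u v : R * R -> R) : Prop :=
  forall phi, test_function Omega phi ->
    \int[@lebesgue2 R]_(x in Omega) (u x * partial i phi x) =
    - \int[@lebesgue2 R]_(x in Omega) (v x * phi x).

Definition sobolev1 (R : realType) (p : \bar R) (Omega : set (R * R))
    (u : R * R -> R) : Prop :=
  Lp_on p Omega u /\
  forall i : 'I_2, exists v, Lp_on p Omega v /\ weak_partial Omega i u v.

(* A function in W^{1,p} of the complement of E is only defined off the null
   set E, so that it belongs to W^{1,p}(R^2) when some Borel representative w
   of its class modulo almost everywhere equality on R^2 does. *)
Definition p_removable (R : realType) (p : \bar R) (E : set (R * R)) : Prop :=
  [/\ closed E,
      lebesgue2 R E = 0%E
    & forall u, sobolev1 p (~` E) u ->
        exists w, sobolev1 p setT w /\
          {ae @lebesgue2 R, forall x, u x = w x}].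

(* Main.v *)
(* Let [phi] be a test function and put [g = u phi], [w = v1 phi + u d1 phi],
   [z = v2 phi + u d2 phi], where [(v1, v2)] is the weak gradient of [u] off
   [C x F], all extended by 0; one has to show that [w] and [z] have integral 0.
   Let [K] be a compact piece of [C] containing the relevant abscissas.
   Cutting off in [x] near [K], which is null, gives [int z(x, y) dy = 0] for
   almost every [x], and cutting off in [y] gives [h(y) := int w(x, y) dx = 0]
   for almost every [y] outside [F].  For [y] in [F], cover [K] by finitely many
   intervals of length comparable to [d], with [sum d^s] bounded, and let [a_i] be
   a smooth approximation of the indicator of the i-th interval; outside these
   intervals one integrates by parts as usual, so that
   [h = sum_i (int w a_i dx + int g a_i' dx)].  The jump [G_i(y) = int g a_i' dx]
   has derivative [int z a_i' dx] and equals [- int w a_i dx] off [F], so that the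
   density hypothesis permits to average over [B(y, d) \ F]:
     |G_i(y)| <= avg_(B(y, d) \ F) |int w a_i dx| + int_(B(y, d)) |int z a_i' dx|.
   Instead of Hoelder's inequality one uses [|f| <= t + t^(1-p) |f|^p], with
   [t] a small multiple of [d^(s-1)]; the exponent [(1-s)(p-1)] is the one
   for which the two error terms sum to a quantity with small integral in [y].
   The endpoints of the intervals are chosen with the maximal function, so that
   [|z|^p] has controlled averages near them.  Letting [d] tend to 0 yields
   [h = 0] almost everywhere on [F]. *)

Require Import Defs.
From HB Require Import structures.
From mathcomp Require Import finmap.
From mathcomp Require Import all_boot all_order all_algebra.
From mathcomp Require Import all_classical all_reals all_analysis.
From mathcomp Require Import measurable_realfun ring lra.

Import Order.TTheory GRing.Theory Num.Theory.
Import numFieldNormedType.Exports.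

Local Open Scope classical_set_scope.
Local Open Scope ring_scope.

Set Implicit Arguments.
Unset Strict Implicit.
Unset Printing Implicit Defensive.

Local Notation leb R := (@lebesgue_measure R).
Local Notation mR R := (measurableTypeR R).
Local Notation mR2 R := (measurableTypeR R * measurableTypeR R)%type.

(** * Smooth cutoff functions *)

(** Put k = (1 - s)(p - 1) and t = lam d^(s-1). Then d t = lam d^s, so the main terms add up to a
    multiple of lam M, where M bounds the sums of d^s, while t^(1-p) = lam^(1-p) d^k is offset by
    the lower bound c d^k for the measure of B(y, d) \ F. What is left of the first error is the
    integral of |w|^p over the heights in B(y, d); its integral in y is of order d. In the second
    error, good endpoints give |z|^p |a_i'| a total integral of order 1/d, and integrating in y
    leaves d^k, at most d because s < (p-2)/(p-1) means k > 1. As s < 1, the sums of d tend to 0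
    with the scale although those of d^s do not. The number c and the thresholds depend on y,
    whereas the exceptional null sets must not. Hence the estimates hold almost everywhere with
    these numbers quantified inside, and the error that is integrated in y is kept free of them. For
    almost every y infinitely many scales have a small error, which suffices since the thresholds
    are fixed before the scale. *)

Definition flat (R : realType) (k : nat) (x : R) : R :=
  if x <= 0 then 0 else x ^- k * expR (- x^-1).

(* A syntactic class of C^oo functions that is visibly closed under derivation:
   [flat k]' is a combination of [flat k.+1] and [flat k.+2]. *)
Inductive smooth (R : realType) : (R -> R) -> Prop :=
| smooth_flat k : smooth (flat k)
| smooth_cst c : smooth (fun=> c)
| smoothD f g : smooth f -> smooth g -> smooth (fun x => f x + g x)
| smoothM f g : smooth f -> smooth g -> smooth (fun x => f x * g x)
| smoothV f : (forall x, f x != 0) -> smooth f -> smooth (fun x => (f x)^-1)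
| smooth_affine a c f : smooth f -> smooth (fun x => f (a * x + c)).

Lemma flat_ge0 (R : realType) k (x : R) : 0 <= flat k x.
Proof.
rewrite /flat; case: ifPn => // x0; rewrite mulr_ge0 ?expR_ge0//.
by rewrite invr_ge0 exprn_ge0// ltW// ltNge.
Qed.

Lemma flat_gt0 (R : realType) k (x : R) : 0 < x -> 0 < flat k x.
Proof.
by move=> x0; rewrite /flat leNgt x0/= mulr_gt0 ?expR_gt0// invr_gt0 exprn_gt0.
Qed.

(** The exponential series gives [expR x^-1 >= x^-(k+1) / (k+1)!]. Since the difference quotient of
    [flat k] at 0 is [flat k.+1], this linear bound makes the derivative at 0 exist and vanish. *)
Lemma flat_le (R : realType) k (x : R) : flat k x <= k.+1`!%:R * `|x|.
Proof.
rewrite /flat; case: ifPn => [_|]; first by rewrite mulr_ge0.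
rewrite -ltNge => x0; rewrite gtr0_norm// expRN -invfM.
have xk : 0 < x ^+ k by rewrite exprn_gt0.
rewrite -[leLHS]mul1r ler_pdivrMr ?mulr_gt0 ?expR_gt0//.
have := @expR_ge1Dxn _ x^-1 k; rewrite invr_ge0 => /(_ (ltW x0)) h.
have F0 : (k.+1`!%:R : R) != 0 by rewrite pnatr_eq0 -lt0n fact_gt0.
have E : 1 = k.+1`!%:R * x * (x ^+ k * (x^-1 ^+ k.+1 / k.+1`!%:R)).
  rewrite exprVn [X in X^-1]exprS; field.
  by rewrite F0 gt_eqF// gt_eqF.
rewrite [leLHS]E.
rewrite ler_pM2l ?mulr_gt0 ?ltr0n ?fact_gt0// ler_pM2l//.
by apply: le_trans h; rewrite lerDr.
Qed.

Lemma is_derive_inv (R : realType) (f : R -> R) (x df : R) :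
  f x != 0 -> is_derive x 1 f df ->
  is_derive x 1 (fun y => (f y)^-1) (- (f x) ^- 2 * df).
Proof.
move=> fx0 [dfx <-].
by split; [exact: derivableV|rewrite deriveV].
Qed.

Lemma is_derive_flat (R : realType) k (x : R) :
  is_derive x 1 (flat k) (- k%:R * flat k.+1 x + flat k.+2 x).
Proof.
have [x0|x0|->] := ltgtP x 0.
- have -> : - k%:R * flat k.+1 x + flat k.+2 x = 0.
    by rewrite /flat ltW// mulr0 addr0.
  apply: (@near_eq_is_derive _ _ _ (cst 0)).
  near=> y; rewrite /flat ifT//; apply: ltW.
  by near: y; apply: lt_nbhsl.
- pose g := (fun y : R => (y ^+ k)^-1) * (@expR R \o (fun y => - y^-1)).
  have dk : is_derive x 1 (fun y : R => (y ^+ k)^-1)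
      (- (x ^+ k) ^- 2 * (k%:R * x ^+ k.-1)).
    apply: is_derive_inv; first by rewrite expf_neq0// gt_eqF.
    split; first exact: exprn_derivable.
    by rewrite exp_derive /GRing.scale /= mulr1.
  have di : is_derive x 1 (fun y : R => - y^-1) (x ^- 2).
    have h := @is_derive_inv _ id x 1 (lt0r_neq0 x0) _.
    by apply: (is_derive_eq (is_deriveN _)); rewrite mulr1 opprK.
  have de := @is_derive1_comp _ expR (fun y => - y^-1) x _ _ _ di.
  have dg := @is_deriveM _ _ _ _ _ _ _ _ dk (de _ (is_derive_expR _)).
  apply: (@near_eq_is_derive _ _ _ g).
    near=> y; rewrite /flat ifF//; apply/negbTE; rewrite -ltNge.
    by near: y; apply: lt_nbhsr.
  apply: is_derive_eq.
  rewrite /flat leNgt x0/= /GRing.scale/=.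
  have xk : x ^+ k != 0 by rewrite expf_neq0// gt_eqF.
  have x1 : x != 0 by rewrite gt_eqF.
  move: xk; clear g dk di de dg; case: k => [|k] xk /=.
    by rewrite !exprS !expr0; field; exact: x1.
  have xk' : x ^+ k != 0 by move: xk; rewrite exprS mulf_eq0 negb_or => /andP[].
  by rewrite !exprS; field; rewrite xk'; exact: x1.
- have -> : - k%:R * flat k.+1 0 + flat k.+2 0 = 0 :> R.
    by rewrite /flat lexx mulr0 addr0.
  have c : h^-1 *: (flat k (h *: (1 : R) + 0) - flat k 0) @[h --> 0^'] --> (0 : R).
    have f0 : flat k 0 = 0 :> R by rewrite /flat lexx.
    apply/cvgrPdist_le => e e0; near=> h.
    rewrite f0 sub0r normrN subr0 addr0 /GRing.scale /= mulr1 normrM.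
    have h0 : h != 0 by near: h; exact: nbhs_dnbhs_neq.
    have -> : `|h^-1| * `|flat k h| = `|flat k.+1 h|.
      rewrite /flat; case: ifPn => [|]; first by rewrite normr0 mulr0.
      rewrite -ltNge => hp.
      rewrite -normrM mulrA exprS invfM//.
    rewrite ger0_norm ?flat_ge0//; apply: (le_trans (flat_le _ _)).
    rewrite -ler_pdivlMl ?ltr0n ?fact_gt0//.
    near: h; apply: dnbhs0_le; rewrite mulr_gt0// invr_gt0 ltr0n fact_gt0//.
  by split; [apply/cvg_ex; exists 0|apply/cvg_lim].
Unshelve. all: by end_near. Qed.

Lemma smooth_derive (R : realType) (f : R -> R) : smooth f ->
  exists2 g : R -> R, smooth g & forall x : R, is_derive x 1 f (g x).
Proof.
elim=> [k|c|{}f g sf [f' sf' df] sg [g' sg' dg]|{}f g sf [f' sf' df] sg [g' sg' dg]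
  |{}f f0 sf [f' sf' df]|a c {}f sf [f' sf' df]].
- exists (fun x => - k%:R * flat k.+1 x + flat k.+2 x); last exact: is_derive_flat.
  by apply: smoothD; [apply: smoothM; [exact: smooth_cst|]|]; exact: smooth_flat.
- by exists (fun=> 0) => *; [exact: smooth_cst|exact: is_derive_cst].
- by exists (fun x => f' x + g' x) => *; [exact: smoothD|exact: is_deriveD].
- exists (fun x => f x * g' x + g x * f' x); last by move=> x; exact: is_deriveM.
  by apply: smoothD; exact: smoothM.
- exists (fun x => -1 * ((f x)^-1 * (f x)^-1) * f' x).
    by do !apply: smoothM => //; [exact: smooth_cst|exact: smoothV|exact: smoothV].
  move=> x; apply: (is_derive_eq (is_derive_inv (f0 x) (df x))).
  by rewrite mulN1r expr2 invfM.
- exists (fun x => a * f' (a * x + c)).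
    by apply: smoothM; [exact: smooth_cst|exact: smooth_affine].
  move=> x; have d : is_derive x 1 (fun x : R => a * x + c) a.
    have h : is_derive x 1 (fun x : R => a * x + c) (a *: (1 : R) + 0).
      exact: (@is_deriveD R R R (fun x => a *: x) (cst c)).
    by apply: (is_derive_eq h); rewrite addr0 /GRing.scale /= mulr1.
  by have h := @is_derive1_comp _ f _ x _ _ (df _) d; rewrite mulrC.
Qed.

Lemma smooth_continuous (R : realType) (f : R -> R) : smooth f -> continuous f.
Proof.
move=> /smooth_derive[g _ df] x; apply: differentiable_continuous.
by apply/derivable1_diffP; case: (df x).
Qed.

Lemma le_flat (R : realType) (x y : R) : x <= y -> flat 0 x <= flat 0 y.
Proof.
move=> xy; rewrite /flat; have [y0|y0] := leP y 0.
  by rewrite (le_trans xy y0).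
case: ifPn => [_|]; first by rewrite mulr_ge0 ?expR_ge0// invr_ge0.
rewrite -ltNge => x0; rewrite !expr0 invr1 !mul1r ler_expR lerN2.
by rewrite lef_pV2 ?posrE.
Qed.

(** The quotient [e x / (e x + e (1 - x))] with [e = flat 0]; its denominator is positive since [x]
    or [1 - x] is. After cross-multiplication monotonicity reads
    [e x * e (1 - y) <= e y * e (1 - x)]. The derivative vanishes off [0, 1] and is bounded there by
    compactness. *)
Lemma exists_smooth_step (R : realType) : exists (sg b : R -> R) (B : R),
  [/\ [/\ smooth sg, smooth b & forall x : R, is_derive x 1 sg (b x)],
      [/\ forall x, x <= 0 -> sg x = 0, forall x, 1 <= x -> sg x = 1,
          forall x, 0 <= sg x <= 1 & {homo sg : x y / x <= y}],
      (forall x, x < 0 \/ 1 < x -> b x = 0)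
    & 0 < B /\ forall x, `|b x| <= B].
Proof.
pose e (x : R) := flat 0 x; pose e1 (x : R) := flat 0 (-1 * x + 1).
have e0 x : 0 <= e x by exact: flat_ge0.
have e10 x : 0 <= e1 x by exact: flat_ge0.
have en (x : R) : x <= 0 -> e x = 0 by move=> x0; rewrite /e /flat x0.
have e1n x : 1 <= x -> e1 x = 0 by move=> x1; rewrite /e1 /flat ifT//; lra.
have d0 x : 0 < e x + e1 x.
  have [x0|x0] := ltP 0 x; first by rewrite ltr_pwDl// flat_gt0.
  by rewrite ltr_wpDl// flat_gt0//; lra.
have d1 x : e x + e1 x != 0 by rewrite gt_eqF.
pose sg x := e x * (e x + e1 x)^-1.
have ss : smooth sg.
  have se1 : smooth e1 by apply: smooth_affine; exact: smooth_flat.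
  have se : smooth e by exact: smooth_flat.
  by apply: smoothM => //; apply: smoothV => //; exact: smoothD.
have [b sb db] := smooth_derive ss.
have s0 (x : R) : x <= 0 -> sg x = 0 by move=> x0; rewrite /sg en// mul0r.
have s1 x : 1 <= x -> sg x = 1.
  by move=> x1; rewrite /sg e1n// addr0 divff//; have := d1 x; rewrite e1n// addr0.
have b0 (x : R) : x < 0 \/ 1 < x -> b x = 0.
  move=> h; have [_ <-] := db x; case: h => h.
  - rewrite (@near_eq_derive _ _ _ _ (cst (0 : R))) ?derive_cst//.
    by near=> y; apply: s0; apply: ltW; near: y; exact: lt_nbhsl.
  - rewrite (@near_eq_derive _ _ _ _ (cst (1 : R))) ?derive_cst//.
    by near=> y; apply: s1; apply: ltW; near: y; exact: lt_nbhsr.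
have bc := smooth_continuous sb.
have [c _ hc] := @EVT_max R (fun x => `|b x|) 0 1 ler01 (continuous_subspaceT
  (fun x => continuous_comp (bc x) (@norm_continuous _ _ _))).
exists sg, b, (`|b c| + 1); split => //; last first.
  split=> [|x]; first by rewrite ltr_wpDl.
  have [x0|x0] := ltP x 0; first by rewrite b0 ?normr0 ?addr_ge0//; left.
  have [x1|x1] := ltP 1 x; first by rewrite b0 ?normr0 ?addr_ge0//; right.
  by rewrite ler_wpDr// hc// in_itv/= x0.
split => // [x|x y xy].
  by rewrite /sg divr_ge0 ?(ltW (d0 _))//= ler_pdivrMr// mul1r lerDl.
rewrite /sg ler_pdivrMr// mulrAC ler_pdivlMr// !mulrDr mulrC lerD2l.
have h1 : e x <= e y by exact: le_flat.
have h2 : e1 y <= e1 x by apply: le_flat; lra.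
by apply: ler_pM.
Unshelve. all: by end_near. Qed.

(** * Products of smooth functions of one variable as test functions *)

Lemma CkW (R : realType) k (f : R * R -> R) : Ck k.+1 f -> Ck k f.
Proof.
elim: k f => [|k ih] f; first by case.
move=> [cf h]; split=> // i; have [df dpf] := h i.
by split=> //; exact: ih.
Qed.

Lemma CkD (R : realType) k (f g : R * R -> R) :
  Ck k f -> Ck k g -> Ck k (fun x => f x + g x).
Proof.
elim: k f g => [|k ih] f g [cf hf] [cg hg].
  by split=> // x; apply: cvgD; [exact: cf|exact: cg].
split=> [x|i]; first by apply: cvgD; [exact: cf|exact: cg].
have [df pf] := hf i; have [dg pg] := hg i.
split=> [x|]; first by apply: derivableD.
have -> : partial i (fun x => f x + g x) = (fun x => partial i f x + partial i g x).
  by apply/funext => x; rewrite /partial [LHS]deriveD.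
exact: ih.
Qed.

Lemma partialM (R : realType) i (f g : R * R -> R) x :
  derivable f x (basis_vec R i) -> derivable g x (basis_vec R i) ->
  partial i (fun x => f x * g x) x = f x * partial i g x + g x * partial i f x.
Proof. by move=> df dg; rewrite /partial [LHS]deriveM. Qed.

Lemma CkM (R : realType) k (f g : R * R -> R) :
  Ck k f -> Ck k g -> Ck k (fun x => f x * g x).
Proof.
elim: k f g => [|k ih] f g Cf Cg.
  have [cf _] := Cf; have [cg _] := Cg.
  by split=> // x; apply: cvgM; [exact: cf|exact: cg].
have := Cf; have := Cg => -[cg hg] [cf hf].
split=> [x|i]; first by apply: cvgM; [exact: cf|exact: cg].
have [df pf] := hf i; have [dg pg] := hg i.
split=> [x|]; first by apply: derivableM.
have -> : partial i (fun x => f x * g x) =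
    (fun x => f x * partial i g x + g x * partial i f x).
  by apply/funext => x; rewrite partialM.
by apply: CkD; apply: ih => //; exact: CkW.
Qed.

Lemma Ck_cst (R : realType) k (c : R) : Ck k (fun=> c : R).
Proof.
elim: k c => [|k ih] c; first by split=> // x; exact: cvg_cst.
split=> [x|i]; first exact: cvg_cst.
split=> [x|]; first exact: derivable_cst.
have -> : partial i (fun=> c : R) = (fun=> 0).
  by apply/funext => x; rewrite /partial derive_cst.
exact: ih.
Qed.

Lemma is_derive_fst (R : realType) (f : R -> R) (df : R) i (z : R * R) :
  is_derive z.1 1 f df ->
  is_derive z (basis_vec R i) (fun z => f z.1) (if i == ord0 then df else 0).
Proof.
case: z => a b /= [dfa dfE].
rewrite /basis_vec; case: ifPn => _.
  split.
    move: dfa; rewrite /derivable /= => dfa.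
    exact: dfa.
  by rewrite -dfE.
have E : (fun h : R => h^-1 *: (f (h *: (0, 1) + (a, b)).1 - f a)) = (fun=> 0).
  apply/funext => h /=; rewrite [h *: 0]mulr0 add0r subrr scaler0//.
split; rewrite ?/derivable ?/derive /= E; first exact: is_cvg_cst.
by apply/cvg_lim => //; exact: cvg_cst.
Qed.

Lemma is_derive_snd (R : realType) (f : R -> R) (df : R) (i : 'I_2) (z : R * R) :
  is_derive z.2 1 f df ->
  is_derive z (basis_vec R i) (fun z => f z.2) (if i == ord0 then 0 else df).
Proof.
case: z => a b /= [dfa dfE].
rewrite /basis_vec; case: ifPn => _; last first.
  split; last by rewrite -dfE.
  move: dfa; rewrite /derivable /= => dfa.
  exact: dfa.
have E : (fun h : R => h^-1 *: (f (h *: (1, 0) + (a, b)).2 - f b)) = (fun=> 0).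
  apply/funext => h /=; rewrite [h *: 0]mulr0 add0r subrr scaler0//.
split; rewrite ?/derivable ?/derive /= E; first exact: is_cvg_cst.
by apply/cvg_lim => //; exact: cvg_cst.
Qed.

Lemma Ck_fst (R : realType) k (f : R -> R) : smooth f -> Ck k (fun z => f z.1).
Proof.
elim: k f => [|k ih] f sf.
  split=> // x; apply: (@cvg_comp _ _ _ fst f _ (nbhs x.1)); first exact: cvg_fst.
  exact: smooth_continuous.
have [g sg dg] := smooth_derive sf.
split=> [x|i].
  apply: (@cvg_comp _ _ _ fst f _ (nbhs x.1)); first exact: cvg_fst.
  exact: smooth_continuous.
split=> [x|]; first by have [] := @is_derive_fst R f (g x.1) i x (dg _).
have -> : partial i (fun z => f z.1) = if i == ord0 then (fun z => g z.1) else (fun=> 0).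
  apply/funext => x; rewrite /partial.
  by have [_ ->] := @is_derive_fst R f (g x.1) i x (dg _); case: ifP.
by case: ifP => _; [exact: ih|exact: Ck_cst].
Qed.

Lemma Ck_snd (R : realType) k (f : R -> R) : smooth f -> Ck k (fun z => f z.2).
Proof.
elim: k f => [|k ih] f sf.
  split=> // x; apply: (@cvg_comp _ _ _ snd f _ (nbhs x.2)); first exact: cvg_snd.
  exact: smooth_continuous.
have [g sg dg] := smooth_derive sf.
split=> [x|i].
  apply: (@cvg_comp _ _ _ snd f _ (nbhs x.2)); first exact: cvg_snd.
  exact: smooth_continuous.
split=> [x|]; first by have [] := @is_derive_snd R f (g x.2) i x (dg _).
have -> : partial i (fun z => f z.2) = if i == ord0 then (fun=> 0) else (fun z => g z.2).
  apply/funext => x; rewrite /partial.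
  by have [_ ->] := @is_derive_snd R f (g x.2) i x (dg _); case: ifP.
by case: ifP => _; [exact: Ck_cst|exact: ih].
Qed.

Lemma partial_fst_snd (R : realType) (i : 'I_2) (a a' b b' : R -> R) (phi : R * R -> R) z :
  (forall x : R, is_derive x 1 a (a' x)) -> (forall x : R, is_derive x 1 b (b' x)) ->
  derivable phi z (basis_vec R i) ->
  partial i (fun z => a z.1 * b z.2 * phi z) z =
  (if i == ord0 then a' z.1 * b z.2 else a z.1 * b' z.2) * phi z
  + a z.1 * b z.2 * partial i phi z.
Proof.
move=> da db dphi.
have [da1 ea] := is_derive_fst i (da z.1).
have [db1 eb] := is_derive_snd i (db z.2).
rewrite partialM//; last by apply: derivableM.
rewrite partialM// /partial ea eb; case: ifP => _; ring.
Qed.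

(** The plane carries the product sigma-algebra, so an open set is written as a countable union of
    the squares with rational centre and radius [1 / (n + 1)] that it contains, enumerated by
    [unpickle]. *)
Lemma open_prod_measurable (R : realType) (A : set (R * R)) : open A ->
  measurable (A : set (measurableTypeR R * measurableTypeR R)).
Proof.
move=> oA.
pose Q (t : rat * rat * nat) : set (measurableTypeR R * measurableTypeR R) :=
  ball (ratr t.1.1 : R) (t.2.+1%:R^-1) `*` ball (ratr t.1.2 : R) (t.2.+1%:R^-1).
pose P t := if `[< Q t `<=` A >] then Q t else set0.
have -> : A = \bigcup_n (oapp P set0 (unpickle n)).
  apply/seteqP; split=> [[x y] Axy|z [n _ /=]]; last first.
    by case: unpickle => //= t; rewrite /P; case: asboolP => // tA /tA.
  have := oA; rewrite openE => /(_ _ Axy) /nbhs_ballP[e /= e0 eA].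
  have [n ne] : exists n, n.+1%:R^-1 < e / 2 :> R.
    have /ltr_add_invr[k] : 0 < e / 2 by rewrite divr_gt0.
    by rewrite add0r => ?; exists k.
  have n0 : 0 < n.+1%:R^-1 :> R by rewrite invr_gt0.
  have [d nd] : exists d : R, d = n.+1%:R^-1 by eexists.
  rewrite -nd in ne n0.
  have ratb (t : R) : exists q, ball (ratr q : R) d t.
    have /rat_in_itvoo[q] : t - d < t + d by lra.
    rewrite in_itv/= => /andP[h1 h2]; exists q.
    rewrite /ball/= ltr_norml. apply/andP; split; lra.
  have [[q hq] [r hr]] := (ratb x, ratb y).
  have [k kE] : exists k, unpickle k = Some (q, r, n).
    by eexists; exact: pickleK.
  exists k; first exact: I.
  rewrite kE /= /P asboolT; first by split; rewrite /= -nd.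
  rewrite /Q /= -nd.
  move=> [u v] [/= hu hv]; apply: eA; split => /=.
    have hu' := ball_sym hq; apply: (le_ball _ (ball_triangle hu' hu)). lra.
  have hv' := ball_sym hr; apply: (le_ball _ (ball_triangle hv' hv)); lra.
apply: bigcupT_measurable => n; case: unpickle => [t|]/=; last exact: measurable0.
rewrite /P; case: asboolP => _; last exact: measurable0.
by apply: measurableX; exact: measurable_ball.
Qed.

Lemma continuous_prod_measurable (R : realType) (f : R * R -> R) : continuous f ->
  measurable_fun (setT : set (measurableTypeR R * measurableTypeR R)) f.
Proof.
move=> /continuousP cf.
apply: (measurability _ (RGenOpens.measurableE R)).
move=> _ [_ [a [b ->] <-]]; rewrite setTI; apply: open_prod_measurable.
exact/cf/interval_open.
Qed.

Lemma integrable_mul_bounded d (T : measurableType d) (R : realType)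
    (mu : {measure set T -> \bar R}) (f h : T -> R) c :
  measurable_fun setT h -> (forall x, `|h x| <= c) ->
  mu.-integrable setT (EFin \o f) ->
  mu.-integrable setT (EFin \o (fun x => f x * h x)).
Proof.
move=> mh hc intf.
apply: (@integrableMl _ _ _ mu setT measurableT (EFin \o f) h) => //.
by exists c; split=> [|M cM x _]; [exact: num_real|exact: le_trans (hc x) (ltW cM)].
Qed.

(** An infinite integral has real value 0 by convention, for which the inequality is trivial. The
    bounds on marginals derived from it thus hold on every line, not only on almost every one. *)
Lemma le_abs_Rintegral d (T : measurableType d) (R : realType)
    (mu : {measure set T -> \bar R}) (D : set T) (f : T -> R) :
  measurable D -> measurable_fun D f ->
  (`|\int[mu]_(x in D) f x|%:E <= \int[mu]_(x in D) `|f x|%:E)%E.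
Proof.
move=> mD mf.
have h : (`|\int[mu]_(x in D) (f x)%:E| <= \int[mu]_(x in D) `|f x|%:E)%E.
  by apply: (le_abse_integral mu mD); exact/measurable_EFinP.
apply: le_trans h; rewrite /Rintegral.
by case: (integral mu D _) => [r||] //=; rewrite leey.
Qed.

(** * Rescaled steps and bumps *)

Definition step (R : realType) : R -> R := projT1 (cid (exists_smooth_step R)).
Definition bump (R : realType) : R -> R :=
  projT1 (cid (projT2 (cid (exists_smooth_step R)))).
Definition bump_bound (R : realType) : R :=
  projT1 (cid (projT2 (cid (projT2 (cid (exists_smooth_step R)))))).

Lemma stepP (R : realType) :
  [/\ [/\ smooth (@step R), smooth (@bump R)
        & forall x : R, is_derive x 1 (@step R) (bump x)],
      [/\ forall x, x <= 0 -> @step R x = 0, forall x, 1 <= x -> @step R x = 1,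
          forall x, 0 <= @step R x <= 1 & {homo @step R : x y / x <= y}],
      (forall x, x < 0 \/ 1 < x -> @bump R x = 0)
    & 0 < bump_bound R /\ forall x, `|@bump R x| <= bump_bound R].
Proof. exact: projT2 (cid (projT2 (cid (projT2 (cid (exists_smooth_step R)))))). Qed.

(** A smoothed Heaviside function that rises on [[t, t + e]], its affine argument being in the shape
    demanded by [smooth_affine]. Its derivative [bump_at e t] is a kernel of mass 1 carried by the
    same interval. *)
Definition step_at (R : realType) (e t y : R) : R := step (e^-1 * y + - (e^-1 * t)).
Definition bump_at (R : realType) (e t y : R) : R :=
  e^-1 * bump (e^-1 * y + - (e^-1 * t)).

Lemma smooth_step_at (R : realType) (e t : R) : smooth (step_at e t).
Proof. by apply: smooth_affine; have [[]] := stepP R. Qed.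

Lemma smooth_bump_at (R : realType) (e t : R) : smooth (bump_at e t).
Proof.
apply: smoothM; first exact: smooth_cst.
by apply: smooth_affine; have [[]] := stepP R.
Qed.

Lemma is_derive_step_at (R : realType) (e t x : R) :
  is_derive x 1 (step_at e t) (bump_at e t x).
Proof.
have [[_ _ ds] _ _ _] := stepP R.
have d : is_derive x 1 (fun x : R => e^-1 * x + - (e^-1 * t)) e^-1.
  have h : is_derive x 1 (fun x : R => e^-1 * x + - (e^-1 * t)) (e^-1 *: (1 : R) + 0).
    exact: (@is_deriveD R R R (fun x => e^-1 *: x) (cst (- (e^-1 * t)))).
  by apply: (is_derive_eq h); rewrite addr0 /GRing.scale /= mulr1.
have h := @is_derive1_comp _ (@step R) _ x _ _ (ds _) d.
by apply: (is_derive_eq h); rewrite /bump_at mulrC.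
Qed.

Lemma step_at_itv (R : realType) (e t x : R) : 0 <= step_at e t x <= 1.
Proof. by have [_ [_ _ + _] _ _] := stepP R; exact. Qed.

Lemma step_at_left (R : realType) (e t x : R) : 0 < e -> x <= t -> step_at e t x = 0.
Proof.
move=> e0 xt; have [_ [+ _ _ _] _ _] := stepP R; apply.
by rewrite -mulrBr pmulr_rle0 ?invr_gt0// subr_le0.
Qed.

Lemma step_at_right (R : realType) (e t x : R) : 0 < e -> t + e <= x -> step_at e t x = 1.
Proof.
move=> e0 xt; have [_ [_ + _ _] _ _] := stepP R; apply.
by rewrite -mulrBr ler_pdivlMl// mulr1 lerBrDl.
Qed.

Lemma le_step_at (R : realType) (e t t' x : R) : 0 < e -> t <= t' ->
  step_at e t' x <= step_at e t x.
Proof.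
move=> e0 tt'; have [_ [_ _ _ +] _ _] := stepP R; apply.
by rewrite lerD2l lerN2 ler_pM2l ?invr_gt0.
Qed.

Lemma bump_at_out (R : realType) (e t x : R) : 0 < e -> x < t \/ t + e < x ->
  bump_at e t x = 0.
Proof.
move=> e0 h; have [_ _ + _] := stepP R; rewrite /bump_at => ->; rewrite ?mulr0//.
rewrite -mulrBr; case: h => h; [left|right].
  by rewrite pmulr_rlt0 ?invr_gt0// subr_lt0.
by rewrite ltr_pdivlMl// mulr1 ltrBrDl.
Qed.

Lemma bump_at_le (R : realType) (e t x : R) : 0 < e ->
  `|bump_at e t x| <= bump_bound R / e.
Proof.
move=> e0; have [_ _ _ [_ h]] := stepP R.
by rewrite normrM gtr0_norm ?invr_gt0// mulrC ler_pM2r ?invr_gt0.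
Qed.

Lemma measurable_smooth (R : realType) (f : R -> R) : smooth f ->
  measurable_fun (setT : set (measurableTypeR R)) f.
Proof. by move=> sf; apply: continuous_measurable_fun; exact: smooth_continuous. Qed.

Lemma integral_bump_at (R : realType) (e t : R) : 0 < e ->
  (\int[@lebesgue_measure R]_x (bump_at e t x)%:E = 1)%E.
Proof.
move=> e0.
have -> : (\int[@lebesgue_measure R]_x (bump_at e t x)%:E =
    \int[@lebesgue_measure R]_(x in `[t, (t + e)%R]) (bump_at e t x)%:E)%E.
  rewrite [RHS]integral_mkcond; apply: eq_integral => x _.
  rewrite patchE; case: ifPn => //; rewrite notin_setE/= in_itv/= => /negP.
  rewrite negb_and -!ltNge => /orP h; rewrite bump_at_out//.
have cs : continuous (step_at e t).
  by apply: smooth_continuous; exact: smooth_step_at.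
rewrite (@continuous_FTC2 _ _ (step_at e t)).
- by rewrite step_at_right// step_at_left// sube0.
- by rewrite ltrDl.
- by apply: continuous_subspaceT; apply: smooth_continuous; exact: smooth_bump_at.
- split.
  + by move=> x _; have [] := is_derive_step_at e t x.
  + by apply: cvg_at_right_filter; exact: cs.
  + by apply: cvg_at_left_filter; exact: cs.
- by move=> x _; rewrite derive1E; have [] := is_derive_step_at e t x.
Qed.

Lemma integrable_bump_at (R : realType) (e t : R) : 0 < e ->
  (@lebesgue_measure R).-integrable setT (EFin \o bump_at e t).
Proof.
move=> e0; apply/integrableP; split.
  by apply/measurable_EFinP; apply: measurable_smooth; exact: smooth_bump_at.
apply: (@le_lt_trans _ _ (\int[@lebesgue_measure R]_(x in `[t, (t + e)%R])
   (bump_bound R / e)%R%:E)%E); last first.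
  rewrite integral_cst//= lebesgue_measure_itv/= lte_fin ltrDl e0.
  by rewrite -EFinB -EFinM ltry.
rewrite [leRHS]integral_mkcond; apply: ge0_le_integral => //.
- apply/measurableT_comp => //; apply/measurable_EFinP.
  by apply: measurable_smooth; exact: smooth_bump_at.
- by apply/(measurable_restrictT _ _).1 => //; exact: measurable_cst.
- move=> x _ /=; rewrite patchE; case: ifPn; first by rewrite lee_fin bump_at_le.
  rewrite notin_setE/= in_itv/= => /negP.
  rewrite negb_and -!ltNge => /orP h; rewrite bump_at_out//.
  by rewrite normr0.
Qed.

(** The kernel is one-sided, but it is bounded by [B / e] and carried by [[t, t + e]], inside the
    ball of radius [2 * e] and length [4 * e]. Hence the deviation from [h t] is at most [4 * B]
    times the mean oscillation over that ball, which tends to 0 at a Lebesgue point. *)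
Lemma bump_at_cvg (R : realType) (h : R -> R) (t : R) :
  (@lebesgue_measure R).-integrable setT (EFin \o h) -> lebesgue_pt h t ->
  \int[@lebesgue_measure R]_y (h y * bump_at e t y) @[e --> 0^'+] --> h t.
Proof.
move=> ih ht.
have mh : measurable_fun (setT : set (mR R)) h.
  by apply/measurable_EFinP; exact: measurable_int ih.
pose B := bump_bound R.
have B0 : 0 < B by have [_ _ _ []] := stepP R.
have key e : 0 < e -> (`|\int[@lebesgue_measure R]_y (h y * bump_at e t y) - h t|%:E
    <= (4 * B)%:E * davg h t (2 * e))%E.
  move=> e0.
  have ib := integrable_bump_at t e0.
  have mb : measurable_fun (setT : set (measurableTypeR R)) (bump_at e t).
    by apply: measurable_smooth; exact: smooth_bump_at.
  have ihb := integrable_mul_bounded mb (bump_at_le t ^~ e0) ih.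
  have -> : \int[@lebesgue_measure R]_y (h y * bump_at e t y) - h t =
     \int[@lebesgue_measure R]_y ((h y - h t) * bump_at e t y).
    under [RHS]eq_Rintegral do rewrite mulrBl.
    rewrite RintegralB//; last first.
      exact: (@integrableZl _ _ _ _ _ measurableT (h t) _ ib).
    rewrite RintegralZl// {3}/Rintegral integral_bump_at//= mulr1//.
  apply: le_trans (le_abs_Rintegral _ _ _) _ => //.
    by apply: measurable_funM => //; exact: measurable_funB.
  rewrite /davg /iavg.
  have e20 : 0 < 2 * e by rewrite mulr_gt0.
  rewrite (lebesgue_measure_ball _ (ltW e20)) inver.
  rewrite mulrn_eq0/= gt_eqF//.
  rewrite muleA -EFinM.
  have -> : 4 * B * (2 * e *+ 2)^-1 = B / e by rewrite -mulr_natl; field; rewrite gt_eqF.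
  rewrite -ge0_integralZl_EFin//=; last 3 first.
  - exact: measurable_ball.
  - apply: measurable_funTS; apply/measurable_EFinP; apply: measurableT_comp => //.
    exact: measurable_funB.
  - by rewrite divr_ge0// ltW.

  rewrite [leRHS]integral_mkcond; apply: ge0_le_integral => //.
  - apply/measurable_EFinP; apply: measurableT_comp => //.
    by apply: measurable_funM => //; exact: measurable_funB.
  - apply/(measurable_restrictT _ _).1; first exact: measurable_ball.
    apply: measurable_funTS; apply/measurable_EFinP; apply: measurable_funM => //.
    apply: measurableT_comp => //; exact: measurable_funB.
  - move=> x _; rewrite patchE; case: ifPn => [_|].
      by rewrite -EFinM lee_fin normrM mulrC ler_wpM2r// bump_at_le.
    rewrite notin_setE /ball/= => /negP; rewrite -leNgt => hx.
    rewrite bump_at_out ?mulr0 ?normr0//.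
    by move: hx; rewrite ler_normr => /orP[] ?; [left|right]; lra.
apply/cvgrPdist_le => r r0.
pose r' := r / (4 * B).
have r'0 : 0 < r' by rewrite divr_gt0// mulr_gt0.
have : \forall e \near (0 : R)^'+, (davg h t e < r'%:E)%E.
  apply: (ht [set x | (x < r'%:E)%E]); apply: open_nbhs_nbhs; split => //.
  exact: open_ereal_lt_ereal.
move=> [d /= d0 hd].
near=> e; have e0 : 0 < e by near: e; exact: nbhs_right_gt.
rewrite distrC -lee_fin; apply: (le_trans (key _ e0)).
have -> : r = 4 * B * r' by rewrite /r'; field; rewrite gt_eqF.
rewrite [leRHS]EFinM lee_pmul2l ?lte_fin ?mulr_gt0//; apply/ltW/hd; last by rewrite mulr_gt0.
rewrite /= sub0r normrN gtr0_norm ?mulr_gt0//.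
suff: e < d / 2 by lra.
by near: e; apply: nbhs_right_lt; rewrite divr_gt0.
Unshelve. all: by end_near. Qed.

Lemma ae_leb_filter (R : realType) : Filter (almost_everywhere (leb R)).
Proof. exact: (ae_filter_ringOfSetsType (leb R)). Qed.

(** A fundamental lemma of the calculus of variations for the family of bumps; how small [e] must be
    may depend on [t]. *)
Lemma ae_eq0_bump_at (R : realType) (h : R -> R) (O : set R) :
  (leb R).-integrable setT (EFin \o h) ->
  (forall t, O t -> \forall e \near 0^'+,
     \int[leb R]_y (h y * bump_at e t y) = 0) ->
  {ae leb R, forall t, O t -> h t = 0}.
Proof.
move=> ih h0.
have := lebesgue_differentiation (open_integrable_locally openT ih).
apply: (@filterS _ _ (ae_leb_filter R)) => t ht Ot.
have c1 := bump_at_cvg ih ht.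
apply: (cvg_unique _ c1) => //.
exact: cvg_near_cst (h0 _ Ot).
Qed.

(** The hypothesis is the weak form of [G' = Z], tested with a primitive of the bump. As [e] tends
    to 0, [step_at] tends to the indicator of []t, +oo[] and dominated convergence applies; the
    primitive thus comes normalized at +oo. *)
Lemma ae_eq_primitive_bump_at (R : realType) (G Z : R -> R) :
  (leb R).-integrable setT (EFin \o G) ->
  (leb R).-integrable setT (EFin \o Z) ->
  (forall t e, 0 < e -> \int[leb R]_y (G y * bump_at e t y) =
      - \int[leb R]_y (Z y * step_at e t y)) ->
  {ae leb R, forall t, G t = - \int[leb R]_(y in `]t, +oo[) Z y}.
Proof.
move=> iG iZ hGZ.
have := lebesgue_differentiation (open_integrable_locally openT iG).
apply: (@filterS _ _ (ae_leb_filter R)) => t ht.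
have mZ : measurable_fun (setT : set (mR R)) Z.
  by apply/measurable_EFinP; exact: measurable_int iZ.
have c1 := bump_at_cvg iG ht.
have c2 : (fun n => \int[leb R]_y (G y * bump_at n.+1%:R^-1 t y)) @ \oo --> G t.
  apply: ((cvg_at_rightP _ _ _).1 c1 (fun n => n.+1%:R^-1)); split.
    by move=> n; rewrite invr_gt0.
  exact: cvg_harmonic.
apply: (cvg_unique _ c2) => //.
have -> : (fun n => \int[leb R]_y (G y * bump_at n.+1%:R^-1 t y)) =
    (fun n => - \int[leb R]_y (Z y * step_at n.+1%:R^-1 t y)).
  by apply/funext => n; rewrite hGZ.
apply: cvgN.
rewrite Rintegral_mkcond.
have ms n : measurable_fun (setT : set (mR R)) (step_at n.+1%:R^-1 t).
  by apply: measurable_smooth; exact: smooth_step_at.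
have mZr : measurable_fun (setT : set (mR R)) (Z \_ `]t, +oo[).
  by apply/(measurable_restrictT _ _).1 => //; exact: measurable_funTS.
have [| | | | | i1 _ c3] := @dominated_convergence _ _ R (leb R) setT measurableT
  (fun n y => (Z y * step_at n.+1%:R^-1 t y)%:E) (EFin \o (Z \_ `]t, +oo[))
  (fun y => `|Z y|%:E).
- by move=> n; apply/measurable_EFinP; exact: measurable_funM.
- exact/measurable_EFinP.
- apply: aeW => y _ /=; apply: cvg_near_cst; rewrite patchE.
  case: ifPn => [|]; rewrite ?notin_setE ?inE/= in_itv/= andbT.
    move=> ty; have yt0 : 0 < y - t by rewrite subr_gt0.
    have := near_infty_natSinv_lt (PosNum yt0); apply: filterS => n /= hn.
    by rewrite step_at_right ?mulr1// -lerBrDl ltW.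
  move=> /negP; rewrite -leNgt => ty; apply: nearW => n.
  by rewrite step_at_left ?mulr0.
- exact: integrable_norm.
- apply: aeW => y n _ /=; rewrite lee_fin normrM ler_piMr//.
  by have /andP[? ?] := step_at_itv n.+1%:R^-1 t y; rewrite ger0_norm.
by apply: fine_cvg; rewrite fineK//; exact: integrable_fin_num.
Qed.

(** * Marginals and Fubini *)

Definition marg1 (R : realType) (f : R * R -> R) (x : R) : R :=
  \int[leb R]_y f (x, y).
Definition marg2 (R : realType) (f : R * R -> R) (y : R) : R :=
  \int[leb R]_x f (x, y).

Lemma le_marg1 (R : realType) (f : R * R -> R) (x : R) :
  measurable_fun (setT : set (mR2 R)) f ->
  (`|marg1 f x|%:E <= \int[leb R]_y `|f (x, y)|%:E)%E.
Proof.
move=> mf; apply: le_abs_Rintegral => //.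
exact: (measurableT_comp mf (measurable_pair1 _)).
Qed.

Lemma le_marg2 (R : realType) (f : R * R -> R) (y : R) :
  measurable_fun (setT : set (mR2 R)) f ->
  (`|marg2 f y|%:E <= \int[leb R]_x `|f (x, y)|%:E)%E.
Proof.
move=> mf; apply: le_abs_Rintegral => //.
exact: (measurableT_comp mf (measurable_pair2 _)).
Qed.

Lemma integrable_marg1 (R : realType) (f : R * R -> R) :
  (@lebesgue2 R).-integrable setT (EFin \o f) ->
  (leb R).-integrable setT (EFin \o marg1 f).
Proof.
move=> intf; have mf := measurable_int _ intf.
have mf' : measurable_fun (setT : set (mR2 R)) f by exact/measurable_EFinP.
apply/integrableP; split.
  apply/measurable_EFinP.
  apply: (measurableT_comp (fine_measurable _)) => //.
  exact: (measurable_fubini_F intf).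
have lt := (@integrable12ltyP _ _ _ _ R (leb R) (leb R) (EFin \o f) mf).1 intf.
apply: le_lt_trans lt.
apply: ge0_le_integral => //.
- apply: measurableT_comp => //; apply/measurable_EFinP.
  apply: (measurableT_comp (fine_measurable _)) => //.
  exact: (measurable_fubini_F intf).
- have ma : measurable_fun (setT : set (mR2 R)) (abse \o (EFin \o f)).
    exact: measurableT_comp.
  exact: (@measurable_fun_fubini_tonelli_F _ _ _ _ R (leb R) _ ma (fun=> abse_ge0 _)).
- by move=> x _; exact: le_marg1.
Qed.

Lemma integrable_marg2 (R : realType) (f : R * R -> R) :
  (@lebesgue2 R).-integrable setT (EFin \o f) ->
  (leb R).-integrable setT (EFin \o marg2 f).
Proof.
move=> intf; have mf := measurable_int _ intf.
have mf' : measurable_fun (setT : set (mR2 R)) f by exact/measurable_EFinP.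
apply/integrableP; split.
  apply/measurable_EFinP.
  apply: (measurableT_comp (fine_measurable _)) => //.
  exact: (measurable_fubini_G intf).
have lt := (@integrable21ltyP _ _ _ _ R (leb R) (leb R) (EFin \o f) mf).1 intf.
apply: le_lt_trans lt.
apply: ge0_le_integral => //.
- apply: measurableT_comp => //; apply/measurable_EFinP.
  apply: (measurableT_comp (fine_measurable _)) => //.
  exact: (measurable_fubini_G intf).
- have ma : measurable_fun (setT : set (mR2 R)) (abse \o (EFin \o f)).
    exact: measurableT_comp.
  exact: (@measurable_fun_fubini_tonelli_G _ _ _ _ R (leb R) _ ma (fun=> abse_ge0 _)).
- by move=> x _; exact: le_marg2.
Qed.

Lemma Rintegral_marg1 (R : realType) (f : R * R -> R) (b : R -> R) c :
  (@lebesgue2 R).-integrable setT (EFin \o f) ->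
  measurable_fun (setT : set (mR R)) b -> (forall x, `|b x| <= c) ->
  \int[@lebesgue2 R]_z (f z * b z.1) = \int[leb R]_x (marg1 f x * b x).
Proof.
move=> intf mb bc.
have mb1 : measurable_fun (setT : set (mR2 R)) (fun z => b z.1).
  exact: (measurableT_comp mb).
have intfb := integrable_mul_bounded mb1 (fun z => bc z.1) intf.
rewrite /Rintegral -[in LHS](integral12_prod_meas1 intfb); congr fine.
apply: ae_eq_integral => //.
- exact: (measurable_fubini_F intfb).
- apply/measurable_EFinP/measurable_funM => //; apply/measurable_EFinP.
  exact: measurable_int (integrable_marg1 intf).
- have := ae_integrable1 intf.
  apply: (@filterS _ _ (ae_leb_filter R)) => x /= ix _.
  transitivity (\int[leb R]_y ((f (x, y))%:E * (b x)%:E))%E => //.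
  rewrite integralZr//.
  rewrite -(fineK (integrable_fin_num _ ix))//.
Qed.

Lemma Rintegral_marg2 (R : realType) (f : R * R -> R) (b : R -> R) c :
  (@lebesgue2 R).-integrable setT (EFin \o f) ->
  measurable_fun (setT : set (mR R)) b -> (forall x, `|b x| <= c) ->
  \int[@lebesgue2 R]_z (f z * b z.2) = \int[leb R]_x (marg2 f x * b x).
Proof.
move=> intf mb bc.
have mb1 : measurable_fun (setT : set (mR2 R)) (fun z => b z.2).
  exact: (measurableT_comp mb).
have intfb := integrable_mul_bounded mb1 (fun z => bc z.2) intf.
rewrite /Rintegral -[in LHS](integral21_prod_meas1 intfb); congr fine.
apply: ae_eq_integral => //.
- exact: (measurable_fubini_G intfb).
- apply/measurable_EFinP/measurable_funM => //; apply/measurable_EFinP.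
  exact: measurable_int (integrable_marg2 intf).
- have := ae_integrable2 intf.
  apply: (@filterS _ _ (ae_leb_filter R)) => x /= ix _.
  transitivity (\int[leb R]_y ((f (y, x))%:E * (b x)%:E))%E => //.
  rewrite integralZr//.
  rewrite -(fineK (integrable_fin_num _ ix))//.
Qed.

(** * Disjoint intervals around a covering *)

(* [((l, r), d)] encodes the interval [l, r] attached to a covering ball of radius [d]. *)
Definition crossing (R : realType) (good : R -> R -> Prop) (c : R) (t : R * R * R) :=
  [/\ t.1.1 <= t.1.2, good t.2 t.1.1, good t.2 t.1.2 & t.1.2 - t.1.1 <= c * t.2].

Definition before (R : realType) : rel (R * R * R) := fun p q => p.1.2 <= q.1.1.

(** Induction from the smallest radii up: the head has the largest radius [d], so its endpoints are
    good for every radius in the disjoint family [L] built from the tail, and the intervals of [L]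
    may be cut at them. Each old interval leaves only one piece, with its own radius, which keeps
    the sums under control. *)
Lemma sorted_crossings_disjoint (R : realType) (good : R -> R -> Prop) (c : R)
    (l : seq (R * R * R)) :
  (forall d d' x, d' <= d -> good d x -> good d' x) ->
  (forall t, t \in l -> crossing good c t) ->
  sorted (fun p q => q.2 <= p.2) l ->
  exists L : seq (R * R * R),
  [/\ forall t, t \in L -> crossing good c t /\ exists2 t', t' \in l & t'.2 = t.2,
      pairwise (@before R) L,
      forall x t, t \in l -> t.1.1 <= x <= t.1.2 ->
        exists2 t, t \in L & t.1.1 <= x <= t.1.2
    & forall f : R -> R, (forall d, 0 <= f d) ->
        \sum_(t <- L) f t.2 <= \sum_(t <- l) f t.2].
Proof.
move=> anti; elim: l => [|[[a b] d] l ih] cl sl.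
  by exists [::]; split=> // f _; rewrite !big_nil.
have /= [ab ga gb bad] := cl _ (mem_head _ _).
have cl' t : t \in l -> crossing good c t.
  by move=> tl; apply: cl; rewrite inE tl orbT.
have dmax t : t \in l -> t.2 <= d.
  have tr : transitive (fun p q : R * R * R => q.2 <= p.2).
    by move=> x y z /= h1 h2; exact: le_trans h2 h1.
  by move: sl => /= /(order_path_min tr) /allP h /h.
have [L [cL dL covL fL]] := ih cl' (path_sorted sl).
have dmaxL t : t \in L -> t.2 <= d.
  by move=> /cL[_ [t' /dmax + <-]].
(* An interval of [L] containing [[a, b]] would be cut into two pieces; in that case the head is
   dropped instead. *)
have [[t0 t0L /andP[t0a t0b]]|noc] :=
    pselect (exists2 t, t \in L & (t.1.1 <= a) && (b <= t.1.2)).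
  exists L; split=> //.
  - move=> t /cL[ct [t' t'l e]]; split=> //; exists t' => //.
    by rewrite inE t'l orbT.
  - move=> x t; rewrite inE => /orP[/eqP -> /= /andP[ax xb]|]; last exact: covL.
    by exists t0; rewrite ?(le_trans t0a)//= (le_trans xb).
  - by move=> f f0; rewrite big_cons ler_wpDl// fL.
(* Intervals starting before [a] are stopped at [a]; the others are pushed beyond [b], and those
   inside [[a, b]] collapse to the point [b]. *)
pose cutl t : R * R * R := (t.1.1, Num.min t.1.2 a, t.2).
pose cutr t : R * R * R := (Num.max t.1.1 b, Num.max t.1.2 b, t.2).
pose L1 := [seq cutl t | t <- L & t.1.1 < a].
pose L2 := [seq cutr t | t <- L & ~~ (t.1.1 < a)].
exists (L1 ++ (a, b, d) :: L2); split.
- move=> t; rewrite mem_cat inE => /orP[|/orP[/eqP ->|]].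
  + move=> /mapP[u]; rewrite mem_filter => /andP[ua uL] ->.
    have [[u12 g1 g2 hc] [t' t'l e]] := cL _ uL.
    split; last by exists t'; rewrite // inE t'l orbT.
    split => //=; first by rewrite le_min u12 ltW.
      by rewrite /Num.min; case: ifP => // _; apply: anti ga; exact: dmaxL.
    by apply: le_trans hc; rewrite lerD2r ge_min lexx.
  + by split; [split|exists (a, b, d); rewrite ?mem_head].
  + move=> /mapP[u]; rewrite mem_filter -leNgt => /andP[ua uL] ->.
    have [[u12 g1 g2 hc] [t' t'l e]] := cL _ uL.
    split; last by exists t'; rewrite // inE t'l orbT.
    split => //=.
    * by rewrite ge_max !le_max lexx u12 orbT.
    * by rewrite /Num.max; case: ifP => // _; apply: anti gb; exact: dmaxL.
    * by rewrite /Num.max; case: ifP => // _; apply: anti gb; exact: dmaxL.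
    * apply: le_trans hc; rewrite /Num.max; do 2 case: ltP => ?; lra.
- rewrite pairwise_cat /= !pairwise_map; apply/and3P.
  split; [|apply: sub_pairwise (pairwise_filter _ dL)|apply/andP; split].
  + apply/allrelP => p q /mapP[u]; rewrite mem_filter => /andP[ua uL] ->.
    rewrite inE => /orP[/eqP ->|/mapP[v]].
      by rewrite /before /= ge_min lexx orbT.
    rewrite mem_filter => /andP[va vL] ->; rewrite /before/=.
    by rewrite ge_min; apply/orP; right; rewrite le_max ab orbT.
  + by move=> p q; rewrite /before /= => h; rewrite ge_min h.
  + apply/allP => q /mapP[v _ ->]; rewrite /before /=.
    by rewrite le_max lexx orbT.
  + apply: sub_pairwise (pairwise_filter _ dL) => p q; rewrite /before /= => h.
    by rewrite ge_max !le_max h lexx orbT.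
- move=> x t; rewrite inE => /orP[/eqP -> /= xab|tl /(covL _ _ tl)].
    by exists (a, b, d); rewrite // mem_cat mem_head orbT.
  move=> [u uL /andP[u1 u2]].
  have [xab|xab] := boolP (a <= x <= b).
    by exists (a, b, d); rewrite // mem_cat mem_head orbT.
  have [ua|au] := ltP u.1.1 a.
    exists (cutl u).
      by rewrite mem_cat; apply/orP; left; apply: map_f; rewrite mem_filter ua.
    rewrite /= u1 le_min u2/=; rewrite leNgt; apply/negP => ax.
    apply: noc; exists u => //; rewrite (ltW ua)/=.
    move: xab; rewrite (ltW ax)/= -ltNge => bx; exact: le_trans (ltW bx) u2.
  have bx : b <= x.
    move: xab; rewrite negb_and -!ltNge => /orP[xa|/ltW//].
    by have := le_lt_trans (le_trans au u1) xa; rewrite ltxx.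
  exists (cutr u).
    rewrite mem_cat inE; apply/orP; right; apply/orP; right; apply: map_f.
    by rewrite mem_filter -leNgt au.
  by rewrite /= ge_max u1 bx le_max u2.
- move=> f f0; rewrite big_cat/= !big_cons !big_map !big_filter/= addrCA lerD2l.
  apply: le_trans (fL _ f0); rewrite [leRHS](bigID (fun t => t.1.1 < a))/=.
  exact: lexx.
Qed.

Lemma crossings_disjoint (R : realType) (good : R -> R -> Prop) (c : R)
    (l : seq (R * R * R)) :
  (forall d d' x, d' <= d -> good d x -> good d' x) ->
  (forall t, t \in l -> crossing good c t) ->
  exists L : seq (R * R * R),
  [/\ forall t, t \in L -> crossing good c t /\ exists2 t', t' \in l & t'.2 = t.2,
      pairwise (@before R) L,
      forall x t, t \in l -> t.1.1 <= x <= t.1.2 ->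
        exists2 t, t \in L & t.1.1 <= x <= t.1.2
    & forall f : R -> R, (forall d, 0 <= f d) ->
        \sum_(t <- L) f t.2 <= \sum_(t <- l) f t.2].
Proof.
move=> anti cl; pose ord (p q : R * R * R) := q.2 <= p.2.
have so : sorted ord (sort ord l).
  by apply: sort_sorted => p q; exact: le_total.
have cs t : t \in sort ord l -> crossing good c t by rewrite mem_sort; exact: cl.
have [L [h1 h2 h3 h4]] := sorted_crossings_disjoint anti cs so.
exists L; split=> //.
- by move=> t /h1[ct [t' + e]]; rewrite mem_sort => t'l; split=> //; exists t'.
- by move=> x t tl; apply: h3; rewrite mem_sort.
- move=> f f0; apply: le_trans (h4 _ f0) _.
  by rewrite (perm_big _ (permEl (perm_sort ord l))).
Qed.

(** The losses of a decreasing function over successive intervals add up to at most its total drop.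
    It is applied with [x] fixed to [st t = step_at e t x], as a function of the position [t] of the
    step, to see that a sum of plateaus stays between 0 and 1. *)
Lemma pairwise_telescope (R : realType) (st : R -> R) (L : seq (R * R * R)) :
  {homo st : x y / x <= y >-> y <= x} -> (forall x, 0 <= st x <= 1) ->
  (forall t, t \in L -> t.1.1 <= t.1.2) -> pairwise (@before R) L ->
  0 <= \sum_(t <- L) (st t.1.1 - st t.1.2) <= 1.
Proof.
move=> mst st01 h pL; apply/andP; split.
  by rewrite big_seq; apply: sumr_ge0 => t tL; rewrite subr_ge0 mst ?h.
have H B : (forall t, t \in L -> B <= t.1.1) ->
    \sum_(t <- L) (st t.1.1 - st t.1.2) <= st B.
  elim: L h pL B => [|t L ih] h /=.
    by move=> _ B _; rewrite big_nil; have /andP[] := st01 B.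
  move=> /andP[/allP tL pL] B Bt; rewrite big_cons.
  have h' u : u \in L -> u.1.1 <= u.1.2 by move=> uL; apply: h; rewrite inE uL orbT.
  have hs := ih h' pL t.1.2 (fun u uL => tL u uL).
  have := mst _ _ (Bt _ (mem_head _ _)); lra.
case: L h pL H => [|t L] h pL H; first by rewrite big_nil.
have /andP[_ s1] := st01 t.1.1.
apply: le_trans (H t.1.1 _) s1 => u; rewrite inE => /orP[/eqP -> //|uL].
apply: le_trans (h _ (mem_head _ _)) _.
by move: pL => /= /andP[/allP /(_ _ uL)].
Qed.

(** * Thresholds and averages *)

(* Either [w <= tau], or [w = w `^ p * w `^ (1 - p) <= tau `^ (1 - p) * w `^ p]. *)
Lemma le_threshold_powR (R : realType) (p tau w : R) : 1 <= p -> 0 < tau -> 0 <= w ->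
  w <= tau + tau `^ (1 - p) * w `^ p.
Proof.
move=> p1 tau0 w0; have [wt|tw] := leP w tau.
  by rewrite ler_wpDr// mulr_ge0 ?powR_ge0.
have wp : 0 < w by exact: lt_trans tw.
rewrite ler_wpDl ?(ltW tau0)//.
have E : w = w `^ (1 - p) * w `^ p.
  by rewrite -powRD ?subrK ?powRr1// gt_eqF// implybT.
rewrite [leLHS]E.
rewrite ler_wpM2r ?powR_ge0// -opprB !powRN lef_pV2 ?posrE ?powR_gt0//.
by rewrite ge0_ler_powR ?nnegrE ?subr_ge0// ltW.
Qed.

(** By the weak (1, 1) inequality the set where the maximal function of [P] exceeds [c] has measure
    less than [d], so []u, u + d[] contains a point outside it and outside a null set covering [K].
    At that point the averages at all scales are bounded at once. *)
Lemma exists_small_average (R : realType) (P : R -> \bar R) (A : R) (K : set R) (u d : R) :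
  measurable_fun (setT : set (mR R)) P -> (forall x, 0 <= P x)%E ->
  (\int[leb R]_x P x <= A%:E)%E -> 0 < d ->
  (leb R).-negligible K ->
  exists2 a, u < a < u + d & ~ K a /\
    forall e, 0 < e -> (\int[leb R]_(x in `[a, (a + e)%R]) P x <= (e * (16 * (A + 1) / d))%R%:E)%E.
Proof.
move=> mP P0 PA d0 [N [mN N0 KN]].
have A0 : 0 <= A by rewrite -lee_fin; apply: le_trans PA; exact: integral_ge0.
pose f := fine \o P.
have iP : (leb R).-integrable setT P.
  apply/integrableP; split => //; under eq_integral do rewrite gee0_abs//.
  exact: le_lt_trans PA (ltry _).
have aeP : ae_eq (leb R) setT P (EFin \o f).
  have := integrable_ae measurableT iP.
  by apply: (@filterS _ _ (ae_leb_filter R)) => x /= h _; rewrite /f /= fineK// h.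
have mf : measurable_fun (setT : set (mR R)) f.
  exact: (measurableT_comp (fine_measurable _)).
have f0 x : 0 <= f x by rewrite fine_ge0.
have If : (\int[leb R]_x `|f x|%:E = \int[leb R]_x P x)%E.
  under eq_integral do rewrite ger0_norm//.
  apply: ge0_ae_eq_integral => //; first exact/measurable_EFinP.
    by move=> x _; rewrite lee_fin.
  exact: ae_eq_sym.
have lf : locally_integrable setT f.
  apply: open_integrable_locally; first exact: openT.
  apply/integrableP; split; first exact/measurable_EFinP.
  by rewrite [X in (X < _)%E]If (le_lt_trans PA)// ltry.
(* The maximal inequality has constant 3, and [3 * A / c < d]. Since [[a, a + e]] lies in a ball of
   length [4 * e], the final constant is [4 * c = 16 * (A + 1) / d]. *)
pose c := 4 * (A + 1) / d.
have c0 : 0 < c by rewrite divr_gt0// mulr_gt0// ltr_wpDl.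
have [a [ua Na HLa]] : exists a, [/\ u < a < u + d, ~ N a & (HL_maximal f a <= c%:E)%E].
  apply: contrapT => /forallNP h.
  have sub : `]u, u + d[ `<=` [set x | (c%:E < HL_maximal f x)%E] `|` N.
    move=> x /=; rewrite in_itv/= => ux; have [Nx|Nx] := pselect (N x); [by right|left].
    rewrite /= ltNge; apply/negP => hx; exact: (h x).
  have mHL : measurable ([set x | (c%:E < HL_maximal f x)%E] : set (mR R)).
    rewrite -[X in measurable X]setTI.
    exact: (emeasurable_fun_o_infty _ (measurable_HL_maximal lf)).
  have : (d%:E <= leb R [set x | (c%:E < HL_maximal f x)%E] + leb R N)%E.
    apply: le_trans (@measureU2 _ _ _ (leb R) _ _ mHL mN).
    have -> : d%:E = leb R `]u, u + d[.
      by rewrite lebesgue_measure_itv/= lte_fin ltrDl d0 -EFinB addrC addKr.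
    by apply: le_measure; rewrite ?inE//; exact: measurableU.
  rewrite N0 adde0 leNgt => /negP; apply.
  apply: (le_lt_trans (maximal_inequality lf c0)); rewrite If.
  apply: (@le_lt_trans _ _ ((3 / c)%:E * A%:E)%E).
    by rewrite lee_pmul2l// lte_fin divr_gt0.
  rewrite -EFinM lte_fin /c.
  have -> : 3 / (4 * (A + 1) / d) * A = d * (3 * A / (4 * (A + 1))).
    by field; rewrite !gt_eqF// ltr_wpDl.
  by rewrite gtr_pMr// ltr_pdivrMr; lra.
exists a => //; split; first by move=> /KN.
move=> e e0.
have e20 : 0 < 2 * e by rewrite mulr_gt0.
have : (iavg f (ball a (2 * e)) <= c%:E)%E.
  apply: le_trans HLa; apply: ereal_sup_ubound; exists (2 * e) => //=.
  by rewrite in_itv/= e20.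
rewrite /iavg (lebesgue_measure_ball _ (ltW e20)) inver mulrn_eq0/= gt_eqF//.
rewrite lee_pdivrMl ?mulrn_wgt0// => h.
apply: (@le_trans _ _ (\int[leb R]_(y in ball a (2 * e)) `|f y|%:E)%E); last first.
  apply: (le_trans h); rewrite -EFinM lee_fin /c -mulr_natl.
  by rewrite le_eqVlt; apply/orP; left; apply/eqP; field; rewrite gt_eqF.
have -> : (\int[leb R]_(y in ball a (2 * e)) `|f y|%:E =
    \int[leb R]_(y in ball a (2 * e)) P y)%E.
  under eq_integral do rewrite ger0_norm//.
  apply: ge0_ae_eq_integral => //; first exact: measurable_ball.
  - by apply: measurable_funTS; exact/measurable_EFinP.
  - exact: measurable_funTS.
  - by move=> x _; rewrite lee_fin.
  - apply: (@filterS _ _ (ae_leb_filter R)) (ae_eq_sym aeP) => x /= h' _.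
    exact: h'.
apply: ge0_subset_integral => //; first exact: measurable_ball.
- exact: measurable_funTS.
- move=> x /=; rewrite in_itv/= /ball/= => /andP[? ?].
  by rewrite ltr_norml; apply/andP; split; lra.
Qed.

Definition ball_kernel (R : realType) (P : R -> \bar R) (d : R) (z : R * R) : \bar R :=
  if `|z.1 - z.2| < d then P z.2 else 0%E.

Lemma measurable_ball_kernel (R : realType) (P : R -> \bar R) (d : R) :
  measurable_fun (setT : set (mR R)) P ->
  measurable_fun (setT : set (mR2 R)) (ball_kernel P d).
Proof.
move=> mP; apply: measurable_fun_ifT => //.
- apply: measurable_fun_ltr => //.
  apply: continuous_prod_measurable => z.
  apply: (@continuous_comp _ _ _ (fun z : R * R => z.1 - z.2) Num.norm).
    by apply: cvgB; [exact: cvg_fst|exact: cvg_snd].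
  exact: norm_continuous.
- exact: (measurableT_comp mP).
Qed.

Lemma integral_ballE (R : realType) (P : R -> \bar R) (d y : R) :
  (\int[leb R]_(t in ball y d) P t = \int[leb R]_t ball_kernel P d (y, t))%E.
Proof.
rewrite integral_mkcond; apply: eq_integral => t _; rewrite patchE /ball_kernel /=.
case: ifPn; first by rewrite inE /ball/= => ->.
by rewrite notin_setE /ball/= => /negP/negbTE ->.
Qed.

Lemma ball_kernel_ge0 (R : realType) (P : R -> \bar R) (d : R) z :
  (forall x, 0 <= P x)%E -> (0 <= ball_kernel P d z)%E.
Proof. by move=> P0; rewrite /ball_kernel; case: ifP. Qed.

Lemma integral_ball_measurable (R : realType) (P : R -> \bar R) (d : R) :
  measurable_fun (setT : set (mR R)) P -> (forall x, 0 <= P x)%E ->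
  measurable_fun (setT : set (mR R)) (fun y => \int[leb R]_(t in ball y d) P t)%E.
Proof.
move=> mP P0.
under eq_fun do rewrite integral_ballE.
exact: (@measurable_fun_fubini_tonelli_F _ _ _ _ R (leb R) _
  (measurable_ball_kernel d mP) (fun z => ball_kernel_ge0 d z P0)).
Qed.

(** Tonelli: [t] lies in [ball y d] exactly when [y] lies in [ball t d], a set of length [2 * d]. *)
Lemma integral_integral_ball (R : realType) (P : R -> \bar R) (d : R) :
  measurable_fun (setT : set (mR R)) P -> (forall x, 0 <= P x)%E -> 0 < d ->
  (\int[leb R]_y \int[leb R]_(t in ball y d) P t = (2 * d)%:E * \int[leb R]_t P t)%E.
Proof.
move=> mP P0 d0.
under eq_integral do rewrite integral_ballE.
rewrite (@fubini_tonelli _ _ _ _ R (leb R) (leb R) _ (measurable_ball_kernel d mP)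
  (fun z => ball_kernel_ge0 d z P0)).
transitivity (\int[leb R]_t ((2 * d)%:E * P t))%E; last first.
  by rewrite ge0_integralZl_EFin// mulr_ge0// ltW.
apply: eq_integral => t _.
transitivity (\int[leb R]_(y in ball t d) P t)%E.
  rewrite [RHS]integral_mkcond; apply: eq_integral => y _; rewrite patchE /ball_kernel /=.
  rewrite distrC.
  case: ifPn => [|]; case: ifPn => //.
  by rewrite notin_setE /ball/=.
  by rewrite inE /ball/= => ->.
rewrite integral_cst; last exact: measurable_ball.
by rewrite /= (lebesgue_measure_ball _ (ltW d0)) muleC mulr_natl.
Qed.

(** * Weak gradients off a product set *)

(** Vanishing on a neighbourhood of each point of [A], and not merely on [A], keeps the closed
    support of a cut-off test function away from the product set. *)
Definition vanishes_near (R : realType) (f : R -> R) (A : set R) :=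
  forall c, A c -> \forall x \near c, f x = 0.

(* [g] plays the role of [u * phi], [w] and [z] that of its weak partial derivatives. *)
Definition weak_gradient_off (R : realType) (K F : set R) (g w z : R * R -> R) :=
  (forall (a a' b : R -> R) c, smooth a -> smooth b ->
     (forall x : R, is_derive x 1 a (a' x)) -> measurable_fun (setT : set (mR R)) a' ->
     (forall x, [/\ `|a x| <= c, `|a' x| <= c & `|b x| <= c]) ->
     vanishes_near a K \/ vanishes_near b F ->
     \int[@lebesgue2 R]_t (g t * (a' t.1 * b t.2)) =
     - \int[@lebesgue2 R]_t (w t * (a t.1 * b t.2))) /\
  (forall (a b b' : R -> R) c, smooth a -> smooth b ->
     (forall x : R, is_derive x 1 b (b' x)) -> measurable_fun (setT : set (mR R)) b' ->
     (forall x, [/\ `|a x| <= c, `|b x| <= c & `|b' x| <= c]) ->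
     vanishes_near a K \/ vanishes_near b F ->
     \int[@lebesgue2 R]_t (g t * (a t.1 * b' t.2)) =
     - \int[@lebesgue2 R]_t (z t * (a t.1 * b t.2))).

Lemma bump_at_vanishes (R : realType) (A : set R) (t : R) : closed A -> ~ A t ->
  \forall e \near 0^'+, vanishes_near (bump_at e t) A.
Proof.
move=> cA At.
have /nbhs_ballP[r /= r0 rA] : nbhs t (~` A).
  by apply: open_nbhs_nbhs; split => //; exact: closed_openC.
near=> e => c Ac.
have e0 : 0 < e by near: e; exact: nbhs_right_gt.
have er : e < r / 2 by near: e; apply: nbhs_right_lt; rewrite divr_gt0.
have rct : r <= `|t - c| by rewrite leNgt; apply/negP => h; exact: (rA c).
near=> x; apply: bump_at_out => //.
have xc : `|c - x| < r / 2.
  by near: x; apply: (@nbhsx_ballx _ _ c (r / 2)); rewrite divr_gt0.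
move: rct xc; rewrite ler_normr ltr_norml => /orP[] ? /andP[? ?]; [left|right]; lra.
Unshelve. all: by end_near. Qed.

Lemma bounded_bump_at (R : realType) (e t : R) : 0 < e ->
  forall x, `|bump_at e t x| <= bump_bound R / e.
Proof. by move=> e0 x; exact: bump_at_le. Qed.

Lemma normr_step_at (R : realType) (e t x : R) : `|step_at e t x| <= 1.
Proof. by have /andP[? ?] := step_at_itv e t x; rewrite ger0_norm. Qed.

Lemma measurable_bump_at (R : realType) (e t : R) :
  measurable_fun (setT : set (mR R)) (bump_at e t).
Proof. by apply: measurable_smooth; exact: smooth_bump_at. Qed.

Lemma measurable_step_at (R : realType) (e t : R) :
  measurable_fun (setT : set (mR R)) (step_at e t).
Proof. by apply: measurable_smooth; exact: smooth_step_at. Qed.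

Lemma integrable_mul_fst (R : realType) (f : R * R -> R) (a : R -> R) c :
  (@lebesgue2 R).-integrable setT (EFin \o f) ->
  measurable_fun (setT : set (mR R)) a -> (forall x, `|a x| <= c) ->
  (@lebesgue2 R).-integrable setT (EFin \o (fun t => f t * a t.1)).
Proof.
move=> intf ma ac.
have m1 : measurable_fun (setT : set (mR2 R)) (fun t => a t.1).
  exact: (measurableT_comp ma).
exact: (integrable_mul_bounded m1 (fun t => ac t.1) intf).
Qed.

Lemma Rintegral_marg1T (R : realType) (f : R * R -> R) :
  (@lebesgue2 R).-integrable setT (EFin \o f) ->
  \int[@lebesgue2 R]_z f z = \int[leb R]_x marg1 f x.
Proof.
move=> intf; have := @Rintegral_marg1 R f (fun=> 1) 1 intf (measurable_cst _) _.
rewrite normr1 => /(_ (fun=> lexx _)).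
by under eq_Rintegral do rewrite mulr1; under [RHS]eq_Rintegral do rewrite mulr1.
Qed.

Lemma Rintegral_marg2T (R : realType) (f : R * R -> R) :
  (@lebesgue2 R).-integrable setT (EFin \o f) ->
  \int[@lebesgue2 R]_z f z = \int[leb R]_x marg2 f x.
Proof.
move=> intf; have := @Rintegral_marg2 R f (fun=> 1) 1 intf (measurable_cst _) _.
rewrite normr1 => /(_ (fun=> lexx _)).
by under eq_Rintegral do rewrite mulr1; under [RHS]eq_Rintegral do rewrite mulr1.
Qed.

Lemma Rintegral0 d (T : measurableType d) (R : realType)
  (mu : {measure set T -> \bar R}) : \int[mu]_x (0 : R) = 0.
Proof. by rewrite /Rintegral integral0. Qed.

Section weak_gradient.
Context (R : realType) (K F : set R) (g w z : R * R -> R).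
Hypotheses (cK : closed K) (cF : closed F).
Hypothesis ig : (@lebesgue2 R).-integrable setT (EFin \o g).
Hypothesis iw : (@lebesgue2 R).-integrable setT (EFin \o w).
Hypothesis iz : (@lebesgue2 R).-integrable setT (EFin \o z).
Hypothesis gwz : weak_gradient_off K F g w z.

Lemma marg1_z_off : {ae leb R, forall x, ~ K x -> marg1 z x = 0}.
Proof.
apply: ae_eq0_bump_at; first exact: integrable_marg1.
move=> t Kt; near=> e.
have e0 : 0 < e by near: e; exact: nbhs_right_gt.
rewrite -(Rintegral_marg1 iz (measurable_bump_at e t) (bounded_bump_at t e0)).
have v : vanishes_near (bump_at e t) K by near: e; exact: bump_at_vanishes.
have B0 : 0 <= bump_bound R / e by apply: le_trans (bounded_bump_at t e0 0).
(* A factor constant in [y] is admissible, the cutoffs being merely bounded; its derivative 0 kills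
   the side of [g]. *)
have h := @gwz.2 (bump_at e t) (fun=> 1) (fun=> 0) (bump_bound R / e + 1)
  (smooth_bump_at e t) (smooth_cst _) (fun x => is_derive_cst _ _ _)
  (measurable_cst _) _ (or_introl v).
under eq_Rintegral do rewrite -[X in _ * X]mulr1.
apply/eqP; rewrite -oppr_eq0 -h.
  by under eq_Rintegral do rewrite !mulr0; rewrite Rintegral0.
move=> x; rewrite normr0 normr1; split; [|by rewrite ler_wpDl|by rewrite addr_ge0].
by apply: le_trans (bounded_bump_at t e0 x) _; rewrite ler_wpDr.
Unshelve. all: by end_near. Qed.

(** The identity [int (w a + g a') dx = 0] at height [y], obtained by testing with bumps in [y]. [O]
    consists of heights where this is admissible: those outside [F] for any [a], or all of them when
    [a] vanishes near [K]. *)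
Lemma marg2_w_identity (a a' : R -> R) (c : R) (O : set R) :
  smooth a -> (forall x : R, is_derive x 1 a (a' x)) ->
  measurable_fun (setT : set (mR R)) a' ->
  (forall x, `|a x| <= c /\ `|a' x| <= c) ->
  (forall t, O t -> \forall e \near 0^'+,
    vanishes_near a K \/ vanishes_near (bump_at e t) F) ->
  {ae leb R, forall y, O y -> marg2 (fun t => w t * a t.1) y
     + marg2 (fun t => g t * a' t.1) y = 0}.
Proof.
move=> sa da ma' bd van.
have ma := measurable_smooth sa.
have iwa := integrable_mul_fst iw ma (fun x => (bd x).1).
have iga := integrable_mul_fst ig ma' (fun x => (bd x).2).
have i1 := integrable_marg2 iwa.
have i2 := integrable_marg2 iga.
apply: ae_eq0_bump_at.
  exact: (@integrableD _ _ _ _ _ measurableT _ _ i1 i2).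
move=> t Ot; near=> e.
have e0 : 0 < e by near: e; exact: nbhs_right_gt.
have mb := measurable_bump_at e t.
have bb := bounded_bump_at t e0.
under eq_Rintegral do rewrite mulrDl.
rewrite RintegralD//;
  [|exact: integrable_mul_bounded mb bb i1|exact: integrable_mul_bounded mb bb i2].
rewrite -(Rintegral_marg2 iwa mb bb) -(Rintegral_marg2 iga mb bb).
have v : vanishes_near a K \/ vanishes_near (bump_at e t) F.
  by near: e; exact: van.
have c0 : 0 <= c by apply: le_trans (bd 0).1.
have B0 : 0 <= bump_bound R / e by apply: le_trans (bb 0).
have h := @gwz.1 a a' (bump_at e t) (c + bump_bound R / e) sa
  (smooth_bump_at e t) da ma' _ v.
under eq_Rintegral do rewrite -mulrA.
under [X in _ + X]eq_Rintegral do rewrite -mulrA.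
rewrite h ?addrN// => x; have [h1 h2] := bd x; split.
- exact: ler_wpDr.
- exact: ler_wpDr.
- exact: ler_wpDl.
Unshelve. all: by end_near. Qed.

Lemma marg2_w_off : {ae leb R, forall y, ~ F y -> marg2 w y = 0}.
Proof.
have := @marg2_w_identity (fun=> 1) (fun=> 0) 1 (~` F) (smooth_cst _)
  (fun x => is_derive_cst _ _ _) (measurable_cst _).
case=> [x|t Ft|N [mN N0 NF]]; first by rewrite normr0 normr1.
  by have := bump_at_vanishes cF Ft; apply: filterS => e; right.
exists N; split=> // y /= h; apply: NF => /= h'; apply: h => Fy.
have := h' Fy; rewrite /marg2.
under eq_Rintegral do rewrite mulr1; under [X in _ + X]eq_Rintegral do rewrite mulr0.
by rewrite Rintegral0 addr0.
Qed.

(** Since [a] vanishes near [K], the factor in [y] may be a step that crosses [F]: this is how the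
    heights in [F] are linked with those outside. *)
Lemma marg2_g_primitive (a : R -> R) (c : R) :
  smooth a -> (forall x, `|a x| <= c) -> vanishes_near a K ->
  {ae leb R, forall t, marg2 (fun t => g t * a t.1) t
    = - \int[leb R]_(y in `]t, +oo[) marg2 (fun t => z t * a t.1) y}.
Proof.
move=> sa bd van.
have ma := measurable_smooth sa.
have iga := integrable_mul_fst ig ma bd.
have iza := integrable_mul_fst iz ma bd.
have i1 := integrable_marg2 iga.
have i2 := integrable_marg2 iza.
apply: ae_eq_primitive_bump_at => // t e e0.
have mb := measurable_bump_at e t.
have ms := measurable_step_at e t.
have bb := bounded_bump_at t e0.
have bs := normr_step_at e t.
rewrite -(Rintegral_marg2 iga mb bb) -(Rintegral_marg2 iza ms bs).
have c0 : 0 <= c by apply: le_trans (bd 0).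
have B0 : 0 <= bump_bound R / e by apply: le_trans (bb 0).
have h := @gwz.2 a (step_at e t) (bump_at e t) (c + bump_bound R / e + 1) sa
  (smooth_step_at e t) (is_derive_step_at e t) mb _ (or_introl van).
under eq_Rintegral do rewrite -mulrA.
under [in RHS]eq_Rintegral do rewrite -mulrA.
apply: h => x; split.
- by rewrite -addrA ler_wpDr// addr_ge0.
- by rewrite ler_wpDl// addr_ge0.
- by rewrite addrAC ler_wpDl// addr_ge0.
Qed.

End weak_gradient.

(** * The jump across one interval *)

Lemma integral_itvoy_diff (R : realType) (Z : R -> R) (y y' d : R) :
  (leb R).-integrable setT (EFin \o Z) -> `|y - y'| < d ->
  (`| \int[leb R]_(t in `]y, +oo[) Z t - \int[leb R]_(t in `]y', +oo[) Z t |%:E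
    <= \int[leb R]_(t in ball y d) `|Z t|%:E)%E.
Proof.
move=> iZ.
have mZ : measurable_fun (setT : set (mR R)) Z.
  by apply/measurable_EFinP; exact: measurable_int iZ.
have H u v : u <= v -> `]u, v] `<=` ball y d ->
    (`| \int[leb R]_(t in `]u, +oo[) Z t - \int[leb R]_(t in `]v, +oo[) Z t |%:E
      <= \int[leb R]_(t in ball y d) `|Z t|%:E)%E.
  move=> uv sub.
  have E : `]u, +oo[%classic = `]u, v] `|` `]v, +oo[ :> set (mR R).
    apply/seteqP; split=> x /=; rewrite !in_itv/= ?andbT.
      by move=> ->; case: leP => xv; [left|right].
    by move=> [/andP[]//|]; apply: le_lt_trans.
  rewrite E Rintegral_setU//; last 2 first.
  - by rewrite -E; exact: integrableS iZ.
  - apply/disj_setPS => x /= []; rewrite !in_itv/= andbT => /andP[_ h1] h2.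
    by have := le_lt_trans h1 h2; rewrite ltxx.
  rewrite addrK.
  apply: le_trans (le_abs_Rintegral _ _ _) _ => //.
    exact: measurable_funTS.
  apply: ge0_subset_integral => //; first exact: measurable_ball.
  by apply: measurable_funTS; apply/measurable_EFinP; exact: measurableT_comp.
move=> yd; have [yy'|/ltW yy'] := leP y y'.
  apply: H => // x /=; rewrite in_itv/= => /andP[? ?].
  move: yd; rewrite /ball/= !ltr_norml => /andP[? ?]; apply/andP; split; lra.
rewrite distrC; apply: H => // x /=; rewrite in_itv/= => /andP[? ?].
move: yd; rewrite /ball/= !ltr_norml => /andP[? ?]; apply/andP; split; lra.
Qed.

(** Almost everywhere [G] equals its primitive [H], and [G = - W] outside [F]; so
    [|H y| <= |H y - H t| + |W t|] for almost every [t] in [S], the part of the ball outside [F].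
    This is averaged over [S], whose measure is at least [m]. The numbers [k1], [k2] and [m] are
    quantified inside so that one null set serves them all. *)
Lemma crossing_bound_1d (R : realType) (F : set R) (G W Z : R -> R) (P : R -> \bar R)
    (d : R) :
  closed F -> 0 < d ->
  (leb R).-integrable setT (EFin \o Z) ->
  {ae leb R, forall t, G t = - \int[leb R]_(y in `]t, +oo[) Z y} ->
  {ae leb R, forall y, ~ F y -> W y + G y = 0} ->
  measurable_fun (setT : set (mR R)) P -> (forall y, 0 <= P y)%E ->
  {ae leb R, forall y k1 k2 m, 0 <= k1 -> 0 <= k2 ->
    (forall y, (`|W y|%:E <= k1%:E + k2%:E * P y)%E) -> 0 < m ->
    (m%:E <= leb R (ball y d `\` F))%E ->
    (`|G y|%:E <= \int[leb R]_(t in ball y d) `|Z t|%:E + k1%:E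
      + (k2 / m)%:E * \int[leb R]_(t in ball y d) P t)%E}.
Proof.
move=> cF d0 iZ hG hW mP P0.
apply: (@filterS _ _ (ae_leb_filter R)) (hG) => y -> k1 k2 m k10 k20 WP m0 mS.
set H := (fun t => - \int[leb R]_(y in `]t, +oo[) Z y) in hG *.
rewrite -/(H y).
have mZ : measurable_fun (setT : set (mR R)) Z.
  by apply/measurable_EFinP; exact: measurable_int iZ.
set V := (\int[leb R]_(t in ball y d) `|Z t|%:E)%E.
have V0 : (0 <= V)%E by exact: integral_ge0.
have mF : measurable (F : set (mR R)) by exact: closed_measurable.
set S := ball y d `\` F.
have mB : measurable (ball y d : set (mR R)) by exact: measurable_ball.
have mS' : measurable (S : set (mR R)) by exact: measurableD.
have muS : (leb R S < +oo)%E.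
  apply: (@le_lt_trans _ _ (leb R (ball y d))).
    by apply: le_measure; rewrite ?inE//; exact: subDsetl.
  by rewrite (lebesgue_measure_ball _ (ltW d0)) ltry.
have mPS : measurable_fun (S : set (mR R)) P by exact: measurable_funTS.
have key : (\int[leb R]_(t in S) `|H y|%:E <= \int[leb R]_(t in S)
     (V + k1%:E + k2%:E * P t))%E.
  apply: ae_ge0_le_integral => //.
  - by move=> t _; apply: adde_ge0; [exact: adde_ge0|exact: mule_ge0].
  - by apply: emeasurable_funD => //; exact: emeasurable_funM.
  have := @filterI _ _ (ae_leb_filter R) _ _ hG hW.
  apply: (@filterS _ _ (ae_leb_filter R)) => t [Ht Wt] [yt /Wt].
  rewrite Ht => WG.
  have h1 : (`|H y - H t|%:E <= V)%E.
    rewrite /H opprK addrC distrC.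
    exact: (integral_itvoy_diff iZ).
  have h2 : `|H y| <= `|H y - H t| + `|W t|.
    have -> : W t = - H t by apply/eqP; rewrite -addr_eq0 WG.
    rewrite (normrN (H t)); apply: le_trans (ler_normD (H y - H t) (H t)).
    by rewrite subrK.
  apply: (@le_trans _ _ (`|H y - H t| + `|W t|)%:E); first by rewrite lee_fin.
  by rewrite EFinD -addeA; apply: leeD => //; exact: WP.
rewrite integral_cst// in key.
rewrite ge0_integralD// in key; last 3 first.
- by rewrite adde_ge0.
- by move=> t _; rewrite mule_ge0// lee_fin.
- exact: emeasurable_funM.
rewrite integral_cst//= ge0_integralZl_EFin// in key.
have PS : (\int[leb R]_(t in S) P t <= \int[leb R]_(t in ball y d) P t)%E.
  apply: ge0_subset_integral => //; first exact: measurable_funTS.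
  exact: subDsetl.
have S0 : (0 < leb R S)%E by apply: lt_le_trans mS; rewrite lte_fin.
have [r rE] : exists r, leb R S = r%:E.
  by exists (fine (leb R S)); rewrite fineK// ge0_fin_numE.
rewrite rE in key mS S0; rewrite lte_fin in S0; rewrite lee_fin in mS.
have h : (`|H y|%:E <= r^-1%:E * ((V + k1%:E) * r%:E
    + k2%:E * \int[leb R]_(t in S) P t))%E.
  by rewrite lee_pdivlMl// muleC.
apply: (le_trans h); rewrite muleDr//; last first.
  apply: ge0_adde_def; rewrite inE; apply: mule_ge0 => //.
  - exact: adde_ge0.
  - by rewrite lee_fin ltW.
  - exact: integral_ge0.
rewrite [X in (X + _)%E]muleC -muleA -EFinM mulfV ?gt_eqF// mule1.
apply: leeD => //; rewrite muleA -EFinM; apply: lee_pmul => //.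
- by rewrite lee_fin mulr_ge0// invr_ge0 ltW.
- exact: integral_ge0.
- by rewrite lee_fin mulrC ler_wpM2l// lef_pV2.
Qed.

(* Thresholding [f] at level [tau] replaces the Hoelder inequality. *)
Lemma le_marg2_threshold (R : realType) (f : R * R -> R) (a : R -> R) (p tau y : R) :
  1 <= p -> 0 < tau -> measurable_fun (setT : set (mR2 R)) f ->
  measurable_fun (setT : set (mR R)) a ->
  (`|marg2 (fun t => f t * a t.1) y|%:E <= tau%:E * \int[leb R]_x `|a x|%:E
    + (tau `^ (1 - p))%:E * \int[leb R]_x (`|f (x, y)| `^ p * `|a x|)%:E)%E.
Proof.
move=> p1 tau0 mf ma.
have mfa : measurable_fun (setT : set (mR2 R)) (fun t => f t * a t.1).
  by apply: measurable_funM => //; exact: (measurableT_comp ma).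
have mfy : measurable_fun (setT : set (mR R)) (fun x => f (x, y)).
  exact: (measurableT_comp mf (measurable_pair2 _)).
have mab : measurable_fun (setT : set (mR R)) (fun x => `|a x|).
  exact: measurableT_comp.
have mfp : measurable_fun (setT : set (mR R)) (fun x => `|f (x, y)| `^ p * `|a x|).
  apply: measurable_funM => //.
  by apply: (measurableT_comp (measurable_powR _)); exact: measurableT_comp.
apply: le_trans (le_marg2 _ mfa) _.
rewrite -ge0_integralZl_EFin//; last 2 first.
- exact/measurable_EFinP.
- exact: ltW.
rewrite -ge0_integralZl_EFin//; last 2 first.
- exact/measurable_EFinP.
- exact: powR_ge0.
rewrite -ge0_integralD//; last 4 first.
- by move=> x _; rewrite mule_ge0// lee_fin ltW.
- by apply: emeasurable_funM => //; exact/measurable_EFinP.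
- by move=> x _; rewrite mule_ge0// lee_fin ?mulr_ge0 ?powR_ge0.
- by apply: emeasurable_funM => //; exact/measurable_EFinP.
apply: ge0_le_integral => //.
- by apply/measurable_EFinP; apply: measurableT_comp => //; exact: measurable_funM.
- by apply: emeasurable_funD; apply: emeasurable_funM => //; exact/measurable_EFinP.
- move=> x _; rewrite -!EFinM -EFinD lee_fin normrM mulrA -mulrDl ler_wpM2r//.
  exact: le_threshold_powR.
Qed.

(** Both transitions lie just to the right of the endpoints, on [[l, l + e]] and [[r, r + e]],
    because a good point controls averages on the intervals that start there. *)
Definition plateau (R : realType) (e l r x : R) := step_at e l x - step_at e r x.
Definition dplateau (R : realType) (e l r x : R) := bump_at e l x - bump_at e r x.

Lemma smoothB (R : realType) (f h : R -> R) :
  smooth f -> smooth h -> smooth (fun x => f x - h x).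
Proof.
move=> sf sh; have -> : (fun x => f x - h x) = (fun x => f x + (-1) * h x).
  by apply/funext => x; rewrite mulN1r.
by apply: smoothD => //; apply: smoothM => //; exact: smooth_cst.
Qed.

Lemma smooth_plateau (R : realType) (e l r : R) : smooth (plateau e l r).
Proof. by apply: smoothB; exact: smooth_step_at. Qed.

Lemma smooth_dplateau (R : realType) (e l r : R) : smooth (dplateau e l r).
Proof. by apply: smoothB; exact: smooth_bump_at. Qed.

Lemma is_derive_plateau (R : realType) (e l r x : R) :
  is_derive x 1 (plateau e l r) (dplateau e l r x).
Proof. by apply: is_deriveB; exact: is_derive_step_at. Qed.

Lemma plateau_itv (R : realType) (e l r x : R) : 0 < e -> l <= r ->
  0 <= plateau e l r x <= 1.
Proof.
move=> e0 lr; have := le_step_at x e0 lr; rewrite /plateau => h.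
have /andP[? ?] := step_at_itv e l x; have /andP[? ?] := step_at_itv e r x.
by apply/andP; split; lra.
Qed.

Lemma normr_plateau (R : realType) (e l r x : R) : 0 < e -> l <= r ->
  `|plateau e l r x| <= 1.
Proof. by move=> e0 lr; have /andP[? ?] := plateau_itv x e0 lr; rewrite ger0_norm. Qed.

Lemma normr_dplateau (R : realType) (e l r x : R) : 0 < e ->
  `|dplateau e l r x| <= bump_bound R / e + bump_bound R / e.
Proof.
by move=> e0; apply: le_trans (ler_normB _ _) _; apply: lerD; exact: bump_at_le.
Qed.

Lemma dplateau_vanishes (R : realType) (K : set R) (e l r : R) :
  vanishes_near (bump_at e l) K -> vanishes_near (bump_at e r) K ->
  vanishes_near (dplateau e l r) K.
Proof.
move=> vl vr c Kc; apply: filterS2 (vl _ Kc) (vr _ Kc) => x h1 h2.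
by rewrite /dplateau h1 h2 subr0.
Qed.

Lemma integral_plateau (R : realType) (e l r : R) : 0 < e -> l <= r ->
  (\int[leb R]_x `|plateau e l r x|%:E <= (r + e - l)%:E)%E.
Proof.
move=> e0 lr.
have -> : (r + e - l)%:E = (\int[leb R]_(x in `[l, (r + e)%R]) 1%:E)%E.
  rewrite integral_cst//= mul1e lebesgue_measure_itv/= lte_fin.
  by rewrite (le_lt_trans lr) ?ltrDl// -EFinB.
rewrite [leRHS]integral_mkcond; apply: ge0_le_integral => //.
- apply/measurable_EFinP; apply: measurableT_comp => //.
  by apply: measurable_smooth; exact: smooth_plateau.
- apply/(measurable_restrictT _ _).1 => //; exact: measurable_cst.
- move=> x _; rewrite patchE; case: ifPn => [_|].
    by rewrite lee_fin normr_plateau.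
  rewrite notin_setE/= in_itv/= => /negP; rewrite negb_and -!ltNge => /orP[h|h].
    rewrite /plateau !step_at_left ?subrr ?normr0// ltW//.
    exact: lt_le_trans lr.
  by rewrite /plateau !step_at_right ?subrr ?normr0//; lra.
Qed.

Lemma integral_bump_weight (R : realType) (P : R -> \bar R) (e t : R) :
  measurable_fun (setT : set (mR R)) P -> (forall x, 0 <= P x)%E -> 0 < e ->
  (\int[leb R]_x (P x * `|bump_at e t x|%:E)
    <= (bump_bound R / e)%:E * \int[leb R]_(x in `[t, (t + e)%R]) P x)%E.
Proof.
move=> mP P0 e0.
have B0 : 0 <= bump_bound R / e by apply: le_trans (bump_at_le t 0 e0).
rewrite -ge0_integralZl_EFin//; last exact: measurable_funTS.
rewrite [leRHS]integral_mkcond; apply: ge0_le_integral => //.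
- by move=> x _; rewrite mule_ge0.
- apply: emeasurable_funM => //; apply/measurable_EFinP; apply: measurableT_comp => //.
  exact: measurable_bump_at.
- apply/(measurable_restrictT _ _).1 => //; apply: measurable_funTS.
  exact: emeasurable_funM.
- move=> x _; rewrite patchE; case: ifPn => [_|].
    by rewrite muleC lee_pmul// lee_fin bump_at_le.
  rewrite notin_setE/= in_itv/= => /negP; rewrite negb_and -!ltNge => /orP h.
  by rewrite bump_at_out// normr0 mule0.
Qed.

Lemma integral_dplateau_weight (R : realType) (P : R -> \bar R) (e l r : R) :
  measurable_fun (setT : set (mR R)) P -> (forall x, 0 <= P x)%E -> 0 < e ->
  (\int[leb R]_x (P x * `|dplateau e l r x|%:E)
    <= (bump_bound R / e)%:E * \int[leb R]_(x in `[l, (l + e)%R]) P x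
     + (bump_bound R / e)%:E * \int[leb R]_(x in `[r, (r + e)%R]) P x)%E.
Proof.
move=> mP P0 e0.
have mPb t : measurable_fun (setT : set (mR R)) (fun x => P x * `|bump_at e t x|%:E)%E.
  apply: emeasurable_funM => //; apply/measurable_EFinP; apply: measurableT_comp => //.
  exact: measurable_bump_at.
apply: (@le_trans _ _ (\int[leb R]_x (P x * `|bump_at e l x|%:E)
   + \int[leb R]_x (P x * `|bump_at e r x|%:E))%E); last first.
  by apply: leeD; exact: integral_bump_weight.
rewrite -ge0_integralD//; last 2 first.
- by move=> x _; rewrite mule_ge0.
- by move=> x _; rewrite mule_ge0.
apply: ge0_le_integral => //.
- by move=> x _; rewrite mule_ge0.
- apply: emeasurable_funM => //; apply/measurable_EFinP; apply: measurableT_comp => //.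
  by apply: measurable_smooth; exact: smooth_dplateau.
- exact: emeasurable_funD.
- move=> x _; rewrite -ge0_muleDr// lee_wpmul2l// -EFinD lee_fin.
  exact: ler_normB.
Qed.

Lemma integral_dplateau (R : realType) (e l r : R) : 0 < e ->
  (\int[leb R]_x `|dplateau e l r x|%:E <= (2 * bump_bound R)%:E)%E.
Proof.
move=> e0.
have h := @integral_dplateau_weight R (cst 1%:E) e l r (measurable_cst _)
  (fun=> lee01) e0.
apply: (le_trans _ (le_trans h _)).
  by under [leRHS]eq_integral do rewrite mul1e.
rewrite !integral_cst//= !mul1e !lebesgue_measure_itv/= !lte_fin !ltrDl e0.
rewrite -!EFinB -!EFinM -EFinD lee_fin.
rewrite le_eqVlt; apply/orP; left; apply/eqP; field; rewrite gt_eqF//.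
Qed.

Definition slice_norm2 (R : realType) (p : R) (f : R * R -> R) (y : R) : \bar R :=
  (\int[leb R]_x (`|f (x, y)| `^ p)%:E)%E.
Definition slice_norm1 (R : realType) (p : R) (f : R * R -> R) (x : R) : \bar R :=
  (\int[leb R]_y (`|f (x, y)| `^ p)%:E)%E.

(* [L / d] bounds the averages, on all intervals starting at [x], of the [p]-th
   powers of [z] integrated along vertical lines. *)
Definition good_point (R : realType) (p : R) (K : set R) (z : R * R -> R) (L d x : R) :=
  ~ K x /\ forall e, 0 < e ->
    (\int[leb R]_(t in `[x, (x + e)%R]) slice_norm1 p z t <= (e * (L / d))%:E)%E.

Definition vertical_energy (R : realType) (p e l r : R) (z : R * R -> R) (y : R) : \bar R :=
  (\int[leb R]_x (`|z (x, y)| `^ p * `|dplateau e l r x|)%:E)%E.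

Lemma measurable_powR_norm (R : realType) (p : R) (f : R * R -> R) :
  measurable_fun (setT : set (mR2 R)) f ->
  measurable_fun (setT : set (mR2 R)) (fun t => `|f t| `^ p).
Proof.
move=> mf; apply: (measurableT_comp (measurable_powR _)).
exact: measurableT_comp.
Qed.

Lemma measurable_slice_norm1 (R : realType) (p : R) (f : R * R -> R) :
  measurable_fun (setT : set (mR2 R)) f ->
  measurable_fun (setT : set (mR R)) (slice_norm1 p f).
Proof.
move=> mf; have m1 : measurable_fun (setT : set (mR2 R)) (fun t => (`|f t| `^ p)%:E).
  by apply/measurable_EFinP; exact: measurable_powR_norm.
apply: (@measurable_fun_fubini_tonelli_F _ _ _ _ R (leb R) _ m1) => t.
by rewrite lee_fin powR_ge0.
Qed.

Lemma measurable_slice_norm2 (R : realType) (p : R) (f : R * R -> R) :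
  measurable_fun (setT : set (mR2 R)) f ->
  measurable_fun (setT : set (mR R)) (slice_norm2 p f).
Proof.
move=> mf; have m1 : measurable_fun (setT : set (mR2 R)) (fun t => (`|f t| `^ p)%:E).
  by apply/measurable_EFinP; exact: measurable_powR_norm.
apply: (@measurable_fun_fubini_tonelli_G _ _ _ _ R (leb R) _ m1) => t.
by rewrite lee_fin powR_ge0.
Qed.

Lemma slice_norm1_ge0 (R : realType) (p : R) (f : R * R -> R) x :
  (0 <= slice_norm1 p f x)%E.
Proof. by apply: integral_ge0 => t _; rewrite lee_fin powR_ge0. Qed.

Lemma slice_norm2_ge0 (R : realType) (p : R) (f : R * R -> R) x :
  (0 <= slice_norm2 p f x)%E.
Proof. by apply: integral_ge0 => t _; rewrite lee_fin powR_ge0. Qed.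

Lemma vertical_energy_ge0 (R : realType) (p e l r : R) (f : R * R -> R) x :
  (0 <= vertical_energy p e l r f x)%E.
Proof. by apply: integral_ge0 => t _; rewrite lee_fin mulr_ge0 ?powR_ge0. Qed.

Lemma integral_slice_norm1 (R : realType) (p : R) (f : R * R -> R) :
  measurable_fun (setT : set (mR2 R)) f ->
  (\int[leb R]_x slice_norm1 p f x = \int[@lebesgue2 R]_t (`|f t| `^ p)%:E)%E.
Proof.
move=> mf; have m1 : measurable_fun (setT : set (mR2 R)) (fun t => (`|f t| `^ p)%:E).
  by apply/measurable_EFinP; exact: measurable_powR_norm.
apply/esym/(@fubini_tonelli1 _ _ _ _ R (leb R) (leb R) _ m1) => t.
by rewrite lee_fin powR_ge0.
Qed.

Lemma integral_slice_norm2 (R : realType) (p : R) (f : R * R -> R) :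
  measurable_fun (setT : set (mR2 R)) f ->
  (\int[leb R]_x slice_norm2 p f x = \int[@lebesgue2 R]_t (`|f t| `^ p)%:E)%E.
Proof.
move=> mf; have m1 : measurable_fun (setT : set (mR2 R)) (fun t => (`|f t| `^ p)%:E).
  by apply/measurable_EFinP; exact: measurable_powR_norm.
apply/esym/(@fubini_tonelli2 _ _ _ _ R (leb R) (leb R) _ m1) => t.
by rewrite lee_fin powR_ge0.
Qed.

Lemma measurable_energy2 (R : realType) (p e l r : R) (z : R * R -> R) :
  measurable_fun (setT : set (mR2 R)) z ->
  measurable_fun (setT : set (mR2 R))
    (fun t => (`|z t| `^ p * `|dplateau e l r t.1|)%:E).
Proof.
move=> mz; apply/measurable_EFinP; apply: measurable_funM; first exact: measurable_powR_norm.
apply: measurableT_comp => //.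
have md : measurable_fun (setT : set (mR R)) (dplateau e l r).
  by apply: measurable_smooth; exact: smooth_dplateau.
exact: (measurableT_comp md).
Qed.

Lemma measurable_vertical_energy (R : realType) (p e l r : R) (z : R * R -> R) :
  measurable_fun (setT : set (mR2 R)) z ->
  measurable_fun (setT : set (mR R)) (vertical_energy p e l r z).
Proof.
move=> mz.
apply: (@measurable_fun_fubini_tonelli_G _ _ _ _ R (leb R) _
  (measurable_energy2 p e l r mz)) => t.
by rewrite lee_fin mulr_ge0 ?powR_ge0.
Qed.

(** The two bumps in [dplateau] are at most [bump_bound R / e], each on an interval of length [e]
    where [slice_norm1 p z] has average at most [L / d]. The powers of [e] cancel, so [e] can be
    taken as small as the geometry demands. *)
Lemma integral_vertical_energy (R : realType) (p e l r L d : R) (K : set R)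
    (z : R * R -> R) :
  measurable_fun (setT : set (mR2 R)) z -> 0 < e ->
  good_point p K z L d l -> good_point p K z L d r ->
  (\int[leb R]_y vertical_energy p e l r z y <= (2 * bump_bound R * (L / d))%:E)%E.
Proof.
move=> mz e0 [_ gl] [_ gr].
have B0 : 0 <= bump_bound R / e by apply: le_trans (bump_at_le 0 0 e0).
rewrite -(@fubini_tonelli _ _ _ _ R (leb R) (leb R) _ (measurable_energy2 p e l r mz));
  last by move=> t; rewrite lee_fin mulr_ge0 ?powR_ge0.
apply: (@le_trans _ _ (\int[leb R]_x (slice_norm1 p z x * `|dplateau e l r x|%:E))%E).
  rewrite le_eqVlt; apply/orP; left; apply/eqP; apply: eq_integral => x _.
  rewrite muleC -ge0_integralZl_EFin//; last first.
    apply/measurable_EFinP.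
    exact: (measurableT_comp (measurable_powR_norm p mz) (measurable_pair1 _)).
  by apply: eq_integral => t _; rewrite -EFinM mulrC.
have h := @integral_dplateau_weight R _ e l r (measurable_slice_norm1 p mz)
  (slice_norm1_ge0 p z) e0.
apply: (le_trans h).
have -> : 2 * bump_bound R * (L / d) = bump_bound R / e * (e * (L / d))
   + bump_bound R / e * (e * (L / d)).
  by move: (L / d) => q; field; rewrite gt_eqF.
have H u : (\int[leb R]_(t in `[u, (u + e)%R]) slice_norm1 p z t <= (e * (L / d))%:E)%E ->
    ((bump_bound R / e)%:E * \int[leb R]_(t in `[u, (u + e)%R]) slice_norm1 p z t
      <= (bump_bound R / e * (e * (L / d)))%:E)%E.
  move=> hu; rewrite [leRHS]EFinM; apply: lee_wpmul2l => //.
by rewrite EFinD; apply: leeD; [apply: H; exact: gl|apply: H; exact: gr].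
Qed.

Section crossing_bound.
Context (R : realType) (K F : set R) (g w z : R * R -> R).
Hypotheses (cK : closed K) (cF : closed F).
Hypothesis ig : (@lebesgue2 R).-integrable setT (EFin \o g).
Hypothesis iw : (@lebesgue2 R).-integrable setT (EFin \o w).
Hypothesis iz : (@lebesgue2 R).-integrable setT (EFin \o z).
Hypothesis gwz : weak_gradient_off K F g w z.

Lemma measurable_integrable2 (f : R * R -> R) :
  (@lebesgue2 R).-integrable setT (EFin \o f) ->
  measurable_fun (setT : set (mR2 R)) f.
Proof. by move=> intf; apply/measurable_EFinP; exact: measurable_int intf. Qed.

(** This is [crossing_bound_1d] for the jump across [[l, r]], both integrals being estimated with
    the threshold [tau]. The 5 comes from [r + e - l <= 5 * d], the 4 from a ball of length [2 * d]
    and the bound [2 * bump_bound R] for the integral of [|dplateau|]. *)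
Lemma crossing_bound (p s e l r d : R) :
  1 <= p -> l <= r -> 0 < e -> e <= d -> r - l <= 4 * d ->
  vanishes_near (bump_at e l) K -> vanishes_near (bump_at e r) K ->
  {ae leb R, forall y c lam, 0 < c -> 0 < lam ->
    ((c * d `^ ((1 - s) * (p - 1)))%:E <= leb R (ball y d `\` F))%E ->
    (`|marg2 (fun t => g t * dplateau e l r t.1) y|%:E
      <= ((5 + 4 * bump_bound R) * lam * d `^ s)%:E
       + (lam `^ (1 - p))%:E * (c^-1%:E * \int[leb R]_(t in ball y d) slice_norm2 p w t
          + (d `^ ((1 - s) * (p - 1)))%:E *
            \int[leb R]_(t in ball y d) vertical_energy p e l r z t))%E}.
Proof.
move=> p1 lr e0 ed rl vl vr.
have d0 : 0 < d by exact: lt_le_trans ed.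
have B0 : 0 < bump_bound R by have [_ _ _ []] := stepP R.
have mw := measurable_integrable2 iw.
have mz := measurable_integrable2 iz.
have vd := dplateau_vanishes vl vr.
have sd := smooth_dplateau e l r.
have bd x := @normr_dplateau R e l r x e0.
have md := measurable_smooth sd.
have mp := measurable_smooth (smooth_plateau e l r).
set c' := bump_bound R / e + bump_bound R / e in bd.
have c'0 : 0 <= c' by apply: le_trans (bd 0).
have prim := marg2_g_primitive ig iz gwz sd bd vd.
have iZ := integrable_marg2 (integrable_mul_fst iz md bd).
have ident : {ae leb R, forall y, ~ F y ->
    marg2 (fun t => w t * plateau e l r t.1) y
     + marg2 (fun t => g t * dplateau e l r t.1) y = 0}.
  apply: (@marg2_w_identity R K F g w z ig iw gwz _ _ (1 + c') (~` F)
    (smooth_plateau e l r) (is_derive_plateau e l r) md).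
    move=> x; split; first by rewrite ler_wpDr// normr_plateau.
    by rewrite ler_wpDl.
  by move=> t Ft; have := bump_at_vanishes cF Ft; apply: filterS => e'; right.
have mZ : measurable_fun (setT : set (mR R)) (marg2 (fun t => z t * dplateau e l r t.1)).
  by apply/measurable_EFinP; exact: measurable_int iZ.
apply: (@filterS _ _ (ae_leb_filter R)) (crossing_bound_1d cF d0 iZ prim ident
  (measurable_slice_norm2 p mw) (slice_norm2_ge0 p w)) => y H c lam c0 lam0 hc.
set kap := (1 - s) * (p - 1) in hc *.
(* This exponent yields both [d * tau = lam * d^s] and [tau^(1 - p) = lam^(1 - p) * d^kap]; in the
   term of [w] the latter is divided by the measure bound [c * d^kap]. *)
pose tau := lam * d `^ (s - 1).
have tau0 : 0 < tau by rewrite mulr_gt0// powR_gt0.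
have dtau : d * tau = lam * d `^ s.
  rewrite /tau mulrCA -[X in X * d `^ _](powRr1 (ltW d0)) -powRD ?subrKC//.
  by rewrite (gt_eqF d0) implybT.
have taup : tau `^ (1 - p) = lam `^ (1 - p) * d `^ kap.
  rewrite /tau powRM ?powR_ge0 ?(ltW lam0)// -powRrM; congr (_ * _ `^ _).
  by rewrite /kap; ring.
have dk0 : 0 < d `^ kap by rewrite powR_gt0.
have WP y' : (`|marg2 (fun t => w t * plateau e l r t.1) y'|%:E
    <= (tau * (5 * d))%:E + (tau `^ (1 - p))%:E * slice_norm2 p w y')%E.
  apply: (le_trans (le_marg2_threshold y' p1 tau0 mw mp)); apply: leeD.
    rewrite [leRHS]EFinM; apply: lee_wpmul2l; first by rewrite lee_fin ltW.
    by apply: (le_trans (integral_plateau e0 lr)); rewrite lee_fin; lra.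
  apply: lee_wpmul2l; first by rewrite lee_fin powR_ge0.
  have mwp : measurable_fun (setT : set (mR R)) (fun x => `|w (x, y')| `^ p).
    exact: (measurableT_comp (measurable_powR_norm p mw) (measurable_pair2 _)).
  apply: ge0_le_integral => //.
  - by apply/measurable_EFinP; apply: measurable_funM => //; exact: measurableT_comp.
  - exact/measurable_EFinP.
  - by move=> x _; rewrite lee_fin ler_piMr ?powR_ge0// normr_plateau.
have V : (\int[leb R]_(t in ball y d) `|marg2 (fun t => z t * dplateau e l r t.1) t|%:E
   <= (4 * bump_bound R * (d * tau))%:E + (tau `^ (1 - p))%:E *
     \int[leb R]_(t in ball y d) vertical_energy p e l r z t)%E.
  have mB : measurable (ball y d : set (mR R)) by exact: measurable_ball.
  have mE := measurable_vertical_energy p e l r mz.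
  apply: (@le_trans _ _ (\int[leb R]_(t in ball y d) ((tau * (2 * bump_bound R))%:E
      + (tau `^ (1 - p))%:E * vertical_energy p e l r z t))%E).
    apply: ge0_le_integral => //.
    - apply: measurable_funTS; apply/measurable_EFinP; exact: measurableT_comp.
    - by apply: emeasurable_funD => //; apply: measurable_funTS; exact: emeasurable_funM.
    - move=> t _; apply: (le_trans (le_marg2_threshold t p1 tau0 mz md)).
      apply: leeD => //; rewrite [leRHS]EFinM; apply: lee_wpmul2l; first by rewrite lee_fin ltW.
      exact: integral_dplateau.
  rewrite ge0_integralD//; last 3 first.
  - by move=> t _; rewrite lee_fin; apply: mulr_ge0; [exact: ltW|apply: mulr_ge0 => //; exact: ltW].
  - by move=> t _; apply: mule_ge0; [rewrite lee_fin powR_ge0|exact: vertical_energy_ge0].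
  - by apply: measurable_funTS; exact: emeasurable_funM.
  apply: leeD.
    rewrite integral_cst//= (lebesgue_measure_ball _ (ltW d0)) -EFinM lee_fin -mulr_natl.
    by rewrite le_eqVlt; apply/orP; left; apply/eqP; ring.
  rewrite ge0_integralZl_EFin ?powR_ge0//; last exact: measurable_funTS.
  by move=> t _; exact: vertical_energy_ge0.
have h := H (tau * (5 * d)) (tau `^ (1 - p)) (c * d `^ kap) _ (powR_ge0 _ _) WP _ hc.
apply: (le_trans (h _ _)).
- by apply: mulr_ge0; [exact: ltW|apply: mulr_ge0 => //; exact: ltW].
- by rewrite mulr_gt0.
have -> : tau `^ (1 - p) / (c * d `^ kap) = lam `^ (1 - p) * c^-1.
  by rewrite taup; field; rewrite !gt_eqF.
set IP := (\int[leb R]_(t in ball y d) slice_norm2 p w t)%E.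
set IE := (\int[leb R]_(t in ball y d) vertical_energy p e l r z t)%E in V *.
have IP0 : (0 <= IP)%E by apply: integral_ge0 => t _; exact: slice_norm2_ge0.
have IE0 : (0 <= IE)%E by apply: integral_ge0 => t _; exact: vertical_energy_ge0.
apply: (@le_trans _ _ ((4 * bump_bound R * (d * tau))%:E + (tau `^ (1 - p))%:E * IE
   + (tau * (5 * d))%:E + (lam `^ (1 - p) * c^-1)%:E * IP)%E).
  by do 2 apply: leeD => //.
clearbody IP IE tau; rewrite ge0_muleDr; last 2 first.
- by apply: mule_ge0 => //; rewrite lee_fin invr_ge0 ltW.
- by apply: mule_ge0 => //; rewrite lee_fin ltW.
rewrite !muleA -!EFinM -taup.
rewrite [X in (X + _)%E]addeAC -EFinD -addeA [X in (_ + X)%E]addeC.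
apply: leeD => //; rewrite lee_fin le_eqVlt; apply/orP; left; apply/eqP.
by rewrite -!mulrA -dtau; ring.
Qed.
End crossing_bound.

(** * Coverings at one scale *)

(** Finite lists, because finitely many plateaus are to be added up; [M] is the same at all scales
    [dl]. *)
Definition small_covers (R : realType) (s M : R) (K : set R) := forall dl : R, 0 < dl ->
  exists l : seq (R * R),
  [/\ forall t, t \in l -> 0 < t.2 <= dl,
      forall x, K x -> exists2 t, t \in l & ball t.1 t.2 x
    & \sum_(t <- l) t.2 `^ s <= M].

Lemma small_covers_sum (R : realType) (s M : R) (K : set R) : s < 1 ->
  small_covers s M K -> forall dl : R, 0 < dl ->
  exists l : seq (R * R),
  [/\ forall t, t \in l -> 0 < t.2 <= dl /\ t.2 <= 1,
      forall x, K x -> exists2 t, t \in l & ball t.1 t.2 x,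
      \sum_(t <- l) t.2 `^ s <= M
    & \sum_(t <- l) t.2 <= dl].
Proof.
move=> s1 hc dl dl0.
have s10 : 0 < 1 - s by rewrite subr_gt0.
have M0 : 0 <= M.
  have [l [_ _ h]] := hc 1 ltr01; apply: le_trans h.
  by apply: sumr_ge0 => t _; exact: powR_ge0.
have M1 : 0 < M + 1 by rewrite ltr_wpDl.
(* A radius [d] below [q] satisfies [d = d^(1 - s) * d^s <= dl / (M + 1) * d^s], and these bounds
   sum to at most [dl]. *)
pose q := (dl / (M + 1)) `^ (1 - s)^-1.
have q0 : 0 < q by rewrite powR_gt0// divr_gt0.
have [|l [h1 h2 h3]] := hc (Num.min (Num.min 1 dl) q).
  by rewrite !lt_min ltr01 dl0.
exists l; split=> // [t /h1|].
  by rewrite !le_min => /andP[-> /andP[/andP[-> ->] _]].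
apply: (@le_trans _ _ (\sum_(t <- l) (dl / (M + 1)) * t.2 `^ s)).
  rewrite big_seq [leRHS]big_seq; apply: ler_sum => t tl.
  have := h1 _ tl; rewrite !le_min => /andP[t0 /andP[_ tq]].
  have E : t.2 = t.2 `^ (1 - s) * t.2 `^ s.
    by rewrite -powRD ?subrK ?powRr1 ?(ltW t0)// (gt_eqF t0) implybT.
  rewrite [leLHS]E.
  rewrite ler_wpM2r ?powR_ge0//.
  have -> : dl / (M + 1) = q `^ (1 - s).
    by rewrite /q -powRrM mulVf ?gt_eqF// powRr1// divr_ge0// ltW.
  by rewrite ge0_ler_powR ?nnegrE ?(ltW t0) ?(ltW q0) ?(ltW s10).
rewrite -big_distrr/= mulrAC ler_pdivrMr// ler_pM2l//.
by apply: (le_trans h3); rewrite lerDl.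
Qed.

Lemma small_covers_negligible (R : realType) (s M : R) (K : set R) : s < 1 ->
  closed K -> small_covers s M K -> leb R K = 0%E.
Proof.
move=> s1 cK hc; apply/eqP; rewrite eq_le measure_ge0 andbT.
apply/lee_addgt0Pr => e e0; rewrite add0e.
have e20 : 0 < e / 2 by rewrite divr_gt0.
have [l [h1 h2 _ h4]] := small_covers_sum s1 hc e20.
pose U (i : nat) : set (mR R) := ball (nth (0, 0) l i).1 (nth (0, 0) l i).2.
have mK : measurable (K : set (mR R)) by exact: closed_measurable.
have sub : K `<=` \big[setU/set0]_(i < size l) U i.
  move=> x /h2[t tl xt]; rewrite -bigcup_mkord.
  by exists (index t l); rewrite /U /= ?index_mem// nth_index.
have mU i : measurable (U i) by exact: measurable_ball.
apply: (le_trans (content_subadditive (leb R) (fun i _ => mU i) mK sub)).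
apply: (@le_trans _ _ (\sum_(i < size l) (2 * (nth (0, 0) l i).2)%:E)%E).
  apply: lee_sum => i _.
  have /h1[/andP[/ltW i0 _] _] : nth (0, 0) l i \in l by exact: mem_nth.
  by rewrite mulr_natl -(lebesgue_measure_ball (nth (0, 0) l i).1 i0).
rewrite sumEFin lee_fin.
have -> : \sum_(i < size l) 2 * (nth (0, 0) l i).2 = 2 * \sum_(t <- l) t.2.
  by rewrite (big_nth (0, 0)) big_mkord big_distrr.
by rewrite mulrC -ler_pdivlMr.
Qed.

(** Around a ball of radius [d] each endpoint is sought between the distances [d] and [2 * d] from
    the centre, a gap of length [d]; so the ball is covered and the interval has length at most
    [4 * d]. Good endpoints avoid [K], hence the points of [K] are still strictly inside once the
    intervals have been made disjoint. *)
Lemma exists_crossings (R : realType) (p s M A : R) (K : set R) (z : R * R -> R) :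
  s < 1 -> closed K -> small_covers s M K ->
  measurable_fun (setT : set (mR2 R)) z ->
  (\int[@lebesgue2 R]_t (`|z t| `^ p)%:E <= A%:E)%E ->
  forall dl : R, 0 < dl ->
  exists L : seq (R * R * R),
  [/\ forall t, t \in L -> [/\ t.1.1 <= t.1.2, good_point p K z (16 * (A + 1)) t.2 t.1.1,
        good_point p K z (16 * (A + 1)) t.2 t.1.2, t.1.2 - t.1.1 <= 4 * t.2
        & [/\ 0 < t.2, t.2 <= dl & t.2 <= 1]],
      pairwise (@before R) L,
      forall x, K x -> exists2 t, t \in L & t.1.1 < x < t.1.2,
      \sum_(t <- L) t.2 `^ s <= M
    & \sum_(t <- L) t.2 <= dl].
Proof.
move=> s1 cK hc mz zA dl dl0.
have nK : (leb R).-negligible K.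
  exists K; split => //; first exact: closed_measurable.
  exact: small_covers_negligible hc.
have [l [h1 h2 h3 h4]] := small_covers_sum s1 hc dl0.
have A0 : 0 <= A.
  by rewrite -lee_fin; apply: le_trans zA; apply: integral_ge0 => t _; rewrite lee_fin powR_ge0.
have zA' : (\int[leb R]_x slice_norm1 p z x <= A%:E)%E by rewrite integral_slice_norm1.
have pts (t : R * R) : exists ab : R * R, 0 < t.2 ->
    [/\ t.1 - 2 * t.2 < ab.1 < t.1 - t.2, t.1 + t.2 < ab.2 < t.1 + 2 * t.2,
      good_point p K z (16 * (A + 1)) t.2 ab.1 & good_point p K z (16 * (A + 1)) t.2 ab.2].
  have [t0|t0] := ltP 0 t.2; last by exists (0, 0).
  have av u := @exists_small_average R (slice_norm1 p z) A K u t.2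
     (measurable_slice_norm1 p mz) (slice_norm1_ge0 p z) zA' t0 nK.
  have [a /andP[a1 a2] ga] := av (t.1 - 2 * t.2).
  have [b /andP[b1 b2] gb] := av (t.1 + t.2).
  exists (a, b) => _; split => //=; apply/andP; split=> //; lra.
have [f hf] := choice pts.
(* The guard [0 < d] makes [good] monotone over all real radii, as [crossings_disjoint] requires. *)
pose good d x := 0 < d -> good_point p K z (16 * (A + 1)) d x.
pose l' := [seq ((f t).1, (f t).2, t.2) | t <- l].
have anti d d' x : d' <= d -> good d x -> good d' x.
  move=> dd' gx d'0; have d0 := lt_le_trans d'0 dd'.
  have [Kx hx] := gx d0; split=> // e e0; apply: (le_trans (hx e e0)).
  rewrite lee_fin ler_pM2l// ler_pM2l ?mulr_gt0 ?ltr_wpDl// lef_pV2//.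
have cl t : t \in l' -> crossing good 4 t.
  move=> /mapP[u /h1[/andP[u0 _] _] ->]; have [/andP[? ?] /andP[? ?] ga gb] := hf _ u0.
  by split => //=; lra.
have [L [hL pL covL sumL]] := crossings_disjoint anti cl.
have hd t : t \in L -> [/\ 0 < t.2, t.2 <= dl & t.2 <= 1].
  move=> /hL[_ [t' /mapP[u /h1[/andP[u0 u1] u2] ->] <-]]; split => //.
exists L; split => //.
- move=> t tL; have [t0 td t1] := hd _ tL; have [[lr gl gr rl] _] := hL _ tL.
  by split => //; [exact: gl|exact: gr].
- move=> x Kx; have [u ul ux] := h2 _ Kx.
  have [/andP[u0 _] _] := h1 _ ul.
  have [/andP[? ?] /andP[? ?] ga gb] := hf _ u0.
  have ul' : ((f u).1, (f u).2, u.2) \in l' by apply: map_f.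
  have xab : (f u).1 <= x <= (f u).2.
    by move: ux; rewrite /ball/= ltr_norml => /andP[? ?]; apply/andP; split; lra.
  have [t tL /andP[t1 t2]] := covL _ _ ul' xab; exists t => //.
  have [t0 _ _] := hd _ tL; have [[_ /(_ t0)[n1 _] /(_ t0)[n2 _] _] _] := hL _ tL.
  rewrite !lt_neqAle t1 t2 !andbT; apply/andP; split; apply/eqP => e.
    by apply: n1; rewrite e.
  by apply: n2; rewrite -e.
- apply: (le_trans (sumL (fun d => d `^ s) _)) => [d|]; first exact: powR_ge0.
  by rewrite big_map.
(* Sums are compared for functions that are nonnegative on the whole line, so the positive part
   replaces the identity. *)
- have -> : \sum_(t <- L) t.2 = \sum_(t <- L) Num.max t.2 0.
    rewrite big_seq [RHS]big_seq; apply: eq_bigr => t /hd[t0 _ _].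
    by rewrite max_l// ltW.
  apply: (le_trans (sumL (fun d => Num.max d 0) _)) => [d|]; first by rewrite le_max lexx orbT.
  rewrite big_map; apply: le_trans h4.
  rewrite big_seq [leRHS]big_seq; apply: ler_sum => t /h1[/andP[t0 _] _].
  by rewrite max_l// ltW.
Qed.

Lemma near_all_seq (T : Type) (F : set_system T) (I : eqType) (l : seq I)
    (P : I -> T -> Prop) : Filter F ->
  (forall i, i \in l -> \forall x \near F, P i x) ->
  \forall x \near F, forall i, i \in l -> P i x.
Proof.
move=> FF; elim: l => [|i l ih] h; first by near=> x.
have h1 := h i (mem_head _ _).
have h2 := ih (fun j jl => h j (mem_behead (s := i :: l) jl)).
apply: filterS2 h1 h2 => x Pi Pl j; rewrite inE => /orP[/eqP -> //|]; exact: Pl.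
Unshelve. all: by end_near. Qed.

Lemma step_at_near (R : realType) (K : set R) (t : R) : closed K -> ~ K t ->
  \forall e \near 0^'+, forall c, K c ->
    \forall x \near c, step_at e t x = (t < c)%R%:R.
Proof.
move=> cK Kt.
have /nbhs_ballP[r /= r0 rA] : nbhs t (~` K).
  by apply: open_nbhs_nbhs; split => //; exact: closed_openC.
near=> e => c Kc.
have e0 : 0 < e by near: e; exact: nbhs_right_gt.
have er : e < r / 2 by near: e; apply: nbhs_right_lt; rewrite divr_gt0.
have rct : r <= `|t - c| by rewrite leNgt; apply/negP => h; exact: (rA c).
near=> x.
have xc : `|c - x| < r / 2.
  by near: x; apply: (@nbhsx_ballx _ _ c (r / 2)); rewrite divr_gt0.
move: xc; rewrite ltr_norml => /andP[? ?].
have [tc|ct] := ltP t c.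
  move: rct; rewrite ler0_norm; last by rewrite subr_le0 ltW.
  by move=> ?; apply: step_at_right => //; lra.
move: rct; rewrite ger0_norm; last by rewrite subr_ge0.
by move=> ?; apply: step_at_left => //; lra.
Unshelve. all: by end_near. Qed.

Lemma Rintegral_sum d (T : measurableType d) (R : realType)
    (mu : {measure set T -> \bar R}) (I : eqType) (l : seq I) (f : I -> T -> R) :
  (forall i, i \in l -> mu.-integrable setT (EFin \o f i)) ->
  mu.-integrable setT (EFin \o (fun x => \sum_(i <- l) f i x)) /\
  \int[mu]_x (\sum_(i <- l) f i x) = \sum_(i <- l) \int[mu]_x f i x.
Proof.
elim: l => [|i l ih] h.
  split; last first.
    by rewrite big_nil; under eq_Rintegral do rewrite big_nil; exact: Rintegral0.
  have -> : EFin \o (fun x => \sum_(j <- [::]) f j x) = cst 0%E.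
    by apply/funext => x /=; rewrite big_nil.
  exact: integrable0.
have h1 := h i (mem_head _ _).
have [h2 h3] := ih (fun j jl => h j (mem_behead (s := i :: l) jl)).
split.
  have -> : EFin \o (fun x => \sum_(j <- i :: l) f j x) =
      ((EFin \o f i) \+ (EFin \o (fun x => (\sum_(j <- l) f j x)%R)))%E.
    by apply/funext => x /=; rewrite big_cons EFinD.
  exact: integrableD.
under eq_Rintegral do rewrite big_cons.
by rewrite RintegralD// h3 big_cons.
Qed.

Definition plateaus (R : realType) (e : R) (L : seq (R * R * R)) (x : R) :=
  \sum_(t <- L) plateau e t.1.1 t.1.2 x.
Definition dplateaus (R : realType) (e : R) (L : seq (R * R * R)) (x : R) :=
  \sum_(t <- L) dplateau e t.1.1 t.1.2 x.

Lemma plateaus_itv (R : realType) (e : R) (L : seq (R * R * R)) (x : R) : 0 < e ->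
  (forall t, t \in L -> t.1.1 <= t.1.2) -> pairwise (@before R) L ->
  0 <= plateaus e L x <= 1.
Proof.
move=> e0 lr pL.
apply: (@pairwise_telescope R (fun t => step_at e t x)) => //.
  by move=> u v uv; exact: le_step_at.
by move=> u; exact: step_at_itv.
Qed.

Lemma smooth_plateaus (R : realType) (e : R) (L : seq (R * R * R)) :
  smooth (plateaus e L) /\ smooth (dplateaus e L).
Proof.
elim: L => [|t L [ih1 ih2]].
  have -> : plateaus e [::] = (fun=> 0) by apply/funext => x; rewrite /plateaus big_nil.
  have -> : dplateaus e [::] = (fun=> 0) by apply/funext => x; rewrite /dplateaus big_nil.
  by split; exact: smooth_cst.
split.
  have -> : plateaus e (t :: L) = (fun x => plateau e t.1.1 t.1.2 x + plateaus e L x).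
    by apply/funext => x; rewrite /plateaus big_cons.
  by apply: smoothD => //; exact: smooth_plateau.
have -> : dplateaus e (t :: L) = (fun x => dplateau e t.1.1 t.1.2 x + dplateaus e L x).
  by apply/funext => x; rewrite /dplateaus big_cons.
by apply: smoothD => //; exact: smooth_dplateau.
Qed.

Lemma is_derive_plateaus (R : realType) (e : R) (L : seq (R * R * R)) (x : R) :
  is_derive x 1 (plateaus e L) (dplateaus e L x).
Proof.
elim: L => [|t L ih].
  have -> : plateaus e [::] = (fun=> 0) by apply/funext => y; rewrite /plateaus big_nil.
  by rewrite /dplateaus big_nil; exact: is_derive_cst.
have -> : plateaus e (t :: L) = (fun x => plateau e t.1.1 t.1.2 x + plateaus e L x).
  by apply/funext => y; rewrite /plateaus big_cons.
rewrite /dplateaus big_cons.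
by apply: is_deriveD; exact: is_derive_plateau.
Qed.

Lemma normr_dplateaus (R : realType) (e : R) (L : seq (R * R * R)) (x : R) : 0 < e ->
  `|dplateaus e L x| <= \sum_(t <- L) (bump_bound R / e + bump_bound R / e).
Proof.
move=> e0; apply: le_trans (ler_norm_sum _ _ _) _.
by apply: ler_sum => t _; exact: normr_dplateau.
Qed.

(* Near a point of [K] every [step_at] is constant, so that the sum telescopes
   to the number of intervals containing that point. *)
Lemma plateaus_complement_vanishes (R : realType) (K : set R) (L : seq (R * R * R)) :
  closed K ->
  (forall t, t \in L -> [/\ t.1.1 <= t.1.2, ~ K t.1.1 & ~ K t.1.2]) ->
  pairwise (@before R) L ->
  (forall x, K x -> exists2 t, t \in L & t.1.1 < x < t.1.2) ->
  \forall e \near 0^'+, vanishes_near (fun x => 1 - plateaus e L x) K.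
Proof.
move=> cK hL pL cov.
have h : \forall e \near (0 : R)^'+, forall t, t \in L ->
   (forall c, K c -> \forall x \near c, step_at e t.1.1 x = (t.1.1 < c)%R%:R)
   /\ (forall c, K c -> \forall x \near c, step_at e t.1.2 x = (t.1.2 < c)%R%:R).
  apply: near_all_seq => t tL; have [_ n1 n2] := hL _ tL.
  by apply: filterS2 (step_at_near cK n1) (step_at_near cK n2) => e.
near=> e => c Kc.
have e0 : 0 < e by near: e; exact: nbhs_right_gt.
have he : forall t, t \in L ->
   (forall c, K c -> \forall x \near c, step_at e t.1.1 x = (t.1.1 < c)%R%:R)
   /\ (forall c, K c -> \forall x \near c, step_at e t.1.2 x = (t.1.2 < c)%R%:R).
  by near: e.
have [t tL /andP[t1 t2]] := cov _ Kc.
have [/(_ _ Kc) h1 /(_ _ Kc) h2] := he _ tL.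
apply: filterS2 h1 h2 => x; rewrite t1 ltNge (ltW t2)/= => e1 e2.
have lr u : u \in L -> u.1.1 <= u.1.2 by move=> /hL[].
have /andP[_ le1] := @plateaus_itv R e L x e0 lr pL.
apply/eqP; rewrite subr_eq0 eq_le le1 andbT.
rewrite /plateaus (perm_big _ (perm_to_rem tL))/= big_cons.
rewrite {1}/plateau e1 e2 subr0 lerDl big_seq; apply: sumr_ge0 => u /mem_rem uL.
by have /andP[] := @plateau_itv R e u.1.1 u.1.2 x e0 (lr _ uL).
Unshelve. all: by end_near. Qed.

(** * The estimate at one scale *)

Section one_scale.
Context (R : realType) (K F : set R) (g w z : R * R -> R) (p s M Aw Az : R).
Hypotheses (cK : closed K) (cF : closed F).
Hypothesis ig : (@lebesgue2 R).-integrable setT (EFin \o g).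
Hypothesis iw : (@lebesgue2 R).-integrable setT (EFin \o w).
Hypothesis iz : (@lebesgue2 R).-integrable setT (EFin \o z).
Hypothesis gwz : weak_gradient_off K F g w z.
Hypotheses (p1 : 1 <= p) (s1 : s < 1) (kap1 : 1 <= (1 - s) * (p - 1)).
Hypothesis hc : small_covers s M K.
Hypothesis hAw : (\int[@lebesgue2 R]_t (`|w t| `^ p)%:E <= Aw%:E)%E.
Hypothesis hAz : (\int[@lebesgue2 R]_t (`|z t| `^ p)%:E <= Az%:E)%E.

Local Notation B := (bump_bound R).
Local Notation kap := ((1 - s) * (p - 1)).

(** The error of [crossing_bound] freed of [c] and [lam]: these depend on the height, whereas this
    quantity is integrated over all heights. *)
Definition crossing_energy (e : R) (t : R * R * R) (y : R) : \bar R :=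
  (\int[leb R]_(u in ball y t.2) slice_norm2 p w u
   + (t.2 `^ kap)%:E *
     \int[leb R]_(u in ball y t.2) vertical_energy p e t.1.1 t.1.2 z u)%E.

Lemma crossing_energy_ge0 e t y : (0 <= crossing_energy e t y)%E.
Proof.
apply: adde_ge0; first by apply: integral_ge0 => u _; exact: slice_norm2_ge0.
apply: mule_ge0; first by rewrite lee_fin powR_ge0.
by apply: integral_ge0 => u _; exact: vertical_energy_ge0.
Qed.

Lemma measurable_crossing_energy e t :
  measurable_fun (setT : set (mR R)) (crossing_energy e t).
Proof.
have mw := measurable_integrable2 iw; have mz := measurable_integrable2 iz.
apply: emeasurable_funD.
  apply: integral_ball_measurable; first exact: measurable_slice_norm2.
  exact: slice_norm2_ge0.
apply: emeasurable_funM => //; apply: integral_ball_measurable.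
  exact: measurable_vertical_energy.
exact: vertical_energy_ge0.
Qed.

(** Each ball integral contributes a factor [2 * t.2]. In the vertical part it meets the bound of
    order [1 / t.2] given by the good endpoints, which leaves [64 * B * (Az + 1) * t.2^kap]; and
    [t.2^kap <= t.2] because [t.2 <= 1 <= kap]. *)
Lemma integral_crossing_energy e t : 0 < e -> 0 < t.2 -> t.2 <= 1 ->
  good_point p K z (16 * (Az + 1)) t.2 t.1.1 ->
  good_point p K z (16 * (Az + 1)) t.2 t.1.2 ->
  (\int[leb R]_y crossing_energy e t y <= ((2 * Aw + 64 * B * (Az + 1)) * t.2)%:E)%E.
Proof.
move=> e0 t0 t1 gl gr.
have mw := measurable_integrable2 iw; have mz := measurable_integrable2 iz.
have mP := measurable_slice_norm2 p mw.
have mE := measurable_vertical_energy p e t.1.1 t.1.2 mz.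
have mIE := integral_ball_measurable t.2 mE (vertical_energy_ge0 p e t.1.1 t.1.2 z).
have B0 : 0 < B by have [_ _ _ []] := stepP R.
have Az0 : 0 <= Az.
  by rewrite -lee_fin; apply: le_trans hAz; apply: integral_ge0 => u _; rewrite lee_fin powR_ge0.
rewrite ge0_integralD//; last 4 first.
- by move=> y _; apply: integral_ge0 => u _; exact: slice_norm2_ge0.
- by apply: integral_ball_measurable => //; exact: slice_norm2_ge0.
- move=> y _; apply: mule_ge0; first by rewrite lee_fin powR_ge0.
  by apply: integral_ge0 => u _; exact: vertical_energy_ge0.
- exact: emeasurable_funM.
rewrite ge0_integralZl_EFin ?powR_ge0//; last first.
  by move=> y _; apply: integral_ge0 => u _; exact: vertical_energy_ge0.
rewrite integral_integral_ball//; last exact: slice_norm2_ge0.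
rewrite integral_integral_ball//; last exact: vertical_energy_ge0.
rewrite integral_slice_norm2// [in leRHS]mulrDl [in leRHS]EFinD; apply: leeD.
  rewrite mulrAC [in leRHS]EFinM; apply: lee_wpmul2l => //; rewrite lee_fin mulr_ge0// ltW//.
have hE := integral_vertical_energy mz e0 gl gr.
apply: (@le_trans _ _ ((t.2 `^ kap)%:E * ((2 * t.2)%:E
    * (2 * B * (16 * (Az + 1) / t.2))%:E))%E).
  apply: lee_wpmul2l; first by rewrite lee_fin powR_ge0.
  by apply: lee_wpmul2l => //; rewrite lee_fin mulr_ge0// ltW.
rewrite -!EFinM lee_fin.
have -> : t.2 `^ kap * (2 * t.2 * (2 * B * (16 * (Az + 1) / t.2))) =
   64 * B * (Az + 1) * t.2 `^ kap by field; rewrite gt_eqF.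
rewrite ler_wpM2l//; last by rewrite ge1r_powR// t0.
by rewrite !mulr_ge0 ?(ltW B0) ?addr_ge0.
Qed.

(** With [A] the sum of the plateaus, [1 - A] vanishes near [K], so [int (w (1 - A) - g A') dx = 0]
    at almost every height, in [F] or not, and [marg2 w] is the integral of [w A] plus the jumps.
    The threshold [tau] serves for [w A], where [A] has mass at most [5 * sig], and [lam] for the
    jumps. [Th] is built before [c], [tau] and [lam] are known. *)
Lemma one_scale_bound (sig : R) : 0 < sig ->
  exists Th : R -> \bar R, [/\ measurable_fun (setT : set (mR R)) Th,
    forall y, (0 <= Th y)%E,
    (\int[leb R]_y Th y <= ((2 * Aw + 64 * B * (Az + 1)) * sig)%:E)%E
  & {ae leb R, forall y c r0, 0 < c -> sig < r0 ->
      (forall r, 0 < r < r0 -> ((c * r `^ kap)%:E <= leb R (ball y r `\` F))%E) ->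
      forall tau lam, 0 < tau -> 0 < lam ->
      (`|marg2 w y|%:E <= (tau * (5 * sig))%:E + (tau `^ (1 - p))%:E * slice_norm2 p w y
        + (((5 + 4 * B) * lam * M)%:E + (lam `^ (1 - p) * (c^-1 + 1))%:E * Th y))%E}].
Proof.
move=> sig0.
have mw := measurable_integrable2 iw; have mz := measurable_integrable2 iz.
have B0 : 0 < B by have [_ _ _ []] := stepP R.
have [L [hL pL cov sumM sumsig]] := exists_crossings s1 cK hc mz hAz sig0.
have Aw0 : 0 <= Aw.
  by rewrite -lee_fin; apply: le_trans hAw; apply: integral_ge0 => u _; rewrite lee_fin powR_ge0.
have Az0 : 0 <= Az.
  by rewrite -lee_fin; apply: le_trans hAz; apply: integral_ge0 => u _; rewrite lee_fin powR_ge0.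
have lr t : t \in L -> t.1.1 <= t.1.2 by move=> /hL[].
have hL' t : t \in L -> [/\ t.1.1 <= t.1.2, ~ K t.1.1 & ~ K t.1.2].
  by move=> /hL[? [? _] [? _] _ _].
(* The covering is fixed by now, so [e] can be taken below all its radii and small with respect to
   the distances of its finitely many endpoints to [K]. *)
have [e [e0 he1 he2]] : exists e : R, [/\ 0 < e, vanishes_near (fun x => 1 - plateaus e L x) K
   & forall t, t \in L -> [/\ e <= t.2, vanishes_near (bump_at e t.1.1) K
       & vanishes_near (bump_at e t.1.2) K]].
  have h : \forall e \near (0 : R)^'+, forall t, t \in L -> [/\ e <= t.2,
      vanishes_near (bump_at e t.1.1) K & vanishes_near (bump_at e t.1.2) K].
    apply: near_all_seq => t tL; have [_ n1 n2] := hL' _ tL.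
    have [_ _ _ _ [t0 _ _]] := hL _ tL.
    by apply: filterS3 (nbhs_right_le t0) (bump_at_vanishes cK n1) (bump_at_vanishes cK n2).
  have h2 := plateaus_complement_vanishes cK hL' pL cov.
  have [e [? [? ?]]] : exists e : R, 0 < e /\ (vanishes_near (fun x => 1 - plateaus e L x) K
    /\ forall t, t \in L -> [/\ e <= t.2, vanishes_near (bump_at e t.1.1) K
       & vanishes_near (bump_at e t.1.2) K]).
    by apply: (@filter_ex _ (0 : R)^'+); apply: filterI (nbhs_right_gt 0) (filterI h2 h).
  by exists e.
exists (fun y => \sum_(t <- L) crossing_energy e t y)%E; split.
- by apply: emeasurable_sum => t; exact: measurable_crossing_energy.
- by move=> y; apply: sume_ge0 => t _; exact: crossing_energy_ge0.
- rewrite ge0_integral_sum//; last 2 first.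
  + by move=> t; exact: measurable_crossing_energy.
  + by move=> t y _; exact: crossing_energy_ge0.
  apply: (@le_trans _ _ (\sum_(t <- L) ((2 * Aw + 64 * B * (Az + 1)) * t.2)%:E)%E).
    rewrite big_seq [leRHS]big_seq; apply: lee_sum => t tL.
    by have [_ g1 g2 _ [t0 _ t1]] := hL _ tL; exact: integral_crossing_energy.
  rewrite sumEFin lee_fin -big_distrr/= ler_wpM2l//.
  by rewrite addr_ge0 ?mulr_ge0// ?addr_ge0// ltW.
have [sA sA'] := smooth_plateaus e L.
have mA := measurable_smooth sA; have mA' := measurable_smooth sA'.
have A01 x : 0 <= plateaus e L x <= 1 by exact: plateaus_itv.
have nA x : `|plateaus e L x| <= 1 by have /andP[? ?] := A01 x; rewrite ger0_norm.
have nA' x := @normr_dplateaus R e L x e0.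
set S := \sum_(t <- L) _ in nA'.
have S0 : 0 <= S by apply: le_trans (nA' 0).
have ident : {ae leb R, forall y, setT y ->
    marg2 (fun t => w t * (1 - plateaus e L t.1)) y
     + marg2 (fun t => g t * - dplateaus e L t.1) y = 0}.
  apply: (@marg2_w_identity R K F g w z ig iw gwz (fun x => 1 - plateaus e L x)
    (fun x => - dplateaus e L x) (1 + S) setT).
  - exact: smoothB (smooth_cst _) sA.
  - move=> x; have h := is_deriveB (is_derive_cst (1 : R) x 1) (is_derive_plateaus e L x).
    by apply: (is_derive_eq h); rewrite sub0r.
  - exact: measurableT_comp.
  - move=> x; have /andP[? ?] := A01 x; split; last by rewrite normrN ler_wpDl.
    by rewrite ger0_norm ?subr_ge0//; lra.
  - by move=> t _; apply: nearW => e'; left.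
have cb : {ae leb R, forall y, forall t, t \in L -> forall c lam, 0 < c -> 0 < lam ->
    ((c * t.2 `^ kap)%:E <= leb R (ball y t.2 `\` F))%E ->
    (`|marg2 (fun u => g u * dplateau e t.1.1 t.1.2 u.1) y|%:E
      <= ((5 + 4 * B) * lam * t.2 `^ s)%:E
       + (lam `^ (1 - p))%:E * (c^-1%:E * \int[leb R]_(u in ball y t.2) slice_norm2 p w u
          + (t.2 `^ kap)%:E *
            \int[leb R]_(u in ball y t.2) vertical_energy p e t.1.1 t.1.2 z u))%E}.
  apply: (near_all_seq (ae_leb_filter R)) => t tL.
  have [h1 _ _ h4 _] := hL _ tL; have [h5 h6 h7] := he2 _ tL.
  exact: (crossing_bound cF ig iw iz gwz s p1 h1 e0 h5 h4 h6 h7).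
have iwy := ae_integrable2 iw; have igy := ae_integrable2 ig.
apply: (@filterS2 _ _ (ae_leb_filter R) _ _ _ _
  (@filterI _ _ (ae_leb_filter R) _ _ ident cb)
  (@filterI _ _ (ae_leb_filter R) _ _ iwy igy)).
move=> y /= [/(_ I) idy cby] [iwy' igy'] c r0 c0 sr0 hr tau lam tau0 lam0.
have iwA : (leb R).-integrable setT (EFin \o (fun x => w (x, y) * plateaus e L x)).
  exact: (integrable_mul_bounded mA nA iwy').
have igt t : t \in L ->
    (leb R).-integrable setT (EFin \o (fun x => g (x, y) * dplateau e t.1.1 t.1.2 x)).
  move=> _; have md := measurable_smooth (smooth_dplateau e t.1.1 t.1.2).
  exact: (integrable_mul_bounded md (fun x => normr_dplateau t.1.1 t.1.2 x e0) igy').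
have E1 : marg2 (fun t => w t * (1 - plateaus e L t.1)) y =
    marg2 w y - marg2 (fun t => w t * plateaus e L t.1) y.
  rewrite /marg2; under eq_Rintegral do rewrite /= mulrBr mulr1.
  by rewrite RintegralB.
have E2 : marg2 (fun t => g t * - dplateaus e L t.1) y =
    - \sum_(t <- L) marg2 (fun u => g u * dplateau e t.1.1 t.1.2 u.1) y.
  rewrite /marg2 -(Rintegral_sum igt).2.
  rewrite -[RHS]mulN1r -RintegralZl//; last exact: (Rintegral_sum igt).1.
  by apply: eq_Rintegral => x _ /=; rewrite /dplateaus mulrN mulN1r big_distrr.
have h0 : marg2 w y = marg2 (fun t => w t * plateaus e L t.1) y
    + \sum_(t <- L) marg2 (fun u => g u * dplateau e t.1.1 t.1.2 u.1) y.
  by move: idy; rewrite E1 E2 => /eqP; rewrite subr_eq0 subr_eq addrC => /eqP.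
rewrite h0; apply: (@le_trans _ _ (`|marg2 (fun t => w t * plateaus e L t.1) y|%:E
    + \sum_(t <- L) `|marg2 (fun u => g u * dplateau e t.1.1 t.1.2 u.1) y|%:E)%E).
  rewrite sumEFin -EFinD lee_fin; apply: le_trans (ler_normD _ _) _.
  by rewrite lerD2l; exact: ler_norm_sum.
apply: leeD.
  apply: (le_trans (le_marg2_threshold y p1 tau0 mw mA)); apply: leeD.
    rewrite [leRHS]EFinM; apply: lee_wpmul2l; first by rewrite lee_fin ltW.
    apply: (@le_trans _ _ (\int[leb R]_x \sum_(t <- L) `|plateau e t.1.1 t.1.2 x|%:E)%E).
      have mpl t : measurable_fun (setT : set (mR R)) (fun x => `|plateau e t.1.1 t.1.2 x|%:E).
        apply/measurable_EFinP; apply: measurableT_comp => //.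
        by apply: measurable_smooth; exact: smooth_plateau.
      apply: ge0_le_integral => //.
      - by apply/measurable_EFinP; exact: measurableT_comp.
      - exact: emeasurable_sum.
      - by move=> x _; rewrite sumEFin lee_fin; exact: ler_norm_sum.
    rewrite ge0_integral_sum//; last first.
      move=> t; apply/measurable_EFinP; apply: measurableT_comp => //.
      by apply: measurable_smooth; exact: smooth_plateau.
    apply: (@le_trans _ _ (\sum_(t <- L) (5 * t.2)%:E)%E).
      rewrite big_seq [leRHS]big_seq; apply: lee_sum => t tL.
      have [h1 _ _ h4 _] := hL _ tL; have [h5 _ _] := he2 _ tL.
      by apply: (le_trans (integral_plateau e0 h1)); rewrite lee_fin; lra.
    by rewrite sumEFin lee_fin -big_distrr/= ler_pM2l.
  apply: lee_wpmul2l; first by rewrite lee_fin powR_ge0.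
  have mwp : measurable_fun (setT : set (mR R)) (fun x => `|w (x, y)| `^ p).
    exact: (measurableT_comp (measurable_powR_norm p mw) (measurable_pair2 _)).
  apply: ge0_le_integral => //.
  - by apply/measurable_EFinP; apply: measurable_funM => //; exact: measurableT_comp.
  - exact/measurable_EFinP.
  - by move=> x _; rewrite lee_fin ler_piMr ?powR_ge0.
(* The inequality [c^-1 * I + J <= (c^-1 + 1) * (I + J)] gathers both errors into
   [crossing_energy]. *)
apply: (@le_trans _ _ (\sum_(t <- L) (((5 + 4 * B) * lam * t.2 `^ s)%:E
    + (lam `^ (1 - p) * (c^-1 + 1))%:E * crossing_energy e t y))%E).
  rewrite big_seq [leRHS]big_seq; apply: lee_sum => t tL.
  have [_ _ _ _ [t0 tsig _]] := hL _ tL.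
  have hct : ((c * t.2 `^ kap)%:E <= leb R (ball y t.2 `\` F))%E.
    by apply: hr; rewrite t0 (le_lt_trans tsig).
  apply: (le_trans (cby t tL c lam c0 lam0 hct)); apply: leeD => //.
  rewrite [in leRHS]EFinM -muleA; apply: lee_wpmul2l; first by rewrite lee_fin powR_ge0.
  have ci0 : 0 < c^-1 by rewrite invr_gt0.
  rewrite /crossing_energy.
  set IP := (\int[leb R]_(u in ball y t.2) slice_norm2 p w u)%E.
  set IE := (\int[leb R]_(u in ball y t.2) vertical_energy p e t.1.1 t.1.2 z u)%E.
  have IP0 : (0 <= IP)%E by apply: integral_ge0 => u _; exact: slice_norm2_ge0.
  have IE0 : (0 <= IE)%E by apply: integral_ge0 => u _; exact: vertical_energy_ge0.
  clearbody IP IE.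
  have dIE0 : (0 <= (t.2 `^ kap)%:E * IE)%E by apply: mule_ge0 => //; rewrite lee_fin powR_ge0.
  rewrite ge0_muleDr//; apply: leeD.
    by apply: lee_wpmul2r => //; rewrite lee_fin lerDl.
  rewrite -[leLHS]mul1e; apply: lee_wpmul2r => //.
  by rewrite lee_fin lerDr ltW.
rewrite big_split/=; apply: leeD.
  rewrite sumEFin lee_fin -big_distrr/= ler_wpM2l//.
  by apply: mulr_ge0; [apply: addr_ge0 => //; apply: mulr_ge0 => //; exact: ltW|exact: ltW].
by rewrite ge0_sume_distrr// => t _; exact: crossing_energy_ge0.
Qed.

End one_scale.

(** * Letting the scale tend to zero *)

(** The infimum of the [Th k] with [k >= N] is dominated by every later [Th m], so its integral is 0
    and it vanishes almost everywhere. The index found depends on [y]. *)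
Lemma ae_eq0_of_integral_to0 (R : realType) (Th : nat -> R -> \bar R) (C : R) :
  (forall n, measurable_fun (setT : set (mR R)) (Th n)) ->
  (forall n y, 0 <= Th n y)%E ->
  (forall n, \int[leb R]_y Th n y <= (C * n.+1%:R^-1)%:E)%E ->
  {ae leb R, forall y, forall N eps, 0 < eps -> exists2 k, (N <= k)%N & (Th k y < eps%:E)%E}.
Proof.
move=> mT T0 TC.
have C0 : 0 <= C.
  have := TC 0%N; rewrite invr1 mulr1 -lee_fin; apply: le_trans.
  by apply: integral_ge0.
have h N : {ae leb R, forall y, einfs (Th ^~ y) N = 0%E}.
  have me := measurable_fun_einfs mT N.
  have e0 y : (0 <= einfs (Th ^~ y) N)%E.
    by apply: le_ereal_inf_tmp => _ [k _ <-].
  have I0 : (\int[leb R]_y einfs (Th ^~ y) N = 0)%E.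
    apply/eqP; rewrite eq_le integral_ge0// andbT; apply/lee_addgt0Pr => e ee; rewrite add0e.
    have ke := @truncnS_gt _ ((C + 1) / e).
    set k := Num.truncn _ in ke.
    pose m := maxn N k.
    apply: (@le_trans _ _ (\int[leb R]_y Th m y)%E).
      apply: ge0_le_integral => // y _; apply: ereal_inf_lbound; exists m => //=.
      exact: leq_maxl.
    apply: (le_trans (TC m)); rewrite lee_fin ler_pdivrMr//.
    have km : k.+1%:R <= m.+1%:R :> R by rewrite ler_nat ltnS leq_maxr.
    have := lt_le_trans ke km; rewrite ltr_pdivrMr// mulrC => h.
    by apply: le_trans (ltW h); rewrite lerDl.
  have := (ae_eq_integral_abs (leb R) measurableT me).1.
  under eq_integral do rewrite gee0_abs//.
  by move=> /(_ I0); apply: (@filterS _ _ (ae_leb_filter R)) => y /(_ I).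
have := ae_foralln h.
apply: (@filterS _ _ (ae_leb_filter R)) => y hy N eps eps0.
have : (einfs (Th ^~ y) N < eps%:E)%E by rewrite hy lte_fin.
by move=> /ereal_inf_lt[_ [k /= Nk <-] ?]; exists k.
Qed.

Lemma Rintegral_ae0 (R : realType) (h : R -> R) :
  (leb R).-integrable setT (EFin \o h) -> {ae leb R, forall x, h x = 0} ->
  \int[leb R]_x h x = 0.
Proof.
move=> ih h0; rewrite -[RHS](Rintegral0 (leb R)) /Rintegral; congr fine.
apply: ae_eq_integral => //; first exact: measurable_int ih.
by apply: (@filterS _ _ (ae_leb_filter R)) h0 => x -> _.
Qed.

Section all_scales.
Context (R : realType) (K F : set R) (g w z : R * R -> R) (p s M Aw Az : R).
Hypotheses (cK : closed K) (cF : closed F).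
Hypothesis ig : (@lebesgue2 R).-integrable setT (EFin \o g).
Hypothesis iw : (@lebesgue2 R).-integrable setT (EFin \o w).
Hypothesis iz : (@lebesgue2 R).-integrable setT (EFin \o z).
Hypothesis gwz : weak_gradient_off K F g w z.
Hypotheses (p1 : 1 < p) (s1 : s < 1) (kap1 : 1 <= (1 - s) * (p - 1)).
Hypothesis hc : small_covers s M K.
Hypothesis hAw : (\int[@lebesgue2 R]_t (`|w t| `^ p)%:E <= Aw%:E)%E.
Hypothesis hAz : (\int[@lebesgue2 R]_t (`|z t| `^ p)%:E <= Az%:E)%E.
Hypothesis hF : {ae leb R, forall y, F y -> exists r0 c, [/\ 0 < r0, 0 < c &
  forall r, 0 < r < r0 ->
    ((c * r `^ ((1 - s) * (p - 1)))%:E <= leb R (ball y r `\` F))%E]}.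

Lemma Rintegral_z0 : \int[@lebesgue2 R]_t z t = 0.
Proof.
rewrite Rintegral_marg1T//; apply: Rintegral_ae0; first exact: integrable_marg1.
have nK : {ae leb R, forall x, ~ K x}.
  exists K; split => //; first exact: closed_measurable.
  - exact: small_covers_negligible hc.
  - by move=> x /= /contrapT.
by apply: (@filterS2 _ _ (ae_leb_filter R)) nK (marg1_z_off cK iz gwz) => x h /(_ h).
Qed.

(** At a height where [|marg2 w y| = 8 * eta > 0], the four terms of [one_scale_bound] can each be
    made at most [eta], a contradiction. The thresholds depend on [y] alone and are fixed before the
    scale, which is then taken among the infinitely many with small [Th]. *)
Lemma marg2_w_on : {ae leb R, forall y, F y -> marg2 w y = 0}.
Proof.
have mw := measurable_integrable2 iw.
have B0 : 0 < bump_bound R by have [_ _ _ []] := stepP R.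
have n1 n : 0 < n.+1%:R^-1 :> R by rewrite invr_gt0.
have sc n := one_scale_bound cK cF ig iw iz gwz (ltW p1) s1 kap1 hc hAw hAz
  (sig := n.+1%:R^-1) (n1 n).
have [Th hTh] := choice sc.
have Pfin : {ae leb R, forall y, slice_norm2 p w y \is a fin_num}.
  have iP : (leb R).-integrable setT (slice_norm2 p w).
    apply/integrableP; split; first exact: measurable_slice_norm2.
    under eq_integral do rewrite gee0_abs ?slice_norm2_ge0//.
    by rewrite integral_slice_norm2// (le_lt_trans hAw) ?ltry.
  have := integrable_ae measurableT iP.
  by apply: (@filterS _ _ (ae_leb_filter R)) => y /(_ I).
have small := ae_eq0_of_integral_to0 (fun n => let: And4 h _ _ _ := hTh n in h)
  (fun n => let: And4 _ h _ _ := hTh n in h) (fun n => let: And4 _ _ h _ := hTh n in h).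
have bound := ae_foralln (fun n => let: And4 _ _ _ h := hTh n in h).
apply: (@filterS2 _ _ (ae_leb_filter R) _ _ _ _
  (@filterI _ _ (ae_leb_filter R) _ _ Pfin small)
  (@filterI _ _ (ae_leb_filter R) _ _ hF bound)).
move=> y /= [Py smally] [hFy by_] Fy.
have [r0 [c [r00 c0 hr]]] := hFy Fy.
have M0 : 0 <= M.
  have [l [_ _ h]] := hc ltr01; apply: le_trans h.
  by apply: sumr_ge0 => t _; exact: powR_ge0.
apply/eqP/negPn/negP => hn0; have eta0 : 0 < `|marg2 w y| / 8.
  by rewrite divr_gt0// normr_gt0.
set eta := `|marg2 w y| / 8 in eta0.
have [P PE P0] : exists2 P : R, slice_norm2 p w y = P%:E & 0 <= P.
  exists (fine (slice_norm2 p w y)); first by rewrite fineK.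
  by rewrite fine_ge0// slice_norm2_ge0.
have P1 : 0 < P + 1 by rewrite ltr_wpDl.
have CM0 : 0 <= (5 + 4 * bump_bound R) * M.
  by apply: mulr_ge0 => //; apply: addr_ge0 => //; apply: mulr_ge0 => //; exact: ltW.
set CM := (5 + 4 * bump_bound R) * M in CM0.
pose lam := eta / (CM + 1).
have lam0 : 0 < lam by rewrite divr_gt0// ltr_wpDl.
(* Chosen so that [tau^(1 - p) * P <= eta]. As [1 - p < 0], a small [eta] forces a large [tau],
   which the scale compensates in the term [tau * (5 * sig)]. *)
pose tau := (eta / (P + 1)) `^ (1 - p)^-1.
have tau0 : 0 < tau by rewrite powR_gt0// divr_gt0.
have taup : tau `^ (1 - p) = eta / (P + 1).
  rewrite /tau -powRrM mulVf ?powRr1//; first by rewrite divr_ge0// ltW.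
  by rewrite subr_eq0 lt_eqF.
have D0 : 0 < lam `^ (1 - p) * (c^-1 + 1).
  by rewrite mulr_gt0 ?powR_gt0// addr_gt0// invr_gt0.
set D := lam `^ (1 - p) * (c^-1 + 1) in D0.
pose N := maxn (Num.truncn (r0^-1)) (Num.truncn (tau * 5 / eta)).
have [k Nk Tk] := smally N (eta / D) (divr_gt0 eta0 D0).
have k1 : k.+1%:R^-1 < r0.
  rewrite invf_plt ?posrE// (lt_le_trans (truncnS_gt _))// ler_nat ltnS.
  exact: leq_trans (leq_maxl _ _) Nk.
have k2 : tau * (5 * k.+1%:R^-1) <= eta.
  have : tau * 5 / eta < k.+1%:R.
    apply: (lt_le_trans (truncnS_gt _)); rewrite ler_nat ltnS.
    exact: leq_trans (leq_maxr _ _) Nk.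
  rewrite ltr_pdivrMr// => /ltW h.
  by rewrite (mulrA tau) ler_pdivrMr// (mulrC eta).
have [T TE T0] : exists2 T : R, Th k y = T%:E & 0 <= T.
  have T0 : (0 <= Th k y)%E by have [_ + _ _] := hTh k; exact.
  exists (fine (Th k y)); last exact: fine_ge0.
  by rewrite fineK// ge0_fin_numE// (lt_trans Tk)// ltry.
rewrite TE lte_fin ltr_pdivlMr// in Tk.
have := by_ k c r0 c0 k1 hr tau lam tau0 lam0.
rewrite -/D PE TE taup -!EFinM -!EFinD lee_fin => bd.
have b1 : eta / (P + 1) * P <= eta.
  by rewrite mulrAC ler_pdivrMr// ler_pM2l// lerDl.
have b2 : (5 + 4 * bump_bound R) * lam * M <= eta.
  rewrite mulrAC -/CM /lam mulrA ler_pdivrMr ?ltr_wpDl//.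
  by rewrite mulrC ler_pM2l// lerDl.
have E : `|marg2 w y| = 8 * eta by rewrite /eta; field.
have : `|marg2 w y| <= (eta + eta) + (eta + eta).
  apply: (le_trans bd); apply: lerD; apply: lerD => //.
  by rewrite mulrC ltW.
by rewrite E; move: (eta) eta0 => x x0; lra.
Qed.

Lemma Rintegral_w0 : \int[@lebesgue2 R]_t w t = 0.
Proof.
rewrite Rintegral_marg2T//; apply: Rintegral_ae0; first exact: integrable_marg2.
apply: (@filterS2 _ _ (ae_leb_filter R) _ _ _ _ marg2_w_on (marg2_w_off cF ig iw gwz)).
by move=> y h1 h2; have [/h1|/h2] := pselect (F y).
Qed.

End all_scales.

(** * From Hausdorff measure to finite coverings *)

(** A covering set may have diameter [r = 0], but balls need a positive radius. For [r > 0] the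
    diameter is doubled, and [2^s <= 2]; for [r = 0 < s] a tiny radius costs at most [e]; for
    [r = s = 0] the convention [0^0 = 1] already pays for any radius. *)
Lemma exists_radius (R : realType) (s r e dl : R) : 0 <= s <= 1 -> 0 <= r <= dl ->
  0 < e -> 0 < dl -> exists2 d, r < d <= 2 * dl & d `^ s <= 2 * r `^ s + e.
Proof.
move=> /andP[s0 s1] /andP[r0 rd] e0 dl0.
have [r1|] := ltP 0 r.
  exists (2 * r); first by apply/andP; split; lra.
  rewrite powRM// ler_wpDr ?(ltW e0)// ler_wpM2r ?powR_ge0//.
  by rewrite ler1_powR// ler1n.
move=> r1; have -> : r = 0 by apply/eqP; rewrite eq_le r1.
have [->|sn0] := eqVneq s 0.
  exists dl; last by rewrite !powRr0; lra.
  by rewrite dl0/=; lra.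
have sp : 0 < s by rewrite lt_neqAle eq_sym sn0.
exists (Num.min dl (e `^ s^-1)).
  rewrite lt_min dl0 powR_gt0//= ge_min; apply/orP; left; lra.
apply: (@le_trans _ _ ((e `^ s^-1) `^ s)).
  rewrite ge0_ler_powR ?nnegrE//.
  - by rewrite le_min (ltW dl0) powR_ge0.
  - by rewrite powR_ge0.
  - by rewrite ge_min lexx orbT.
rewrite -powRrM mulVf// powRr1 ?(ltW e0)// lerDr mulr_ge0 ?powR_ge0//.
Qed.

Lemma ediam_nneg (R : realType) (V : normedModType R) (A : set V) :
  A !=set0 -> (0 <= ediam A)%E.
Proof.
move=> [x Ax]; apply: ereal_sup_ubound; exists x, x; split=> //.
by rewrite subrr normr0.
Qed.

Lemma le_ediam (R : realType) (V : normedModType R) (A : set V) x y :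
  A x -> A y -> (`|x - y|%:E <= ediam A)%E.
Proof. by move=> Ax Ay; apply: ereal_sup_ubound; exists x, y. Qed.

Lemma hausdorff_cost_ge0 (R : realType) (V : normedModType R) (s : R) (A : set V) :
  (0 <= hausdorff_cost s A)%E.
Proof. by rewrite /hausdorff_cost; case: ifP => // _; exact: poweR_ge0. Qed.

Lemma sum_half_powers (R : realType) n : \sum_(k < n) (2 : R) ^- k.+1 <= 1.
Proof.
suff -> : \sum_(k < n) (2 : R) ^- k.+1 = 1 - 2 ^- n.
  by rewrite gerBl invr_ge0 exprn_ge0.
elim: n => [|n ih]; first by rewrite big_ord0 expr0 invr1 subrr.
rewrite big_ord_recr/= ih exprS; field.
by rewrite expf_neq0// pnatr_eq0.
Qed.

(** Each nonempty covering set lies in an open ball centred at one of its points, with radius beyond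
    its diameter, and compactness leaves finitely many balls. The constant comes from [C] and is
    common to all its compact pieces. *)
Lemma hausdorff_small_covers (R : realType) (s : R) (C : set R) : 0 <= s <= 1 ->
  (hausdorff_measure s C < +oo)%E ->
  exists M, forall K, K `<=` C -> compact K -> small_covers s M K.
Proof.
move=> s01 hC.
have [m mE] : exists m : R, (hausdorff_measure s C <= m%:E)%E.
  move: hC; case: (hausdorff_measure s C) => [r||]// _; first by exists r.
  by exists 0; rewrite leNye.
(* Here [m + 1] bounds the total cost of a cover at scale [dl / 2], the factor 2 is the loss in
   [exists_radius], and the last 1 bounds the sum of the errors [2^-(k+1)]. Radii may reach twice
   the scale, that is [dl]. *)
exists (2 * (m + 1) + 1) => K KC cK dl dl0.
have dl20 : 0 < dl / 2 by rewrite divr_gt0.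
have : (hausdorff_premeasure s (dl / 2) C < (m + 1)%:E)%E.
  apply: (@le_lt_trans _ _ (hausdorff_measure s C)).
    by apply: ereal_sup_ubound; exists (dl / 2).
  by apply: (le_lt_trans mE); rewrite lte_fin ltrDl.
move=> /ereal_inf_lt[_ [U [CU Udl ->]] Usum].
have x0 k : {x : R | U k !=set0 -> U k x}.
  by apply: cid; have [[x Ux]|n] := pselect (U k !=set0); [exists x|exists 0].
pose x k := sval (x0 k).
have hx k : U k !=set0 -> U k (x k) by exact: (svalP (x0 k)).
have p2 k : 0 < 2 ^- k.+1 :> R by rewrite invr_gt0 exprn_gt0.
have hd k : exists d : R, U k !=set0 -> [/\ (ediam (U k) < d%:E)%E, 0 < d <= dl
    & ((d `^ s)%:E <= 2%:E * hausdorff_cost s (U k) + (2 ^- k.+1)%:E)%E].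
  have [Uk|n] := pselect (U k !=set0); last by exists 0.
  have D0 := ediam_nneg Uk; have Dd := Udl k.
  have [r rE] : exists r, ediam (U k) = r%:E.
    by move: D0 Dd; case: (ediam (U k)) => // r _ _; exists r.
  rewrite rE !lee_fin in D0 Dd.
  have [d /andP[rd ddl] dh] := @exists_radius R s r (2 ^- k.+1) (dl / 2) s01
    (introT andP (conj D0 Dd)) (p2 k) dl20.
  exists d => _; split; first by rewrite rE lte_fin.
    by rewrite (le_lt_trans D0 rd)/=; lra.
  rewrite /hausdorff_cost asboolF; last by move=> U0; case: Uk => y; rewrite U0.
  by rewrite rE poweR_EFin -EFinM -EFinD lee_fin.
have [d hd'] := choice hd.
have cov : K `<=` cover [set k | U k !=set0] (fun k => ball (x k) (d k)).
  move=> y /KC /CU[k _ Uky]; have Uk : U k !=set0 by exists y.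
  exists k => //; have [h _ _] := hd' _ Uk.
  by rewrite /ball/= -lte_fin; apply: le_lt_trans h; apply: le_ediam => //; exact: hx.
move: cK; rewrite compact_cover => /(_ _ _ _ _ cov)[].
  by move=> k _; exact: ball_open.
move=> D DU covD.
(* All nonempty covering sets of index below [n] are kept, so that the total cost is compared with a
   partial sum of the series. *)
pose n := (\max_(k <- enum_fset D) k).+1.
have Dn k : k \in D -> (k < n)%N.
  by move=> kD; rewrite /n ltnS; apply: (@leq_bigmax_seq _ (enum_fset D) xpredT id).
clearbody n; pose l := [seq (x k, d k) | k <- iota 0 n & `[< U k !=set0 >]].
exists l; split.
- move=> t /mapP[k]; rewrite mem_filter => /andP[/asboolP Uk _] -> /=.
  by have [_ ] := hd' _ Uk.
- move=> y /covD[k /= kD yk]; exists (x k, d k) => //; apply: map_f.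
  rewrite mem_filter mem_iota /= add0n Dn// andbT; apply/asboolP.
  exact: set_mem (DU _ kD).
rewrite big_map big_filter -lee_fin -sumEFin.
apply: (@le_trans _ _ (\sum_(k <- iota 0 n) (2%:E * hausdorff_cost s (U k) + (2 ^- k.+1)%:E))%E).
  rewrite big_mkcond/=; apply: lee_sum => k _; case: ifPn => [/asboolP Uk|_].
    by have [_ _] := hd' _ Uk.
  by apply: adde_ge0; [apply: mule_ge0 => //; exact: hausdorff_cost_ge0|
    rewrite lee_fin invr_ge0 exprn_ge0].
rewrite big_split/= [leRHS]EFinD; apply: leeD; last first.
  rewrite sumEFin lee_fin; have := sum_half_powers R n.
  by rewrite -(big_mkord xpredT (fun k => (2 : R) ^- k.+1)) /index_iota subn0.
rewrite -ge0_sume_distrr; last by move=> k _; exact: hausdorff_cost_ge0.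
rewrite [leRHS]EFinM; apply: lee_wpmul2l => //; apply: le_trans (ltW Usum).
have := @nneseries_lim_ge R (fun k => hausdorff_cost s (U k)) xpredT 0 n.
by rewrite /index_iota subn0; apply => k _ _; exact: hausdorff_cost_ge0.
Qed.

(** * Test functions, cutoffs and integrability *)

Lemma bounded_image_compact (R : realType) (S : set (R * R)) (f : R * R -> R) :
  continuous f -> compact S -> exists2 N, 0 < N & forall x, S x -> `|f x| <= N.
Proof.
move=> cf cS; have : compact (f @` S).
  by apply: continuous_compact => //; exact: continuous_subspaceT.
move=> /compact_bounded[M [_ hM]]; exists (`|M| + 1); first by rewrite ltr_wpDl.
move=> x Sx; apply: (hM (`|M| + 1)); first by rewrite (le_lt_trans (ler_norm _))// ltrDl.
by exists x.
Qed.

Lemma support0 (R : realType) (phi : R * R -> R) x :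
  ~ closure [set x | phi x != 0] x -> phi x = 0.
Proof.
by move=> nx; apply/eqP/negPn/negP => h; apply: nx; exact: subset_closure.
Qed.

Lemma partial_support0 (R : realType) (phi : R * R -> R) i x :
  ~ closure [set x | phi x != 0] x -> partial i phi x = 0.
Proof.
move=> nx; rewrite /partial -[RHS](derive_cst (0 : R) x (basis_vec R i)).
apply: near_eq_derive.
have : nbhs x (~` closure [set x | phi x != 0]).
  by apply: open_nbhs_nbhs; split => //; apply: closed_openC; exact: closed_closure.
by apply: filterS => y /support0.
Qed.

(** A point of the product set in the support of [phi] has its abscissa in [[- N, N]], so it is
    enough that [a] vanish near this compact piece of [C], or [b] near [F]; the cut-off function is
    then 0 around that point. *)
Lemma test_function_cutoff (R : realType) (C F : set R) (phi : R * R -> R)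
    (a b : R -> R) (N : R) :
  test_function setT phi -> smooth a -> smooth b ->
  (forall x, closure [set x | phi x != 0] x -> `|x.1| <= N) ->
  vanishes_near a (C `&` `[- N, N]) \/ vanishes_near b F ->
  test_function (~` (C `*` F)) (fun x => a x.1 * b x.2 * phi x).
Proof.
move=> [Ckphi cS _] sa sb hN van.
have sub : closure [set x | a x.1 * b x.2 * phi x != 0] `<=`
    closure [set x | phi x != 0].
  apply: closureS => x /=; apply: contra => /eqP ->; by rewrite mulr0.
split.
- move=> k; apply: CkM => //.
  by apply: CkM; [exact: Ck_fst|exact: Ck_snd].
- by apply: subclosed_compact cS sub; exact: closed_closure.
- move=> [x y] xs [/= Cx Fy].
  have xN : `[- N, N]%classic x.
    by rewrite /= in_itv/= -ler_norml; exact: (hN _ (sub _ xs)).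
  have [A /xs[z [/= z0 Az]] hA] : exists2 A : set (R * R), nbhs (x, y) A &
      forall z, A z -> a z.1 = 0 \/ b z.2 = 0.
    case: van => [/(_ x (conj Cx xN)) h|/(_ y Fy) h].
      exists (fst @^-1` [set x | a x = 0]); last by move=> z; left.
      exact: (@cvg_fst _ _ (nbhs x) (nbhs y)).
    exists (snd @^-1` [set x | b x = 0]); last by move=> z; right.
    exact: (@cvg_snd _ _ (nbhs x) (nbhs y)).
  move: z0; have [->|->] := hA _ Az; first by rewrite !mul0r eqxx.
  by rewrite mulr0 mul0r eqxx.
Qed.

Definition Lp_fun (R : realType) (p : R) (f : R * R -> R) :=
  measurable_fun (setT : set (mR2 R)) f /\
  (\int[@lebesgue2 R]_x (`|f x| `^ p)%:E < +oo)%E.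

Lemma Lfun_Lp_fun (R : realType) (p : R) (f : R * R -> R) : 1 <= p ->
  f \in Lfun (@lebesgue2 R) p%:E -> Lp_fun p f.
Proof.
move=> p1 hf; split; first exact: set_mem (sub_Lfun_mfun hf).
have /integrableP[_] := Lfun_integrable p1 hf; apply: le_lt_trans.
by under [leRHS]eq_integral do rewrite gee0_abs ?lee_fin ?powR_ge0//.
Qed.

Lemma Lp_funD (R : realType) (p : R) (f h : R * R -> R) : 0 <= p ->
  Lp_fun p f -> Lp_fun p h -> Lp_fun p (fun x => f x + h x).
Proof.
move=> p0 [mf If] [mh Ih]; split; first exact: measurable_funD.
have m1 := measurable_powR_norm p mf; have m2 := measurable_powR_norm p mh.
apply: (@le_lt_trans _ _ (\int[@lebesgue2 R]_x ((2 `^ p)%:E * ((`|f x| `^ p)%:E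
   + (`|h x| `^ p)%:E)))%E).
  apply: ge0_le_integral => //.
  - apply/measurable_EFinP; apply: measurable_powR_norm; exact: measurable_funD.
  - by apply: emeasurable_funM => //; apply: emeasurable_funD; exact/measurable_EFinP.
  - move=> x _; rewrite -EFinD -EFinM lee_fin.
    apply: (@le_trans _ _ ((2 * Num.max `|f x| `|h x|) `^ p)).
      rewrite ge0_ler_powR ?nnegrE// ?mulr_ge0// ?le_max ?normr_ge0//.
      apply: le_trans (ler_normD _ _) _; rewrite mulr_natl mulr2n.
      by apply: lerD; rewrite le_max lexx ?orbT.
    rewrite powRM ?le_max ?normr_ge0// ler_wpM2l ?powR_ge0//.
    by rewrite /Num.max; case: ifP => _; rewrite ?lerDl ?lerDr powR_ge0.
rewrite ge0_integralZl_EFin ?powR_ge0//; last 2 first.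
- by move=> x _; rewrite adde_ge0// lee_fin powR_ge0.
- by apply: emeasurable_funD; exact/measurable_EFinP.
rewrite ge0_integralD//; last 2 first.
- exact/measurable_EFinP.
- exact/measurable_EFinP.
by rewrite lte_mul_pinfty ?lee_fin ?powR_ge0// lte_add_pinfty.
Qed.

(** Integrability follows from [|f| <= 1 + |f|^p], the threshold inequality with [tau = 1], since
    the square has finite measure. *)
Lemma Lp_fun_mul_bounded (R : realType) (p c N : R) (f h : R * R -> R) : 1 <= p ->
  Lp_fun p f -> measurable_fun (setT : set (mR2 R)) h ->
  (forall x, `|h x| <= c) -> 0 <= N ->
  (forall x, ~ (`[- N, N] `*` `[- N, N]) x -> h x = 0) ->
  Lp_fun p (fun x => f x * h x) /\
  (@lebesgue2 R).-integrable setT (EFin \o (fun x => f x * h x)).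
Proof.
move=> p1 [mf If] mh hc N0 hN.
have p0 : 0 <= p by exact: le_trans p1.
have mfh : measurable_fun (setT : set (mR2 R)) (fun x => f x * h x).
  exact: measurable_funM.
have c0 : 0 <= c by apply: le_trans (hc 0).
have m1 := measurable_powR_norm p mf.
split; first split => //.
  apply: (@le_lt_trans _ _ (\int[@lebesgue2 R]_x ((c `^ p)%:E * (`|f x| `^ p)%:E))%E).
    apply: ge0_le_integral => //.
    - by apply/measurable_EFinP; exact: measurable_powR_norm.
    - by apply: emeasurable_funM => //; exact/measurable_EFinP.
    - move=> x _; rewrite -EFinM lee_fin normrM powRM// mulrC ler_wpM2r ?powR_ge0//.
      by rewrite ge0_ler_powR ?nnegrE.
  rewrite ge0_integralZl_EFin ?powR_ge0//; last exact/measurable_EFinP.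
  by rewrite lte_mul_pinfty ?lee_fin ?powR_ge0.
apply/integrableP; split; first exact/measurable_EFinP.
pose Q : set (mR2 R) := `[- N, N] `*` `[- N, N].
have mQ : measurable Q by apply: measurableX.
apply: (@le_lt_trans _ _ (\int[@lebesgue2 R]_x (c%:E * ((\1_Q x)%:E + (`|f x| `^ p)%:E)))%E).
  apply: ge0_le_integral => //.
  - by apply/measurable_EFinP; exact: measurableT_comp.
  - apply: emeasurable_funM => //; apply: emeasurable_funD; exact/measurable_EFinP.
  - move=> x _; rewrite -EFinD -EFinM lee_fin /=.
    have [Qx|Qx] := pselect (Q x); last first.
      by rewrite hN// mulr0 normr0 mulr_ge0// addr_ge0// powR_ge0.
    rewrite indicE mem_set// normrM mulrC ler_pM//.
    have := @le_threshold_powR R p 1 `|f x| p1 ltr01 (normr_ge0 _).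
    by rewrite powR1 mul1r.
rewrite ge0_integralZl_EFin//; last 2 first.
- by move=> x _; rewrite adde_ge0// lee_fin powR_ge0.
- by apply: emeasurable_funD; exact/measurable_EFinP.
rewrite ge0_integralD//; last 2 first.
- exact/measurable_EFinP.
- exact/measurable_EFinP.
rewrite lte_mul_pinfty ?lee_fin// lte_add_pinfty// integral_indic// setIT.
have -> : lebesgue2 R Q = (leb R `[(- N)%R, N] * leb R `[(- N)%R, N])%E.
  by apply: product_measure1E.
by rewrite !lebesgue_measure_itv/=; case: ifP => _; rewrite ?mule0 ?ltry// -EFinB -EFinM ltry.
Qed.

Lemma Lp_fun_mul_test (R : realType) (p N : R) (i : 'I_2) (U phi : R * R -> R) :
  1 <= p -> 0 <= N -> test_function setT phi ->
  (forall x, closure [set x | phi x != 0] x -> `|x.1| <= N /\ `|x.2| <= N) ->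
  Lp_fun p U ->
  [/\ Lp_fun p (fun t => U t * phi t),
      (@lebesgue2 R).-integrable setT (EFin \o (fun t => U t * phi t)),
      Lp_fun p (fun t => U t * partial i phi t)
    & (@lebesgue2 R).-integrable setT (EFin \o (fun t => U t * partial i phi t))].
Proof.
move=> p1 N0 [Ckphi cS _] hN LU.
have [cphi h1] := Ckphi 1%N; have [dphi [cdphi _]] := h1 i.
have off x : ~ (`[- N, N] `*` `[- N, N])%classic x -> ~ closure [set x | phi x != 0] x.
  by move=> nx /hN[x1 x2]; apply: nx; split; rewrite /= in_itv/= -ler_norml.
have [B1 B10 hB1] := bounded_image_compact cphi cS.
have [B2 B20 hB2] := bounded_image_compact cdphi cS.
have bphi x : `|phi x| <= B1.
  have [xS|xS] := pselect (closure [set x | phi x != 0] x); first exact: hB1.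
  by rewrite support0// normr0 ltW.
have bdphi x : `|partial i phi x| <= B2.
  have [xS|xS] := pselect (closure [set x | phi x != 0] x); first exact: hB2.
  by rewrite partial_support0// normr0 ltW.
have mphi := continuous_prod_measurable cphi.
have mdphi := continuous_prod_measurable cdphi.
have [? ?] := Lp_fun_mul_bounded p1 LU mphi bphi N0 (fun x h => support0 (off x h)).
have [? ?] := Lp_fun_mul_bounded p1 LU mdphi bdphi N0
  (fun x h => partial_support0 i (off x h)).
by split.
Qed.

Lemma Rintegral_mul_patch (R : realType) (O : set (R * R)) (u h : R * R -> R) :
  \int[@lebesgue2 R]_(x in O) (u x * h x) = \int[@lebesgue2 R]_x ((u \_ O) x * h x).
Proof.
rewrite Rintegral_mkcond; apply: eq_Rintegral => x _; rewrite !patchE.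
by case: ifP => // _; rewrite mul0r.
Qed.

(** The product rule for the admissible test function [a b phi], the term with [partial i phi] being
    moved to the other side. The bound is put on [D], the derivative of [a b] in direction [i],
    because in the applications the derivative of the other factor is provided by [smooth_derive]
    without a bound. *)
Lemma weak_partial_cutoff (R : realType) (p c N : R) (C F : set R) (i : 'I_2)
    (u v phi : R * R -> R) (a a' b b' : R -> R) :
  1 <= p -> 0 <= N -> test_function setT phi ->
  (forall x, closure [set x | phi x != 0] x -> `|x.1| <= N /\ `|x.2| <= N) ->
  Lp_fun p (u \_ (~` (C `*` F))) -> Lp_fun p (v \_ (~` (C `*` F))) ->
  weak_partial (~` (C `*` F)) i u v ->
  smooth a -> smooth b ->
  (forall x : R, is_derive x 1 a (a' x)) -> (forall x : R, is_derive x 1 b (b' x)) ->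
  (forall x, `|a x| <= c) -> (forall x, `|b x| <= c) ->
  let D := (fun x : R * R => if i == ord0 then a' x.1 * b x.2 else a x.1 * b' x.2) in
  measurable_fun (setT : set (mR2 R)) D -> (forall x, `|D x| <= c * c) ->
  vanishes_near a (C `&` `[- N, N]) \/ vanishes_near b F ->
  \int[@lebesgue2 R]_t ((u \_ (~` (C `*` F))) t * phi t * D t) =
  - \int[@lebesgue2 R]_t (((v \_ (~` (C `*` F))) t * phi t
      + (u \_ (~` (C `*` F))) t * partial i phi t) * (a t.1 * b t.2)).
Proof.
move=> p1 N0 tphi hN LU LV wk sa sb da db ac bc D mD Dc van.
set U := u \_ _ in LU *; set V := v \_ _ in LV *.
have tpsi := test_function_cutoff tphi sa sb (fun x h => (hN x h).1) van.
have := wk _ tpsi; rewrite [LHS]Rintegral_mul_patch [in RHS]Rintegral_mul_patch -/U -/V => eqn.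
have [Ckphi _ _] := tphi; have [_ h1] := Ckphi 1%N; have [dphi _] := h1 i.
have [_ iU _ idU] := Lp_fun_mul_test i p1 N0 tphi hN LU.
have [_ iV _ _] := Lp_fun_mul_test i p1 N0 tphi hN LV.
have mab : measurable_fun (setT : set (mR2 R)) (fun t => a t.1 * b t.2).
  apply: measurable_funM.
    exact: (measurableT_comp (measurable_smooth sa)).
  exact: (measurableT_comp (measurable_smooth sb)).
have abc x : `|a x.1 * b x.2| <= c * c by rewrite normrM; apply: ler_pM.
have iUD := integrable_mul_bounded mD Dc iU.
have iVab := integrable_mul_bounded mab abc iV.
have idUab := integrable_mul_bounded mab abc idU.
have E1 : \int[@lebesgue2 R]_x (U x * partial i (fun z => a z.1 * b z.2 * phi z) x) =
   \int[@lebesgue2 R]_x (U x * phi x * D x)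
   + \int[@lebesgue2 R]_x (U x * partial i phi x * (a x.1 * b x.2)).
  rewrite -RintegralD//; apply: eq_Rintegral => x _.
  by rewrite (partial_fst_snd da db)//= -/(D x); ring.
have E2 : \int[@lebesgue2 R]_x ((V x * phi x + U x * partial i phi x) * (a x.1 * b x.2)) =
   \int[@lebesgue2 R]_x (V x * phi x * (a x.1 * b x.2))
   + \int[@lebesgue2 R]_x (U x * partial i phi x * (a x.1 * b x.2)).
  by rewrite -RintegralD//; apply: eq_Rintegral => x _; rewrite mulrDl.
have E3 : \int[@lebesgue2 R]_x (V x * (a x.1 * b x.2 * phi x)) =
   \int[@lebesgue2 R]_x (V x * phi x * (a x.1 * b x.2)).
  by apply: eq_Rintegral => x _; ring.
by move: eqn; rewrite E1 E2 E3 opprD => <-; rewrite addrK.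
Qed.

Lemma weak_gradient_off_cutoff (R : realType) (p N : R) (C F : set R)
    (u v0 v1 phi : R * R -> R) :
  1 <= p -> 0 <= N -> test_function setT phi ->
  (forall x, closure [set x | phi x != 0] x -> `|x.1| <= N /\ `|x.2| <= N) ->
  let O := ~` (C `*` F) in
  Lp_fun p (u \_ O) -> Lp_fun p (v0 \_ O) -> Lp_fun p (v1 \_ O) ->
  weak_partial O ord0 u v0 -> weak_partial O ord_max u v1 ->
  weak_gradient_off (C `&` `[- N, N]) F (fun t => (u \_ O) t * phi t)
    (fun t => (v0 \_ O) t * phi t + (u \_ O) t * partial ord0 phi t)
    (fun t => (v1 \_ O) t * phi t + (u \_ O) t * partial ord_max phi t).
Proof.
move=> p1 N0 tphi hN O LU LV0 LV1 w0 w1; split.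
  move=> a a' b c sa sb da ma' bd van.
  have [b' sb' db] := smooth_derive sb.
  have := weak_partial_cutoff p1 N0 tphi hN LU LV0 w0 sa sb da db
    (fun x => let: And3 h _ _ := bd x in h) (fun x => let: And3 _ _ h := bd x in h).
  apply => //=.
    apply: measurable_funM; first exact: (measurableT_comp ma').
    exact: (measurableT_comp (measurable_smooth sb)).
  by move=> x; rewrite normrM; apply: ler_pM => //; [case: (bd x.1)|case: (bd x.2)].
move=> a b b' c sa sb db mb' bd van.
have [a' sa' da] := smooth_derive sa.
have := weak_partial_cutoff p1 N0 tphi hN LU LV1 w1 sa sb da db
  (fun x => let: And3 h _ _ := bd x in h) (fun x => let: And3 _ h _ := bd x in h).
apply => //=.
  apply: measurable_funM; first exact: (measurableT_comp (measurable_smooth sa)).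
  exact: (measurableT_comp mb').
by move=> x; rewrite normrM; apply: ler_pM => //; [case: (bd x.1)|case: (bd x.2)].
Qed.

Lemma Rintegral_cutoff_split (R : realType) (p N : R) (i : 'I_2)
    (U V phi : R * R -> R) :
  1 <= p -> 0 <= N -> test_function setT phi ->
  (forall x, closure [set x | phi x != 0] x -> `|x.1| <= N /\ `|x.2| <= N) ->
  Lp_fun p U -> Lp_fun p V ->
  let w := (fun t => V t * phi t + U t * partial i phi t) in
  [/\ Lp_fun p w, (@lebesgue2 R).-integrable setT (EFin \o w),
      (@lebesgue2 R).-integrable setT (EFin \o (fun t => U t * phi t))
    & \int[@lebesgue2 R]_t w t = \int[@lebesgue2 R]_t (V t * phi t) +
        \int[@lebesgue2 R]_t (U t * partial i phi t)].
Proof.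
move=> p1 N0 tphi hN LU LV w.
have [_ iU LdU idU] := Lp_fun_mul_test i p1 N0 tphi hN LU.
have [LVp iV _ _] := Lp_fun_mul_test i p1 N0 tphi hN LV.
have p0 : 0 <= p by apply: le_trans p1.
split; first exact: (Lp_funD p0 LVp LdU).
- exact: (integrableD measurableT iV idU).
- exact: iU.
- exact: (RintegralD measurableT iV idU).
Qed.

Lemma compact_support_bound (R : realType) (phi : R * R -> R) :
  test_function setT phi ->
  exists2 N, 0 <= N &
    forall x, closure [set x | phi x != 0] x -> `|x.1| <= N /\ `|x.2| <= N.
Proof.
move=> [_ cS _].
have c1 : continuous (fst : R * R -> R) by move=> x; exact: cvg_fst.
have c2 : continuous (snd : R * R -> R) by move=> x; exact: cvg_snd.
have [N1 N10 h1] := bounded_image_compact c1 cS.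
have [N2 N20 h2] := bounded_image_compact c2 cS.
exists (N1 + N2); first by rewrite addr_ge0// ltW.
by move=> x xS; have := h1 _ xS; have := h2 _ xS; split; lra.
Qed.

Lemma compact_slab (R : realType) (C : set R) (N : R) :
  closed C -> compact (C `&` `[- N, N]).
Proof.
by move=> cC; rewrite setIC; apply: compact_closedI => //; exact: segment_compact.
Qed.

(** * Removability of the product set *)

Lemma closed_negligible (R : realType) (s : R) (C : set R) :
  0 <= s < 1 -> closed C -> (hausdorff_measure s C < +oo)%E -> leb R C = 0%E.
Proof.
move=> /andP[s0 s1] cC Cfin.
have s01 : 0 <= s <= 1 by rewrite s0 ltW.
have [M hM] := hausdorff_small_covers s01 Cfin.
have CE : C = \bigcup_n (C `&` `[- n%:R, n%:R]).
  apply/seteqP; split => [x Cx|x [n _ []]//].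
  exists (Num.truncn `|x|).+1 => //; split => //=.
  by rewrite in_itv/= -ler_norml ltW// truncnS_gt.
rewrite CE; apply/negligibleP.
  apply: bigcup_measurable => n _; apply: closed_measurable.
  by apply: closedI => //; exact: interval_closed.
apply: negligible_bigcup => n.
have cK : closed (C `&` `[- n%:R, n%:R]) by apply: closedI => //; exact: interval_closed.
apply/negligibleP; first exact: closed_measurable.
apply: (small_covers_negligible s1 cK (hM _ _ _)); first exact: subIsetl.
exact: compact_slab.
Qed.

Lemma closed_setX (R : realType) (C F : set R) :
  closed C -> closed F -> closed (C `*` F).
Proof.
move=> cC cF.
have -> : C `*` F = (fst : R * R -> R) @^-1` C `&` (snd : R * R -> R) @^-1` F by [].
by apply: closedI; apply: closed_comp => // x _; [exact: cvg_fst|exact: cvg_snd].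
Qed.

(** Both directions are treated together since [int w = 0] relies on the weak derivative in [y] as
    well. As [w] and [z] come from the product rule, the vanishing of their integrals is exactly
    integration by parts against [phi] on the whole plane. *)
Lemma weak_partial_across (R : realType) (p s : R) (C F : set R)
    (u v0 v1 : R * R -> R) :
  1 < p -> 0 <= s < 1 -> 1 <= (1 - s) * (p - 1) ->
  closed C -> (hausdorff_measure s C < +oo)%E -> closed F ->
  {ae @lebesgue_measure R, forall y : R, F y ->
     exists r_y c_y : R, [/\ 0 < r_y, 0 < c_y &
       forall r : R, 0 < r < r_y ->
         ((c_y * r `^ ((1 - s) * (p - 1)))%:E
            <= @lebesgue_measure R (ball y r `\` F))%E]} ->
  let O := ~` (C `*` F) in
  Lp_fun p (u \_ O) -> Lp_fun p (v0 \_ O) -> Lp_fun p (v1 \_ O) ->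
  weak_partial O ord0 u v0 -> weak_partial O ord_max u v1 ->
  weak_partial setT ord0 (u \_ O) (v0 \_ O) /\
  weak_partial setT ord_max (u \_ O) (v1 \_ O).
Proof.
move=> p1 /andP[s0 s1] kap1 cC Cfin cF hF O LU L0 L1 w0 w1.
have s01 : 0 <= s <= 1 by rewrite s0 ltW.
have p1' : 1 <= p by exact: ltW.
have [M hM] := hausdorff_small_covers s01 Cfin.
suff main phi : test_function setT phi ->
    \int[@lebesgue2 R]_t ((u \_ O) t * partial ord0 phi t) =
      - (\int[@lebesgue2 R]_t ((v0 \_ O) t * phi t)) /\
    \int[@lebesgue2 R]_t ((u \_ O) t * partial ord_max phi t) =
      - (\int[@lebesgue2 R]_t ((v1 \_ O) t * phi t)).
  by split => phi tphi; [exact: (main phi tphi).1|exact: (main phi tphi).2].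
move=> tphi.
have [N N0 hN] := compact_support_bound tphi.
have cK : closed (C `&` `[- N, N]) by apply: closedI => //; exact: interval_closed.
have hK : small_covers s M (C `&` `[- N, N]).
  by apply: hM; [exact: subIsetl|exact: compact_slab].
have off := weak_gradient_off_cutoff p1' N0 tphi hN LU L0 L1 w0 w1.
have [[mw Iw] iw ig Ew] := Rintegral_cutoff_split ord0 p1' N0 tphi hN LU L0.
have [[mz Iz] iz _ Ez] := Rintegral_cutoff_split ord_max p1' N0 tphi hN LU L1.
have bd (h : R * R -> R) : (\int[lebesgue2 R]_x (`|h x| `^ p)%:E < +oo)%E ->
    (\int[@lebesgue2 R]_x (`|h x| `^ p)%:E <=
      (fine (\int[@lebesgue2 R]_x (`|h x| `^ p)%:E))%:E)%E.
  move=> hh; rewrite fineK// ge0_fin_numE//.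
  by apply: integral_ge0 => x _; rewrite lee_fin powR_ge0.
split.
  have W := Rintegral_w0 cK cF ig iw iz off p1 s1 kap1 hK (bd _ Iw) (bd _ Iz) hF.
  by apply/eqP; rewrite -addr_eq0 addrC -Ew; apply/eqP.
have Z := Rintegral_z0 cK iz off s1 hK.
by apply/eqP; rewrite -addr_eq0 addrC -Ez; apply/eqP.
Qed.

Theorem theorem1p3 (R : realType) (p s : R)
    (hp : 2 <= p) (hs0 : 0 <= s) (hs : s < (p - 2) / (p - 1))
    (C F : set R) (hC : closed C)
    (hCs : (hausdorff_measure s C < +oo)%E)
    (hF : closed F)
    (hFs : {ae @lebesgue_measure R, forall y : R, F y ->
       exists r_y c_y : R, [/\ 0 < r_y, 0 < c_y &
         forall r : R, 0 < r < r_y ->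
           ((c_y * r `^ ((1 - s) * (p - 1)))%:E
              <= @lebesgue_measure R (ball y r `\` F))%E]}) :
  p_removable p%:E (C `*` F).
Proof.
have p1 : 1 < p by lra.
have sp : s * (p - 1) < p - 2 by move: hs; rewrite ltr_pdivlMr// subr_gt0.
have s1 : 0 <= s < 1 by rewrite hs0/=; nra.
(* The assumption [s < (p - 2) / (p - 1)] amounts to [(1 - s) * (p - 1) > 1]. *)
have kap1 : 1 <= (1 - s) * (p - 1) by rewrite mulrBl mul1r; lra.
have cE := closed_setX hC hF.
have E0 : lebesgue2 R (C `*` F) = 0%E.
  have -> : lebesgue2 R (C `*` F) = (leb R C * leb R F)%E.
    by apply: product_measure1E; exact: closed_measurable.
  by rewrite (closed_negligible s1 hC hCs) mul0e.
split => // u [Lu wu].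
have p1e : (1 <= p%:E)%E by rewrite lee_fin ltW.
(* Extension by 0 across the null set gives the representative on the plane; the weak derivatives
   are extended in the same way. *)
exists (u \_ (~` (C `*` F))); split; last first.
  exists (C `*` F); split => //.
    by apply: measurableX; exact: closed_measurable.
  by move=> x /=; apply: contra_notP => nx; rewrite patchE mem_set.
have [v0 [L0 w0]] := wu ord0; have [v1 [L1 w1]] := wu ord_max.
have [W0 W1] := weak_partial_across p1 s1 kap1 hC hCs hF hFs
  (Lfun_Lp_fun (ltW p1) Lu) (Lfun_Lp_fun (ltW p1) L0) (Lfun_Lp_fun (ltW p1) L1) w0 w1.
split; first by rewrite /Lp_on patch_setT.
move=> i; have [->|->] : i = ord0 \/ i = ord_max.
- by case: i => -[|[|]]// j; [left|right]; exact/val_inj.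
- by exists (v0 \_ (~` (C `*` F))); rewrite /Lp_on patch_setT.
- by exists (v1 \_ (~` (C `*` F))); rewrite /Lp_on patch_setT.
Qed.
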